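(* Let $m>0$, $\ell_1,\ell_2,\ell_3>0$ and $\zeta\in\frac{2\pi}{\ell_3}\mathbb{Z}$. There exists a constant $C=C(m,\zeta,\mathbb{T}^2)$ such that for any $a\in[0,\sqrt{\zeta^2+m^2}]$ and any $\varphi\in W^{1,4/3}(\mathbb{T}^2,\mathbb{C}^4)$, $$\|\mathrm{Pr}_{m,\zeta}^\perp\varphi\|_{L^4}\le C\,\|\mathrm{Pr}_{m,\zeta}^\perp(\mathbf{D}_{\mathbb{T}^2}-a)\varphi\|_{L^{4/3}} .$$
   Context: $\mathbb{T}^2=\mathbb{R}^2/(\ell_1\mathbb{Z}\times\ell_2\mathbb{Z})$. $\gamma^0=\begin{pmatrix}I_2&0\\0&-I_2\end{pmatrix}$, $\gamma^k=\begin{pmatrix}0&\sigma^k\\-\sigma^k&0\end{pmatrix}$ for $k=1,2,3$, with Pauli matrices $\sigma^1=\begin{pmatrix}0&1\\1&0\end{pmatrix}$, $\sigma^2=\begin{pmatrix}0&-i\\i&0\end{pmatrix}$, $\sigma^3=\begin{pmatrix}1&0\\0&-1\end{pmatrix}$. $\mathbf{D}_{\mathbb{T}^2}:=-i\sum_{k=1}^2\gamma^0\gamma^k\partial_k+\zeta\gamma^0\gamma^3+m\gamma^0$ acts on $\mathbb{C}^4$-valued functions on $\mathbb{T}^2$; it is self-adjoint with discrete spectrum, and its lowest positive eigenvalue is $\sqrt{\zeta^2+m^2}$, with eigenspace $\mathrm{Eigen}(\mathbf{D}_{\mathbb{T}^2};\sqrt{\zeta^2+m^2})$ (a finite-dimensional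 space of constant spinors). $\mathrm{Pr}_{m,\zeta}$ is the $L^2$-orthogonal projection onto this eigenspace (extended to integrable spinors by the same pairing with an orthonormal basis of the eigenspace) and $\mathrm{Pr}_{m,\zeta}^\perp=\mathrm{Id}-\mathrm{Pr}_{m,\zeta}$. *)

(* Defs.v *)
From HB Require Import structures.
From mathcomp Require Import all_boot all_order all_algebra.
From mathcomp Require Import all_classical all_reals all_analysis.
From mathcomp Require Import complex.

Set Implicit Arguments.
Unset Strict Implicit.
Unset Printing Implicit Defensive.

Import Order.TTheory GRing.Theory Num.Theory.
Import numFieldNormedType.Exports.

Local Open Scope classical_set_scope.
Local Open Scope ring_scope.

Section GammaMatrices.
Variable R : realType.

Definition mx2 (a b c d : R[i]) : 'M[R[i]]_2 :=
  block_mx (a%:M : 'M[R[i]]_1) b%:M c%:M d%:M.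

Definition sigma1 : 'M[R[i]]_2 := mx2 0 1 1 0.
Definition sigma2 : 'M[R[i]]_2 := mx2 0 (- 'i%C) 'i%C 0.
Definition sigma3 : 'M[R[i]]_2 := mx2 1 0 0 (- 1).

Definition gamma0 : 'M[R[i]]_4 :=
  block_mx (1%:M : 'M[R[i]]_2) 0 0 (- 1%:M : 'M[R[i]]_2).

Definition gamma_of (s : 'M[R[i]]_2) : 'M[R[i]]_4 := block_mx 0 s (- s) 0.

Definition gamma1 := gamma_of sigma1.
Definition gamma2 := gamma_of sigma2.
Definition gamma3 := gamma_of sigma3.

End GammaMatrices.

(* A function on T^2 = R^2 / (l1 Z x l2 Z) is represented by the doubly periodic
   function that it induces on R^2; integrals, norms and almost-everywhere
   statements are taken over the fundamental cell [0, l1[ x [0, l2[. *)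
Section Torus.
Variables (R : realType) (l1 l2 : R).

(* [measurableTypeR R] is [R] with the sigma-algebra that carries
   [lebesgue_measure]; [plane] is convertible to [R * R]. *)
Definition plane := (measurableTypeR R * measurableTypeR R)%type.

Definition leb2 : {measure set plane -> \bar R} :=
  (@lebesgue_measure R \x @lebesgue_measure R)%E.

Definition cell : set plane := [set` `[0, l1[] `*` [set` `[0, l2[].

Definition spinor := 'cV[R[i]]_4.
Definition spinor_field := R * R -> spinor.

Definition hdot (u v : spinor) : R[i] := \sum_j (u j 0)^*%C * v j 0.
Definition spinor_norm (u : spinor) : R :=
  Num.sqrt (\sum_j ComplexField.Normc.normc (u j 0) ^+ 2).

Definition torus_fun (T : zmodType) (f : R * R -> T) : Prop :=
  periodic f (l1, 0) /\ periodic f (0, l2).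

Definition ae_eq_torus (u v : spinor_field) : Prop :=
  {ae leb2, forall x, cell x -> u x = v x}.

Definition Lp_norm (p : R) (u : spinor_field) : \bar R :=
  'N[leb2]_(p%:E)[(fun x : plane => (spinor_norm (u x))%:E) \_ cell]%E.

Definition in_Lp (p : R) (u : spinor_field) : Prop :=
  [/\ torus_fun u,
      forall j, measurable_fun cell (fun x : plane => complex.Re (u x j 0)),
      forall j, measurable_fun cell (fun x : plane => complex.Im (u x j 0))
    & (Lp_norm p u < +oo)%E].

Definition cintegral (f : R * R -> R[i]) : R[i] :=
  Complex (\int[leb2]_(x in cell) complex.Re (f x))
          (\int[leb2]_(x in cell) complex.Im (f x)).

Definition L2_inner (u v : spinor_field) : R[i] :=
  cintegral (fun x => hdot (u x) (v x)).

Fixpoint Cn (n : nat) (f : R * R -> R) : Prop :=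
  continuous f /\
  (if n is n'.+1 then
     forall v : R * R, (forall x, derivable f x v) /\ Cn n' ('D_v f)
   else True).

Definition test_fun (f : R * R -> R) : Prop :=
  torus_fun f /\ forall n, Cn n f.

Definition e1 : R * R := (1, 0).
Definition e2 : R * R := (0, 1).

(* [w] is the weak derivative of [u] in the direction [v] on the torus. *)
Definition weak_derivative (v : R * R) (u w : spinor_field) : Prop :=
  forall f, test_fun f -> forall j,
    cintegral (fun x => ('D_v f x)%:C%C * u x j 0) =
    - cintegral (fun x => (f x)%:C%C * w x j 0).

Definition in_W1p (p : R) (u : spinor_field) : Prop :=
  in_Lp p u /\
  forall v, v = e1 \/ v = e2 ->
    exists2 w, in_Lp p w & weak_derivative v u w.

(* A representative of the weak derivative, unique up to null sets; 0 by
   default when [u] has no integrable weak derivative. *)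
Definition wpartial (v : R * R) (u : spinor_field) : spinor_field :=
  xget (fun=> 0) [set w | in_Lp 1 w /\ weak_derivative v u w].

Definition Dirac (m zeta : R) (u : spinor_field) : spinor_field := fun x =>
  - 'i%C *: (gamma0 R *m gamma1 R *m wpartial e1 u x
             + gamma0 R *m gamma2 R *m wpartial e2 u x)
  + zeta%:C%C *: (gamma0 R *m gamma3 R *m u x)
  + m%:C%C *: (gamma0 R *m u x).

(* The self-adjoint realisation of the Dirac operator has domain W^{1,2}. *)
Definition Eigen (m zeta lambda : R) : set spinor_field :=
  [set u | in_W1p 2 u /\
           ae_eq_torus (Dirac m zeta u) (fun x => lambda%:C%C *: u x)].

Definition orthonormal_basis (V : set spinor_field) (e : seq spinor_field) :
    Prop :=
  let e_ i := nth (fun=> 0) e i in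
  [/\ forall i, (i < size e)%N -> V (e_ i),
      forall i j, (i < size e)%N -> (j < size e)%N ->
        L2_inner (e_ i) (e_ j) = (i == j)%:R
    & forall u, V u ->
        ae_eq_torus u (fun x => \sum_(i < size e) L2_inner (e_ i) u *: e_ i x)].

Definition eigenbasis (m zeta : R) : seq spinor_field :=
  xget [::]
    (orthonormal_basis (Eigen m zeta (Num.sqrt (zeta ^+ 2 + m ^+ 2)))).

Definition Pr (m zeta : R) (u : spinor_field) : spinor_field := fun x =>
  \sum_(e <- eigenbasis m zeta) L2_inner e u *: e x.

Definition Pr_perp (m zeta : R) (u : spinor_field) : spinor_field := fun x =>
  u x - Pr m zeta u x.

End Torus.

(* Main.v *)
Require Import Defs.
From HB Require Import structures.
From mathcomp Require Import all_boot all_order all_algebra.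
From mathcomp Require Import all_classical all_reals all_analysis.
From mathcomp Require Import measurable_realfun complex.
From mathcomp Require Import zify ring lra.

Set Implicit Arguments.
Unset Strict Implicit.
Unset Printing Implicit Defensive.

Import Order.TTheory GRing.Theory Num.Theory.
Import numFieldNormedType.Exports.
Import HBSimple HBNNSimple.

Local Open Scope classical_set_scope.
Local Open Scope ring_scope.

(** On the Fourier mode [n] the Dirac operator acts by a Hermitian matrix whose
    square is the scalar [energy n ^+ 2 = |k n|^2 + zeta^2 + m^2], where [k n] is
    the frequency of the mode. For [n != 0] the gap between [energy n] and
    [lam = sqrt (zeta^2 + m^2)] grows linearly with [n] ([spectral_gap]). On the
    zero mode the eigenvalues are [lam] and [-lam], and the projection removes
    precisely the first. Hence, if [psi = Pr_perp phi] and
    [g = Pr_perp (D - a) phi] with [0 <= a <= lam], the Fourier coefficients obey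
    [c (1 + |n|) |psi n| <= |g n|] with [c] independent of [a]
    ([Pr_perp_coercive]).

    It remains to see that such a gain of one derivative takes L^(4/3) to L^4.
    In dimension two H^(1/2) embeds in L^4, and dually L^(4/3) embeds in
    H^(-1/2); each embedding costs half a derivative. For trigonometric
    polynomials the first one is a discrete inequality: the L^4 norm is the l^2
    norm of the autocorrelation of the coefficients, bounded by weighted
    Cauchy-Schwarz ([convolution_square_le], [tpoly_L4_le]). Pairing an L^(4/3)
    function with the right polynomial gives the second one ([fcoef_dual_le]).

    The first embedding is also needed for [psi], known only to be integrable and
    to have weighted square-summable coefficients. Here [psi] is paired with the
    cube of a simple function below the positive part of its real part
    ([nnsfun_below_L4_le]). The pairing is computed on trigonometric polynomials,
    through their density in L^2(rho dx) for [rho = 1 + |psi|]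
    ([approximable_indic], [approximable_pairing_le]), a density which follows
    from explicit approximations of half-lines ([half_line_approx]) by Dynkin's
    theorem. When all the coefficients vanish, the same estimate yields the
    uniqueness of Fourier series ([vfcoef_inj]); this identifies the eigenspace
    with the constants in an eigenspace of the symbol at 0, and so gives the
    projection ([Pr_ae]). *)

(** * Lattice sums and a discrete convolution inequality *)

(** By induction on the sequence. The cross term [2 S a_i b_i] is at most
    [p + q], where [p] and [q] are the cross terms of the product on the right:
    [p q = A B (a_i b_i)^2 >= S^2 (a_i b_i)^2] by induction, and
    [4 p q <= (p + q)^2]. *)
Lemma cauchy_schwarz_weighted (R : realFieldType) (I : eqType) (s : seq I)
    (P : pred I) (w a b : I -> R) :
  (forall i, 0 < w i) ->
  (\sum_(i <- s | P i) a i * b i) ^+ 2 <=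
  (\sum_(i <- s | P i) w i * a i ^+ 2) * (\sum_(i <- s | P i) b i ^+ 2 / w i).
Proof.
move=> w0; elim: s => [|i s IH]; first by rewrite !big_nil expr0n mul0r.
rewrite !big_cons; case: (P i) => //.
set S := \sum_(j <- s | P j) a j * b j in IH *.
set A := \sum_(j <- s | P j) w j * _ in IH *.
set B := \sum_(j <- s | P j) _ / w j in IH *.
have A0 : 0 <= A.
  by apply: sumr_ge0 => j _; rewrite mulr_ge0 ?sqr_ge0 ?(ltW (w0 _))//.
have B0 : 0 <= B.
  by apply: sumr_ge0 => j _; rewrite mulr_ge0 ?sqr_ge0 ?invr_ge0 ?(ltW (w0 _))//.
set p := A * (b i ^+ 2 / w i); set q := w i * a i ^+ 2 * B.
have w0i := ltW (w0 i).
have p0 : 0 <= p by rewrite /p mulr_ge0 ?divr_ge0 ?sqr_ge0.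
have q0 : 0 <= q := mulr_ge0 (mulr_ge0 w0i (sqr_ge0 _)) B0.
have pq : p * q = A * B * (a i * b i) ^+ 2.
  by rewrite /p /q; field; rewrite gt_eqF.
have cross : 2 * (S * (a i * b i)) <= p + q.
  have [neg|pos] := leP (S * (a i * b i)) 0.
    have : 0 <= p + q by exact: addr_ge0.
    by move: neg; lra.
  rewrite -ler_sqr ?nnegrE ?addr_ge0//; last by move: pos; lra.
  apply: (@le_trans _ _ (4 * (p * q))).
    have -> : (2 * (S * (a i * b i))) ^+ 2 = 4 * (S ^+ 2 * (a i * b i) ^+ 2).
      by ring.
    by rewrite ler_pM2l ?ltr0n// pq ler_wpM2r ?sqr_ge0.
  rewrite -subr_ge0; have -> : (p + q) ^+ 2 - 4 * (p * q) = (p - q) ^+ 2 by ring.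
  exact: sqr_ge0.
have -> : (a i * b i + S) ^+ 2 =
    (a i * b i) ^+ 2 + 2 * (S * (a i * b i)) + S ^+ 2 by ring.
have -> : (w i * a i ^+ 2 + A) * (b i ^+ 2 / w i + B) =
    (a i * b i) ^+ 2 + (p + q) + A * B.
  by rewrite /p /q; field; rewrite gt_eqF.
by rewrite lerD// lerD2l.
Qed.

Lemma sum_reindex_le (R : realDomainType) (I J : eqType) (s : seq I)
    (t : seq J) (P : pred I) (g : I -> J) (f : J -> R) :
  uniq s -> uniq t -> injective g -> (forall j, 0 <= f j) ->
  (forall i, i \in s -> P i -> g i \notin t -> f (g i) = 0) ->
  \sum_(i <- s | P i) f (g i) <= \sum_(j <- t) f j.
Proof.
move=> us ut ginj f0 fg.
rewrite (bigID (fun i => g i \in t)) /= [X in _ + X]big1_seq ?addr0; last first.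
  by move=> i /andP[/andP[Pi gi] si]; exact: fg.
rewrite -big_filter -(big_map g xpredT f).
set u := map g _.
have uu : uniq u by rewrite map_inj_uniq// filter_uniq.
have sub : {subset u <= t}.
  by move=> j /mapP[k]; rewrite mem_filter => /andP[/andP[_ +] _] ->.
rewrite [leRHS](bigID (mem u)) /=.
have -> : \sum_(j <- t | j \in u) f j = \sum_(j <- u) f j.
  rewrite -big_filter; apply: perm_big; apply: uniq_perm => //.
    exact: filter_uniq.
  by move=> j; rewrite mem_filter; case: (boolP (j \in u)) => //= /sub ->.
by rewrite lerDl sumr_ge0.
Qed.

Lemma sum_reindex (R : nmodType) (I J : eqType) (s : seq I) (t : seq J)
    (g : I -> J) (f : J -> R) :
  uniq s -> uniq t -> injective g -> {subset t <= map g s} ->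
  (forall i, i \in s -> g i \notin t -> f (g i) = 0) ->
  \sum_(i <- s) f (g i) = \sum_(j <- t) f j.
Proof.
move=> us ut ginj ts fg.
rewrite -(big_map g xpredT f) (bigID (mem t)) /= [X in _ + X]big1_seq ?addr0.
  rewrite -big_filter; apply: perm_big; apply: uniq_perm => //.
    by rewrite filter_uniq// map_inj_uniq.
  by move=> j; rewrite mem_filter; case: (boolP (j \in t)) => //= /ts.
by move=> j /andP[jt /mapP[i si jE]]; rewrite jE fg -?jE.
Qed.

Section LatticeBoxes.

Definition zrange (N : nat) : seq int :=
  [seq i%:Z - N%:Z | i <- iota 0 N.*2.+1].
Definition zbox (N : nat) : seq (int * int) :=
  [seq (a, b) | a <- zrange N, b <- zrange N].
Definition supn (n : int * int) : nat := maxn `|n.1| `|n.2|.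

Lemma mem_zrange N a : (a \in zrange N) = (`|a| <= N)%N.
Proof.
apply/mapP/idP => [[k]|aN].
  by rewrite mem_iota => /andP[_ kN] ->; lia.
exists (absz (a + N%:Z)); last by lia.
by rewrite mem_iota; lia.
Qed.

Lemma uniq_zrange N : uniq (zrange N).
Proof. by rewrite map_inj_uniq ?iota_uniq// => i j; lia. Qed.

Lemma mem_zbox N n : (n \in zbox N) = (supn n <= N)%N.
Proof.
case: n => a b; rewrite geq_max /= -!mem_zrange.
apply/allpairsP/andP => [[[x y]/= [xN yN [-> ->]]]//|[aN bN]].
by exists (a, b).
Qed.

Lemma uniq_zbox N : uniq (zbox N).
Proof. by apply: allpairs_uniq; rewrite ?uniq_zrange// => -[a b] [c d]. Qed.

Lemma size_zbox N : size (zbox N) = (N.*2.+1 ^ 2)%N.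
Proof. by rewrite size_allpairs !size_map !size_iota. Qed.

Lemma leq_supnD m n : (supn (m + n)%R <= supn m + supn n)%N.
Proof. by case: m n => a b [c d]; rewrite /supn /= ; lia. Qed.

Lemma supnN n : supn (- n) = supn n.
Proof. by case: n => a b; rewrite /supn /=; lia. Qed.

Variable R : realFieldType.

(** The weight of the Sobolev space H^(1/2): it is comparable with
    [(1 + |n|^2)^(1/2)], and the sup norm of [n] makes lattice sums easy. *)
Definition wgt (n : int * int) : R := (supn n).+1%:R.

Lemma wgt_gt0 n : 0 < wgt n. Proof. by rewrite ltr0n. Qed.

(** The shell [max(i, j) = r] has [2 r + 1] points of weight [r + 1], so
    each shell contributes less than 2. *)
Lemma sum_quadrant (r : nat) :
  \sum_(i < r) \sum_(j < r) (maxn i j).+1%:R^-1 <= 2 * r%:R :> R.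
Proof.
elim: r => [|r IH]; first by rewrite big_ord0 mulr0.
rewrite big_ord_recr /=.
under eq_bigr do rewrite big_ord_recr /=.
rewrite big_split /= big_ord_recr /= maxnn.
have E (i : 'I_r) : (maxn i r).+1%:R^-1 = r.+1%:R^-1 :> R.
  by rewrite (maxn_idPr (ltnW (ltn_ord i))).
have E' (i : 'I_r) : (maxn r i).+1%:R^-1 = r.+1%:R^-1 :> R.
  by rewrite maxnC E.
rewrite (eq_bigr _ (fun i _ => E i)) (eq_bigr _ (fun i _ => E' i)).
rewrite !sumr_const card_ord.
rewrite -addrA [r.+1%:R in leRHS]mulrSr mulrDr mulr1; apply: lerD => //.
rewrite addrA -mulrnDr -mulrSr -[leLHS]mulr_natr.
by rewrite mulrC ler_pdivrMr ?ltr0n// -natrM ler_nat; lia.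
Qed.

(** Shells again: the square has four quadrants, each of which is covered by
    [sum_quadrant]. *)
Lemma sum_zbox_wgtV N : \sum_(n <- zbox N) (wgt n)^-1 <= 8 * N.+1%:R.
Proof.
have dbl (F : nat -> R) : (forall i, 0 <= F i) ->
    \sum_(a <- zrange N) F `|a|%N <= 2 * \sum_(i < N.+1) F i.
  move=> F0; rewrite big_map -(big_mkord xpredT) /index_iota subn0.
  rewrite -addnn -addnS iotaD big_cat mulr_natl mulr2n add0n; apply: lerD.
    rewrite (eq_bigr (fun i => F (absz (i%:Z - N%:Z))))//.
    rewrite (_ : \sum_(_ <- _) _ = \sum_(i < N) F (N - i)%N); last first.
      rewrite -[iota 0 N](_ : index_iota 0 N = _); last by rewrite /index_iota subn0.
      rewrite big_mkord; apply: eq_bigr => i _; congr F; have := ltn_ord i; lia.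
    rewrite -(big_mkord xpredT (fun i => F (N - i)%N)).
    rewrite -[iota 0 N.+1](_ : index_iota 0 N.+1 = _); last by rewrite /index_iota subn0.
    rewrite big_nat_recl//= big_nat_rev /= add0n.
    rewrite (_ : \sum_(0 <= i < N) _ = \sum_(0 <= i < N) F i.+1); last first.
      by rewrite !big_nat; apply: eq_bigr => i iN; congr F; lia.
    by rewrite lerDr.
  rewrite -[N in iota N _]addn0 iotaDl big_map.
  by apply: ler_sum => i _; rewrite (_ : `|_|%N = i)//; lia.
rewrite big_allpairs /=.
apply: (@le_trans _ _ (2 * \sum_(i < N.+1)
    \sum_(b <- zrange N) (maxn i `|b|).+1%:R^-1)).
  apply: (dbl (fun i => \sum_(b <- zrange N) (maxn i `|b|).+1%:R^-1)) => i.
  by apply: sumr_ge0 => b _; rewrite invr_ge0.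
have -> : 8 * N.+1%:R = 2 * (2 * (2 * N.+1%:R)) :> R by ring.
rewrite ler_pM2l ?ltr0n//.
apply: le_trans (_ : 2 * (\sum_(i < N.+1) \sum_(j < N.+1) (maxn i j).+1%:R^-1) <= _).
  rewrite mulr_sumr; apply: ler_sum => i _.
  by apply: (dbl (fun j => (maxn i j).+1%:R^-1)) => j; rewrite invr_ge0.
by rewrite ler_pM2l ?ltr0n// sum_quadrant.
Qed.

(** Since [wgt k <= wgt n + wgt (n + k)], the summand is at most
    [(1 / wgt n + 1 / wgt (n + k)) / wgt k]. On the range [|n| <= 2 |k|] the
    lattice sums of both reciprocals are [O(wgt k)]. *)
Lemma sum_near_wgtV N k :
  \sum_(n <- zbox N | (supn n <= (supn k).*2)%N) (wgt (n + k) * wgt n)^-1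
    <= 40.
Proof.
set K := supn k.
apply: (@le_trans _ _ (\sum_(n <- zbox N | (supn n <= K.*2)%N)
    ((wgt n)^-1 + (wgt (n + k))^-1) / K.+1%:R)).
  apply: ler_sum => n _; rewrite ler_pdivlMr ?ltr0n//.
  have -> : (wgt n)^-1 + (wgt (n + k))^-1 =
      (wgt (n + k) * wgt n)^-1 * (wgt n + wgt (n + k)).
    have h i : wgt i != 0 by rewrite gt_eqF// wgt_gt0.
    by move: (wgt n) (wgt (n + k)) (h n) (h (n + k)) => x y x0 y0; field;
       rewrite x0.
  rewrite ler_pM2l ?invr_gt0 ?mulr_gt0 ?wgt_gt0// -natrD ler_nat.
  have := leq_supnD (n + k) (- n); rewrite addrC addKr supnN -/K; lia.
rewrite -mulr_suml ler_pdivrMr ?ltr0n// big_split /=.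
have B1 : \sum_(n <- zbox N | (supn n <= K.*2)%N) (wgt n)^-1
    <= 8 * (K.*2).+1%:R.
  apply: le_trans (sum_zbox_wgtV K.*2).
  apply: (@sum_reindex_le _ _ _ _ _ _ id (fun n => (wgt n)^-1)).
  - exact: uniq_zbox.
  - exact: uniq_zbox.
  - by [].
  - by move=> j; rewrite invr_ge0 ltW ?wgt_gt0.
  - by move=> n _ nK; rewrite mem_zbox nK.
have B2 : \sum_(n <- zbox N | (supn n <= K.*2)%N) (wgt (n + k))^-1
    <= 8 * (K.*2 + K).+1%:R.
  apply: le_trans (sum_zbox_wgtV (K.*2 + K)).
  apply: (@sum_reindex_le _ _ _ _ _ _ (fun n => n + k) (fun n => (wgt n)^-1)).
  - exact: uniq_zbox.
  - exact: uniq_zbox.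
  - exact: addIr.
  - by move=> j; rewrite invr_ge0 ltW ?wgt_gt0.
  - move=> n _ nK; rewrite mem_zbox -/K => /negP; case.
    apply: leq_trans (leq_supnD _ _) _; rewrite -/K; lia.
apply: le_trans (lerD B1 B2) _.
rewrite -!natrM -natrD ler_nat; lia.
Qed.

(** This is H^(1/2) in L^4 on the Fourier side. The autocorrelation of [a]
    at [k] is split according to whether [|n| <= 2 |k|]. For such near terms
    Cauchy-Schwarz with the weight [wgt (n + k) wgt n] and [sum_near_wgtV]
    bound the square by 40 times the autocorrelation of [wgt a^2], whose total
    mass is [D^2]. For the far terms [n] and [n + k] are comparable:
    Cauchy-Schwarz with the weight [wgt (n + k)] leaves [2 a n ^+ 2 / wgt n], and
    each [n] is far from at most [|n|^2] values of [k]. The constant is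
    [2 (40 + 2)]. *)
Lemma convolution_square_le N (a : int * int -> R) :
  (forall n, 0 <= a n) -> (forall n, n \notin zbox N -> a n = 0) ->
  \sum_(k <- zbox N.*2) (\sum_(n <- zbox N) a (n + k) * a n) ^+ 2
    <= 84 * (\sum_(n <- zbox N) wgt n * a n ^+ 2) ^+ 2.
Proof.
move=> a0 aN; set D := \sum_(n <- zbox N) wgt n * a n ^+ 2.
have d0 n : 0 <= wgt n * a n ^+ 2 by rewrite mulr_ge0 ?sqr_ge0 ?ltW ?wgt_gt0.
have D0 : 0 <= D by exact: sumr_ge0.
pose near k n := (supn n <= (supn k).*2)%N.
have shift (Q : pred (int * int)) k :
    \sum_(n <- zbox N | Q n) wgt (n + k) * a (n + k) ^+ 2 <= D.
  apply: (@sum_reindex_le _ _ _ _ _ _ (fun n => n + k)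
    (fun n => wgt n * a n ^+ 2)); rewrite ?uniq_zbox//; first exact: addIr.
  by move=> n _ _ /aN ->; rewrite expr0n mulr0.
have shift' (n : int * int) :
    \sum_(k <- zbox N.*2) wgt (n + k) * a (n + k) ^+ 2 <= D.
  apply: (@sum_reindex_le _ _ _ _ _ _ (fun k => n + k)
    (fun n => wgt n * a n ^+ 2)); rewrite ?uniq_zbox//.
  by move=> k _ _ /aN ->; rewrite expr0n mulr0.
have ppos n k : 0 < wgt (n + k) * wgt n by rewrite mulr_gt0 ?wgt_gt0.
have nearB : \sum_(k <- zbox N.*2)
    (\sum_(n <- zbox N | near k n) a (n + k) * a n) ^+ 2 <= 40 * D ^+ 2.
  apply: (@le_trans _ _ (\sum_(k <- zbox N.*2) 40 * \sum_(n <- zbox N)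
      (wgt (n + k) * a (n + k) ^+ 2) * (wgt n * a n ^+ 2))).
    apply: ler_sum => k _.
    have := @cauchy_schwarz_weighted _ _ (zbox N) (near k)
      (fun n => wgt (n + k) * wgt n) (fun n => a (n + k) * a n)
      (fun=> 1) (fun n => ppos n k).
    under eq_bigr do rewrite mulr1.
    move=> /le_trans; apply.
    rewrite mulrC; apply: ler_pM.
    - by apply: sumr_ge0 => n _; rewrite mulr_ge0 ?sqr_ge0 ?invr_ge0 ?(ltW (ppos n k)).
    - by apply: sumr_ge0 => n _; rewrite mulr_ge0 ?sqr_ge0 ?(ltW (ppos n k)).
    - under eq_bigr do rewrite expr1n mul1r.
      exact: sum_near_wgtV.
    - rewrite [leRHS](bigID (near k)) /=.
      rewrite [X in X + _](eq_bigr (fun n => wgt (n + k) * wgt n * (a (n + k) * a n) ^+ 2));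
        last by move=> n _; ring.
      by rewrite lerDl sumr_ge0// => n _; exact: mulr_ge0.
  rewrite -mulr_sumr ler_pM2l ?ltr0n// exchange_big /=.
  under eq_bigr do rewrite -mulr_suml.
  rewrite expr2 {2}/D mulr_sumr; apply: ler_sum => n _.
  by rewrite ler_wpM2r.
have farB : \sum_(k <- zbox N.*2)
    (\sum_(n <- zbox N | ~~ near k n) a (n + k) * a n) ^+ 2 <= 2 * D ^+ 2.
  apply: (@le_trans _ _ (\sum_(k <- zbox N.*2) D * \sum_(n <- zbox N)
     (if ~~ near k n then 2 * (a n ^+ 2 / wgt n) else 0))).
    apply: ler_sum => k _.
    have := @cauchy_schwarz_weighted _ _ (zbox N) (fun n => ~~ near k n)
      (fun n => wgt (n + k)) (fun n => a (n + k)) a (fun n => wgt_gt0 (n + k)).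
    move=> /le_trans; apply; apply: ler_pM.
    - exact: sumr_ge0.
    - by apply: sumr_ge0 => n _; rewrite mulr_ge0 ?sqr_ge0 ?invr_ge0 ?ltW ?wgt_gt0.
    - exact: shift.
    - rewrite -big_mkcond /=; apply: ler_sum => n; rewrite /near -ltnNge => nk.
      rewrite mulrCA ler_wpM2l ?sqr_ge0//.
      rewrite -[leLHS]mul1r ler_pdivrMr ?wgt_gt0// mulrAC ler_pdivlMr ?wgt_gt0//.
      rewrite mul1r -natrM ler_nat.
      have := leq_supnD (n + k) (- k); rewrite addrK supnN; lia.
  rewrite -mulr_sumr expr2 mulrCA ler_wpM2l// exchange_big /=.
  rewrite {1}/D mulr_sumr; apply: ler_sum => n _.
  rewrite -big_mkcond /= big_const_seq iter_addr addr0.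
  case: (posnP (supn n)) => n0.
    rewrite (eq_count (a2 := pred0)) ?count_pred0; last first.
      by move=> k; rewrite /near n0.
    by rewrite mulr0n mulr_ge0.
  (* Being far from [n] means [2 |k| < |n|], so such [k] fill a box of half-side
     [(|n| - 1) / 2], which has at most [|n|^2] points. *)
  have cnt : (count (fun k => ~~ near k n) (zbox N.*2) <= supn n ^ 2)%N.
    set r := (supn n).-1./2.
    apply: (@leq_trans (size (zbox r))).
      rewrite -size_filter; apply: uniq_leq_size; first by rewrite filter_uniq ?uniq_zbox.
      move=> k; rewrite mem_filter !mem_zbox /near -ltnNge => /andP[kn _].
      rewrite /r; have := odd_double_half (supn n).-1.
      lia.
    rewrite size_zbox leq_exp2r// /r.
    have := odd_double_half (supn n).-1; lia.
  rewrite -[leLHS]mulr_natr -mulrA ler_pM2l ?ltr0n// mulrAC.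
  rewrite ler_pdivrMr ?wgt_gt0// [leRHS]mulrAC [leRHS]mulrC.
  apply: ler_wpM2l; first exact: sqr_ge0.
  rewrite -natrM ler_nat.
  by apply: leq_trans cnt _; rewrite expnS expn1; apply: leq_mul; exact: leqnSn.
apply: (@le_trans _ _ (\sum_(k <- zbox N.*2)
   (2 * (\sum_(n <- zbox N | near k n) a (n + k) * a n) ^+ 2 +
    2 * (\sum_(n <- zbox N | ~~ near k n) a (n + k) * a n) ^+ 2))).
  apply: ler_sum => k _; rewrite (bigID (near k)) /=.
  set x := \sum_(_ <- _ | _) _; set y := \sum_(_ <- _ | _) _.
  rewrite -subr_ge0.
  have -> : 2 * x ^+ 2 + 2 * y ^+ 2 - (x + y) ^+ 2 = (x - y) ^+ 2 by ring.
  exact: sqr_ge0.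
rewrite big_split /= -!mulr_sumr.
move: nearB farB; lra.
Qed.

End LatticeBoxes.

(** * Integrals of complex-valued functions *)

Section SquaredModulus.
Variable R : realType.
Implicit Types z u : R[i].

Definition sqn z : R := complex.Re z ^+ 2 + complex.Im z ^+ 2.

Lemma ReD z u : complex.Re (z + u) = complex.Re z + complex.Re u.
Proof. by case: z u => a b [c d]. Qed.
Lemma ImD z u : complex.Im (z + u) = complex.Im z + complex.Im u.
Proof. by case: z u => a b [c d]. Qed.
Lemma ReN z : complex.Re (- z) = - complex.Re z.
Proof. by case: z => a b. Qed.
Lemma ImN z : complex.Im (- z) = - complex.Im z.
Proof. by case: z => a b. Qed.
Lemma ReM z u : complex.Re (z * u) =
  complex.Re z * complex.Re u - complex.Im z * complex.Im u.
Proof. by case: z u => a b [c d]. Qed.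
Lemma ImM z u : complex.Im (z * u) =
  complex.Re z * complex.Im u + complex.Im z * complex.Re u.
Proof. by case: z u => a b [c d]. Qed.
Lemma ReJ z : complex.Re (z^*%C) = complex.Re z.
Proof. by case: z. Qed.
Lemma ImJ z : complex.Im (z^*%C) = - complex.Im z.
Proof. by case: z. Qed.

(** Reduces the real and imaginary parts of a polynomial expression to those
    of its atoms. *)
Definition ReImE := (ReD, ImD, ReN, ImN, ReM, ImM, ReJ, ImJ).

Lemma conjcD z u : (z + u)^*%C = z^*%C + u^*%C.
Proof. exact: rmorphD. Qed.
Lemma conjcN z : (- z)^*%C = - z^*%C.
Proof. exact: rmorphN. Qed.
Lemma conjcM z u : (z * u)^*%C = z^*%C * u^*%C.
Proof. exact: rmorphM. Qed.

Lemma complex_ext z u :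
  complex.Re z = complex.Re u -> complex.Im z = complex.Im u -> z = u.
Proof. by case: z u => a b [c d] /= -> ->. Qed.

Lemma Re_sum (I : Type) (s : seq I) (P : pred I) (F : I -> R[i]) :
  complex.Re (\sum_(i <- s | P i) F i) = \sum_(i <- s | P i) complex.Re (F i).
Proof. by apply: (big_morph (@complex.Re R)) => //; exact: ReD. Qed.

Lemma Im_sum (I : Type) (s : seq I) (P : pred I) (F : I -> R[i]) :
  complex.Im (\sum_(i <- s | P i) F i) = \sum_(i <- s | P i) complex.Im (F i).
Proof. by apply: (big_morph (@complex.Im R)) => //; exact: ImD. Qed.

Lemma sqn_ge0 z : 0 <= sqn z.
Proof. by rewrite addr_ge0// sqr_ge0. Qed.

Lemma sqn_eq0 z : sqn z = 0 -> z = 0.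
Proof.
case: z => a b /eqP; rewrite /sqn /= paddr_eq0 ?sqr_ge0// !sqrf_eq0.
by move=> /andP[/eqP -> /eqP ->].
Qed.

Lemma sqn0 : sqn 0 = 0.
Proof. by rewrite /sqn /= expr0n addr0. Qed.

Lemma sqnM z u : sqn (z * u) = sqn z * sqn u.
Proof. by rewrite /sqn !ReImE; ring. Qed.

Lemma sqnN z : sqn (- z) = sqn z.
Proof. by rewrite /sqn !ReImE !sqrrN. Qed.

Lemma sqnJ z : sqn z^*%C = sqn z.
Proof. by rewrite /sqn !ReImE sqrrN. Qed.

Lemma sqn_real (x : R) : sqn x%:C%C = x ^+ 2.
Proof. by rewrite /sqn /= expr0n addr0. Qed.

Lemma mulJc z : z * z^*%C = (sqn z)%:C%C.
Proof. by apply: complex_ext; rewrite !ReImE /sqn /=; ring. Qed.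

Lemma sqnD_le z u : sqn (z + u) <= 2 * sqn z + 2 * sqn u.
Proof.
rewrite /sqn !ReImE -subr_ge0.
rewrite [X in 0 <= X](_ : _ = (complex.Re z - complex.Re u) ^+ 2 +
  (complex.Im z - complex.Im u) ^+ 2); last by ring.
by rewrite addr_ge0 ?sqr_ge0.
Qed.

Definition modc z : R := Num.sqrt (sqn z).

Lemma modc_ge0 z : 0 <= modc z. Proof. exact: sqrtr_ge0. Qed.

Lemma sqr_modc z : modc z ^+ 2 = sqn z.
Proof. by rewrite sqr_sqrtr ?sqn_ge0. Qed.

Lemma modcM z u : modc (z * u) = modc z * modc u.
Proof. by rewrite /modc sqnM sqrtrM ?sqn_ge0. Qed.

Lemma modcJ z : modc z^*%C = modc z.
Proof. by rewrite /modc sqnJ. Qed.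

Lemma normr_Re_le z : `|complex.Re z| <= modc z.
Proof. by rewrite -sqrtr_sqr ler_wsqrtr// lerDl sqr_ge0. Qed.

Lemma normr_Im_le z : `|complex.Im z| <= modc z.
Proof. by rewrite -sqrtr_sqr ler_wsqrtr// lerDr sqr_ge0. Qed.

Lemma Re_le_modc z : complex.Re z <= modc z.
Proof. exact: le_trans (ler_norm _) (normr_Re_le z). Qed.

Lemma modc0 : modc 0 = 0. Proof. by rewrite /modc sqn0 sqrtr0. Qed.

Lemma modcD_le z u : modc (z + u) <= modc z + modc u.
Proof.
rewrite -ler_sqr ?nnegrE ?modc_ge0 ?addr_ge0 ?modc_ge0// sqr_modc sqrrD !sqr_modc.
rewrite /sqn !ReImE.
have : complex.Re (z * u^*%C) <= modc z * modc u.
  by rewrite -[modc u]modcJ -modcM Re_le_modc.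
rewrite !ReImE mulrN opprK; set p := modc z * modc u; rewrite -[p *+ 2]mulr_natl.
by move: p => p; nra.
Qed.

Lemma modc_sum_le (I : Type) (s : seq I) (P : pred I) (F : I -> R[i]) :
  modc (\sum_(i <- s | P i) F i) <= \sum_(i <- s | P i) modc (F i).
Proof.
elim: s => [|i s IH]; first by rewrite !big_nil modc0.
rewrite !big_cons; case: (P i) => //.
by apply: le_trans (modcD_le _ _) _; rewrite lerD2l.
Qed.

End SquaredModulus.

Section ComplexIntegral.
Context d (T : measurableType d) (R : realType).
Variables (mu : {measure set T -> \bar R}) (D : set T).
Hypothesis mD : measurable D.

Definition cint (f : T -> R[i]) : R[i] :=
  Complex (\int[mu]_(x in D) complex.Re (f x))
          (\int[mu]_(x in D) complex.Im (f x)).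

Definition rintegrable (f : T -> R) := mu.-integrable D (EFin \o f).

Definition cintegrable (f : T -> R[i]) :=
  rintegrable (fun x => complex.Re (f x)) /\
  rintegrable (fun x => complex.Im (f x)).

Definition cmeasurable (f : T -> R[i]) :=
  measurable_fun D (fun x => complex.Re (f x)) /\
  measurable_fun D (fun x => complex.Im (f x)).

Implicit Types f g : T -> R.

Lemma rintegrable_measurable f : rintegrable f -> measurable_fun D f.
Proof. by move=> /integrableP[/measurable_EFinP]. Qed.

Lemma cintegrable_measurable (f : T -> R[i]) : cintegrable f -> cmeasurable f.
Proof. by move=> [/rintegrable_measurable ? /rintegrable_measurable ?]. Qed.

Lemma rintegrable_le f g : measurable_fun D f ->
  (forall x, D x -> `|f x| <= g x) -> rintegrable g -> rintegrable f.
Proof.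
move=> mf fg; apply: le_integrable => //; first exact/measurable_EFinP.
by move=> x Dx /=; rewrite lee_fin (le_trans (fg x Dx))// ler_norm.
Qed.

Lemma eq_rintegrable f g : {in D, f =1 g} -> rintegrable f -> rintegrable g.
Proof. by move=> fg; apply: eq_integrable => // x xD /=; rewrite fg. Qed.

Lemma rintegrableD f g : rintegrable f -> rintegrable g ->
  rintegrable (fun x => f x + g x).
Proof.
move=> fi gi; have := integrableD mD fi gi.
by apply: eq_integrable => // x _ /=; rewrite EFinD.
Qed.

Lemma rintegrableZ k f : rintegrable f -> rintegrable (fun x => k * f x).
Proof.
move=> fi; have := integrableZl mD k fi.
by apply: eq_integrable => // x _ /=; rewrite EFinM.
Qed.

Lemma rintegrableN f : rintegrable f -> rintegrable (fun x => - f x).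
Proof. by move=> /(rintegrableZ (-1)); apply: eq_rintegrable => x _; rewrite mulN1r. Qed.

Lemma rintegrableB f g : rintegrable f -> rintegrable g ->
  rintegrable (fun x => f x - g x).
Proof. by move=> fi /rintegrableN; exact: rintegrableD. Qed.

Lemma rintegrable_norm f : rintegrable f -> rintegrable (fun x => `|f x|).
Proof. exact: integrable_norm. Qed.

Lemma rintegrable_sum (I : Type) (s : seq I) (F : I -> T -> R) :
  (forall i, rintegrable (F i)) -> rintegrable (fun x => \sum_(i <- s) F i x).
Proof.
move=> Fi; elim: s => [|i s IH].
  under eq_fun do rewrite big_nil; exact: integrable0.
under eq_fun do rewrite big_cons; exact: rintegrableD.
Qed.

Lemma Rint_sum (I : Type) (s : seq I) (F : I -> T -> R) :
  (forall i, rintegrable (F i)) ->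
  \int[mu]_(x in D) (\sum_(i <- s) F i x) = \sum_(i <- s) \int[mu]_(x in D) F i x.
Proof.
move=> Fi; elim: s => [|i s IH].
  rewrite big_nil (@eq_Rintegral _ _ _ _ _ (fun=> 0)).
    by rewrite /Rintegral integral0.
  by move=> x _; rewrite big_nil.
rewrite big_cons -IH -(RintegralD mD (Fi i) (rintegrable_sum s Fi)).
by apply: eq_Rintegral => x _; rewrite big_cons.
Qed.

Lemma cintegrableD (f g : T -> R[i]) : cintegrable f -> cintegrable g ->
  cintegrable (fun x => f x + g x).
Proof.
move=> [fr fi] [gr gi]; split; under eq_fun do rewrite ReImE; exact: rintegrableD.
Qed.

Lemma cintegrableZ k (f : T -> R[i]) : cintegrable f -> cintegrable (fun x => k * f x).
Proof.
move=> [fr fi]; split; under eq_fun do rewrite ReImE.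
- by apply: rintegrableB; exact: rintegrableZ.
- by apply: rintegrableD; exact: rintegrableZ.
Qed.

Lemma cintegrableN (f : T -> R[i]) : cintegrable f -> cintegrable (fun x => - f x).
Proof.
by move=> [fr fi]; split; under eq_fun do rewrite ReImE; exact: rintegrableN.
Qed.

Lemma cintegrable0 : cintegrable (fun=> 0).
Proof. by split; exact: integrable0. Qed.

Lemma cintegrable_sum (I : Type) (s : seq I) (F : I -> T -> R[i]) :
  (forall i, cintegrable (F i)) -> cintegrable (fun x => \sum_(i <- s) F i x).
Proof.
move=> Fi; elim: s => [|i s IH].
  by under eq_fun do rewrite big_nil; exact: cintegrable0.
by under eq_fun do rewrite big_cons; exact: cintegrableD.
Qed.

Lemma eq_cint (f g : T -> R[i]) : {in D, f =1 g} -> cint f = cint g.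
Proof.
by move=> fg; congr Complex; apply: eq_Rintegral => x xD; rewrite fg.
Qed.

Lemma cintD (f g : T -> R[i]) : cintegrable f -> cintegrable g ->
  cint (fun x => f x + g x) = cint f + cint g.
Proof.
move=> [fr fi] [gr gi]; apply: complex_ext; rewrite ReImE /=.
- by rewrite -RintegralD//; apply: eq_Rintegral => x _; rewrite ReImE.
- by rewrite -RintegralD//; apply: eq_Rintegral => x _; rewrite ReImE.
Qed.

Lemma cintZ k (f : T -> R[i]) : cintegrable f -> cint (fun x => k * f x) = k * cint f.
Proof.
move=> [fr fi]; apply: complex_ext; rewrite !ReImE /=.
- rewrite -!RintegralZl// -RintegralB//; try exact: rintegrableZ.
  by apply: eq_Rintegral => x _; rewrite ReImE.
- rewrite -!RintegralZl// -RintegralD//; try exact: rintegrableZ.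
  by apply: eq_Rintegral => x _; rewrite ReImE.
Qed.

Lemma cintN (f : T -> R[i]) : cintegrable f -> cint (fun x => - f x) = - cint f.
Proof.
move=> fi; rewrite -mulN1r -cintZ//.
by apply: eq_cint => x _; rewrite mulN1r.
Qed.

Lemma cint_sum (I : Type) (s : seq I) (F : I -> T -> R[i]) :
  (forall i, cintegrable (F i)) ->
  cint (fun x => \sum_(i <- s) F i x) = \sum_(i <- s) cint (F i).
Proof.
move=> Fi; apply: complex_ext; rewrite ?Re_sum ?Im_sum /=.
- rewrite -Rint_sum; last by move=> i; case: (Fi i).
  by apply: eq_Rintegral => x _; rewrite Re_sum.
- rewrite -Rint_sum; last by move=> i; case: (Fi i).
  by apply: eq_Rintegral => x _; rewrite Im_sum.
Qed.

Lemma cmeasurableM (f g : T -> R[i]) : cmeasurable f -> cmeasurable g ->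
  cmeasurable (fun x => f x * g x).
Proof.
move=> [fr fi] [gr gi]; split; under eq_fun do rewrite ReImE.
- by apply: measurable_funB; exact: measurable_funM.
- by apply: measurable_funD; exact: measurable_funM.
Qed.

Lemma cmeasurableJ (f : T -> R[i]) : cmeasurable f -> cmeasurable (fun x => (f x)^*%C).
Proof.
move=> [fr fi]; split; first by under eq_fun do rewrite ReImE.
by under eq_fun do rewrite ReImE; exact: measurableT_comp.
Qed.

Lemma measurable_sqn (f : T -> R[i]) : cmeasurable f -> measurable_fun D (fun x => sqn (f x)).
Proof. by move=> [fr fi]; apply: measurable_funD; exact: measurable_funX. Qed.

Lemma measurable_modc (f : T -> R[i]) : cmeasurable f -> measurable_fun D (fun x => modc (f x)).
Proof.
move=> /measurable_sqn mf.
have ms : measurable_fun [set: R] (@Num.sqrt R).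
  by apply: continuous_measurable_fun; exact: sqrt_continuous.
exact: measurableT_comp ms mf.
Qed.

Lemma cintegrable_modc (f : T -> R[i]) : cintegrable f -> rintegrable (fun x => modc (f x)).
Proof.
move=> fi; have mf := cintegrable_measurable fi; case: fi => fr fi.
apply: (rintegrable_le (measurable_modc mf) _
  (rintegrableD (rintegrable_norm fr) (rintegrable_norm fi))) => x _.
rewrite ger0_norm ?modc_ge0// -ler_sqr ?nnegrE ?modc_ge0 ?addr_ge0//.
rewrite sqr_modc sqrrD !real_normK ?num_real// /sqn.
by rewrite addrAC lerDl mulrn_wge0// mulr_ge0.
Qed.

Lemma cintegrable_le (f : T -> R[i]) (g : T -> R) : cmeasurable f ->
  (forall x, D x -> modc (f x) <= g x) -> rintegrable g -> cintegrable f.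
Proof.
move=> [fr fi] fg gi; split.
- apply: (rintegrable_le fr _ gi) => x Dx.
  exact: le_trans (normr_Re_le _) (fg x Dx).
- apply: (rintegrable_le fi _ gi) => x Dx.
  exact: le_trans (normr_Im_le _) (fg x Dx).
Qed.

Lemma cintegrableM_bounded (e f : T -> R[i]) (M : R) : cmeasurable e ->
  (forall x, D x -> modc (e x) <= M) -> cintegrable f ->
  cintegrable (fun x => e x * f x).
Proof.
move=> me eM fi.
apply: (cintegrable_le (cmeasurableM me (cintegrable_measurable fi)) _
  (rintegrableZ M (cintegrable_modc fi))) => x Dx.
by rewrite modcM ler_wpM2r ?modc_ge0 ?eM.
Qed.

Lemma Re_cint (f : T -> R[i]) : complex.Re (cint f) = \int[mu]_(x in D) complex.Re (f x).
Proof. by []. Qed.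

Hypothesis finD : (mu D < +oo)%E.

Lemma rintegrable_bounded f (M : R) : measurable_fun D f ->
  (forall x, D x -> `|f x| <= M) -> rintegrable f.
Proof.
move=> mf fM; apply: measurable_bounded_integrable => //.
exists M; split; first exact: num_real.
by move=> y My x Dx; exact: le_trans (fM x Dx) (ltW My).
Qed.

Lemma cintegrable_bounded (f : T -> R[i]) (M : R) : cmeasurable f ->
  (forall x, D x -> modc (f x) <= M) -> cintegrable f.
Proof.
move=> [fr fi] fM; split.
- by apply: (rintegrable_bounded (M := M) fr) => x /fM; apply: le_trans; exact: normr_Re_le.
- by apply: (rintegrable_bounded (M := M) fi) => x /fM; apply: le_trans; exact: normr_Im_le.
Qed.

End ComplexIntegral.

(** * The fundamental cell *)

Section PlaneMeasurability.
Variable R : realType.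

(** An open set is a countable union of open boxes with rational corners, and
    boxes are measurable for the product sigma-algebra. *)
Lemma open_measurable_plane (A : set (R * R)) : open A ->
  measurable (A : set (plane R)).
Proof.
move=> oA.
pose box (u : (rat * rat) * (rat * rat)) : set (R * R) :=
  `]ratr u.1.1, ratr u.1.2[ `*` `]ratr u.2.1, ratr u.2.2[.
rewrite (_ : A = \bigcup_(u in setT)
    (if `[< box u `<=` A >] then box u else set0)); last first.
  apply/seteqP; split => [[x y] Axy|x [u _]]; last first.
    by case: ifPn => [/asboolP bA /bA|].
  have /nbhs_ballP[e /= e0 ballA] : nbhs (x, y) A by exact: open_nbhs_nbhs.
  have bounds (z : R) : exists q : rat * rat,
      [/\ z - e < ratr q.1, ratr q.1 < z, z < ratr q.2 & ratr q.2 < z + e].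
    have /rat_in_itvoo[p] : z - e < z by rewrite ltrBlDr ltrDl.
    have /rat_in_itvoo[q] : z < z + e by rewrite ltrDl.
    rewrite !in_itv/= => /andP[? ?] /andP[? ?].
    by exists (p, q).
  have [p [xp1 xp2 xp3 xp4]] := bounds x.
  have [q [yq1 yq2 yq3 yq4]] := bounds y.
  exists (p, q) => //; rewrite ifT.
    by split; rewrite /= in_itv/=; apply/andP.
  apply/asboolP => -[s t] [/=]; rewrite !in_itv/= => /andP[? ?] /andP[? ?].
  apply: ballA; split => /=; rewrite /ball/= ltr_norml; apply/andP; split; lra.
apply: countable_bigcupT_measurable => [|u]; first exact: countableP.
case: ifPn => // _.
by apply: measurableX.
Qed.

Lemma continuous_measurable_plane (f : R * R -> R) : continuous f ->
  measurable_fun [set: plane R] (f : plane R -> R).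
Proof.
move=> cf; apply: (measurability (@RGenOInfty.G R)) => //.
  exact: RGenOInfty.measurableE.
move=> _ [_ [x ->] <-]; rewrite setTI.
by apply: open_measurable_plane; apply: open_comp.
Qed.

End PlaneMeasurability.

Section Cell.
Variables (R : realType) (l1 l2 : R).
Hypotheses (l1_gt0 : 0 < l1) (l2_gt0 : 0 < l2).
Local Notation cell := (@cell R l1 l2).
Local Notation leb2 := (leb2 R).

Lemma measurable_cell : measurable cell.
Proof. by apply: measurableX; exact: measurable_itv. Qed.

Lemma leb2_cell : leb2 cell = (l1 * l2)%:E.
Proof.
transitivity ((lebesgue_measure `[0%R, l1[ * lebesgue_measure `[0%R, l2[)%E : \bar R).
  exact: (product_measure1E lebesgue_measure lebesgue_measure
    (measurable_itv _) (measurable_itv _)).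
by rewrite !lebesgue_measure_itv/= !lte_fin l1_gt0 l2_gt0 !oppr0 !addr0 -EFinM.
Qed.

Lemma leb2_cell_lty : (leb2 cell < +oo)%E.
Proof. by rewrite leb2_cell ltry. Qed.

(** The half-open cell sits in the compact rectangle with the same sides. *)
Lemma bounded_on_cell (f : R * R -> R) : continuous f ->
  exists M : R, forall x, cell x -> `|f x| <= M.
Proof.
move=> cf.
have /compact_bounded [M [_ Mf]] :
    compact (f @` ([set` `[0, l1]] `*` [set` `[0, l2]])).
  apply: continuous_compact; first exact: continuous_subspaceT.
  by apply: compact_setX; exact: segment_compact.
exists (M + 1) => -[x y] [/=]; rewrite !in_itv/= => /andP[x0 xl] /andP[y0 yl].
apply: (Mf (M + 1)); first by rewrite ltrDl.
by exists (x, y) => //; split; rewrite /= in_itv/= ?x0 ?y0 ltW.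
Qed.

Lemma continuous_rintegrable_cell (f : R * R -> R) : continuous f ->
  rintegrable leb2 cell f.
Proof.
move=> cf; have [M fM] := bounded_on_cell cf.
apply: (rintegrable_bounded measurable_cell leb2_cell_lty (M := M)) => //.
exact: (measurable_funTS (continuous_measurable_plane cf)).
Qed.

Lemma is_derive_line (f : R * R -> R) (a v : R * R) (df : R) :
  is_derive (0 : R) 1 (fun h : R => f (h *: v + a)) df ->
  is_derive a v f df.
Proof.
move=> [dv de].
have E : (fun h : R => h^-1 *: ((f \o shift a) (h *: v) - f a)) =
   (fun h : R => h^-1 *: (((fun h : R => f (h *: v + a)) \o shift 0) (h *: 1) -
     (fun h : R => f (h *: v + a)) 0)).
  apply/funext => h /=; rewrite /shift /= scale0r add0r addr0.
  by rewrite /GRing.scale /= mulr1.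
by split; rewrite /derivable /derive E.
Qed.

Lemma planeE (h a b c d : R) : h *: (a, b) + (c, d) = (h * a + c, h * b + d).
Proof. by []. Qed.

Lemma is_derive_slice1 (f : R * R -> R) (x y df : R) :
  is_derive (x, y) (e1 R) f df -> is_derive x (1 : R) (fun t : R => f (t, y)) df.
Proof.
move=> [dv de].
have E : (fun h : R => h^-1 *: (((fun t => f (t, y)) \o shift x) (h *: 1) - f (x, y))) =
    (fun h : R => h^-1 *: ((f \o shift (x, y)) (h *: e1 R) - f (x, y))).
  apply/funext => h /=; rewrite /shift /= /e1; by rewrite planeE mulr0 add0r.
by split; rewrite /derivable /derive E.
Qed.

Lemma is_derive_slice2 (f : R * R -> R) (x y df : R) :
  is_derive (x, y) (e2 R) f df -> is_derive y (1 : R) (fun t : R => f (x, t)) df.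
Proof.
move=> [dv de].
have E : (fun h : R => h^-1 *: (((fun t => f (x, t)) \o shift y) (h *: 1) - f (x, y))) =
    (fun h : R => h^-1 *: ((f \o shift (x, y)) (h *: e2 R) - f (x, y))).
  apply/funext => h /=; rewrite /shift /= /e2; by rewrite planeE mulr0 add0r.
by split; rewrite /derivable /derive E.
Qed.

(** The fundamental theorem of calculus over one period. *)
Lemma integral_period_derivative (l : R) (F f : R -> R) : 0 < l ->
  (forall x : R, is_derive x (1 : R) F (f x)) -> continuous f -> F l = F 0 ->
  (\int[lebesgue_measure]_(x in `[0%R, l[) (f x)%:E = 0)%E.
Proof.
move=> l0 dF cf Fl.
have mf : measurable_fun [set: R] f by exact: continuous_measurable_fun.
have cF : continuous F.
  move=> x; apply/differentiable_continuous/derivable1_diffP.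
  by case: (dF x).
rewrite integral_itv_bndo_bndc; last first.
  exact/measurable_EFinP/measurable_funTS.
rewrite (@continuous_FTC2 _ f F)//.
- by rewrite Fl -EFinB subrr.
- exact: continuous_subspaceT.
- split=> [x _||].
  + by case: (dF x).
  + exact/cvg_at_right_filter/cF.
  + exact/cvg_at_left_filter/cF.
- by move=> x _; rewrite derive1E; case: (dF x).
Qed.

Lemma integral_cell_iter1 (f : R * R -> R) : rintegrable leb2 cell f ->
  (forall y, (\int[lebesgue_measure]_(x in `[0%R, l1[) (f (x, y))%:E = 0)%E) ->
  \int[leb2]_(x in cell) f x = 0.
Proof.
move=> fi f0; rewrite /Rintegral integral_mkcond.
have gi : leb2.-integrable setT ((EFin \o f) \_ cell).
  by apply/integrable_restrict => //; [exact: measurable_cell|rewrite setTI].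
rewrite -(integral21_prod_meas1 gi).
rewrite (eq_integral (fun=> 0%E)) ?integral0// => y _.
have [yl|yl] := boolP (y \in `[0, l2[).
  rewrite /fubini_G -[RHS](f0 y) [RHS]integral_mkcond; apply: eq_integral => x _.
  rewrite !patchE; congr (if _ then _ else _).
  apply/idP/idP; rewrite !inE /Defs.cell/= ?in_itv/=.
    by move=> -[].
  by move=> ?; split.
rewrite /fubini_G (eq_integral (fun=> 0%E)) ?integral0// => x _.
rewrite patchE ifF//; apply/negbTE; apply: contra yl.
by rewrite inE => -[].
Qed.

Lemma integral_cell_iter2 (f : R * R -> R) : rintegrable leb2 cell f ->
  (forall x, (\int[lebesgue_measure]_(y in `[0%R, l2[) (f (x, y))%:E = 0)%E) ->
  \int[leb2]_(x in cell) f x = 0.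
Proof.
move=> fi f0; rewrite /Rintegral integral_mkcond.
have gi : leb2.-integrable setT ((EFin \o f) \_ cell).
  by apply/integrable_restrict => //; [exact: measurable_cell|rewrite setTI].
rewrite -(integral12_prod_meas1 gi).
rewrite (eq_integral (fun=> 0%E)) ?integral0// => x _.
have [xl|xl] := boolP (x \in `[0, l1[).
  rewrite /fubini_F -[RHS](f0 x) [RHS]integral_mkcond; apply: eq_integral => y _.
  rewrite !patchE; congr (if _ then _ else _).
  apply/idP/idP; rewrite !inE /Defs.cell/= ?in_itv/=.
    by move=> -[].
  by move=> ?; split.
rewrite /fubini_F (eq_integral (fun=> 0%E)) ?integral0// => y _.
rewrite patchE ifF//; apply/negbTE; apply: contra xl.
by rewrite inE => -[].
Qed.

(** Fubini lets the derivative be integrated first along its own direction,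
    over a full period. *)
Lemma integral_cell_derivative (f : R * R -> R) (v : R * R) :
  test_fun l1 l2 f -> v = e1 R \/ v = e2 R ->
  \int[leb2]_(x in cell) 'D_v f x = 0.
Proof.
move=> [[per1 per2] fC] ve.
have df x w : derivable f x w by case: (fC 1%N) => _ /(_ w)[].
have cdf w : continuous ('D_w f) by case: (fC 1%N) => _ /(_ w)[_] [].
have idf := continuous_rintegrable_cell (cdf v).
case: ve => ve; subst v.
- apply: integral_cell_iter1 => // y.
  apply: (@integral_period_derivative l1 (fun t => f (t, y))) => //.
  + move=> x; apply: is_derive_slice1; split=> //.
  + move=> x; apply: (@continuous_comp _ _ _ (fun t => (t, y)) ('D_(e1 R) f)).
      exact: (cvg_pair (@cvg_id _ (nbhs x)) (cvg_cst y)).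
    exact: cdf.
  + by have := per1 (0, y); rewrite /GRing.add /= /add_pair/= add0r addr0.
- apply: integral_cell_iter2 => // x.
  apply: (@integral_period_derivative l2 (fun t => f (x, t))) => //.
  + move=> y; apply: is_derive_slice2; split=> //.
  + move=> y; apply: (@continuous_comp _ _ _ (fun t => (x, t)) ('D_(e2 R) f)).
      exact: (cvg_pair (cvg_cst x) (@cvg_id _ (nbhs y))).
    exact: cdf.
  + by have := per2 (x, 0); rewrite /GRing.add /= /add_pair/= add0r addr0.
Qed.

End Cell.

(** * Trigonometric polynomials and Fourier coefficients *)

Section Waves.
Variables (R : realType) (l1 l2 : R).
Hypotheses (l1_gt0 : 0 < l1) (l2_gt0 : 0 < l2).
Local Notation cell := (@cell R l1 l2).
Local Notation leb2 := (leb2 R).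
Implicit Types (n k : int * int) (x v : R * R).

Definition freq n v : R :=
  2 * pi / l1 * n.1%:~R * v.1 + 2 * pi / l2 * n.2%:~R * v.2.

(** The real trigonometric monomials; this family is stable under all the
    directional derivatives, which is why its members are test functions. *)
Definition wave (a b : R) n x : R := a * cos (freq n x) + b * sin (freq n x).

Definition expi n x : R[i] := Complex (cos (freq n x)) (sin (freq n x)).

Lemma freqD n x v : freq n (x + v) = freq n x + freq n v.
Proof. by rewrite /freq /=; ring. Qed.

Lemma freqDn n k x : freq (n + k) x = freq n x + freq k x.
Proof. by rewrite /freq /= !intrD; ring. Qed.

Lemma freqZ n h x : freq n (h *: x) = h * freq n x.
Proof. by rewrite /freq /= /GRing.scale /=; ring. Qed.

Lemma freqNn n x : freq (- n) x = - freq n x.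
Proof. by rewrite /freq /= !intrN; ring. Qed.

Lemma freq0n x : freq 0 x = 0.
Proof. by rewrite /freq /=; ring. Qed.

Lemma freq_e1 n : freq n (e1 R) = 2 * pi / l1 * n.1%:~R.
Proof. by rewrite /freq /=; ring. Qed.

Lemma freq_e2 n : freq n (e2 R) = 2 * pi / l2 * n.2%:~R.
Proof. by rewrite /freq /=; ring. Qed.

Lemma freq_eq0 n : freq n (e1 R) = 0 -> freq n (e2 R) = 0 -> n = 0.
Proof.
have pi0 : pi != 0 :> R by rewrite gt_eqF// pi_gt0.
have l10 : l1 != 0 by rewrite gt_eqF.
have l20 : l2 != 0 by rewrite gt_eqF.
rewrite freq_e1 freq_e2 => /eqP n1 /eqP n2.
move: n1; rewrite !mulf_eq0 invr_eq0 (negbTE pi0) (negbTE l10) pnatr_eq0/= intr_eq0.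
move: n2; rewrite !mulf_eq0 invr_eq0 (negbTE pi0) (negbTE l20) pnatr_eq0/= intr_eq0.
by case: n => a b /= /eqP -> /eqP ->.
Qed.

Lemma cos_sinD2pi (t : R) (z : int) :
  cos (t + 2 * pi * z%:~R) = cos t /\ sin (t + 2 * pi * z%:~R) = sin t.
Proof.
have H (s : R) (i : nat) : cos (s + pi *+ 2 *+ i) = cos s /\ sin (s + pi *+ 2 *+ i) = sin s.
  by split; apply: periodicn => u; [exact: cosD2pi|exact: sinD2pi].
case: z => i.
  have -> : 2 * pi * (Posz i)%:~R = pi *+ 2 *+ i :> R by rewrite pmulrn; ring.
  exact: H.
have -> : 2 * pi * (Negz i)%:~R = - (pi *+ 2 *+ i.+1) :> R.
  by rewrite NegzE intrN pmulrn; ring.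
have [<- <-] := H (t - pi *+ 2 *+ i.+1) i.+1.
by rewrite subrK.
Qed.

Lemma wave_periodic a b n : torus_fun l1 l2 (wave a b n).
Proof.
have l10 : l1 != 0 by rewrite gt_eqF.
have l20 : l2 != 0 by rewrite gt_eqF.
split=> x; rewrite /wave freqD.
- have -> : freq n (l1, 0) = 2 * pi * n.1%:~R by rewrite /freq /=; field; rewrite ?l10 ?l20.
  by have [-> ->] := cos_sinD2pi (freq n x) n.1.
- have -> : freq n (0, l2) = 2 * pi * n.2%:~R by rewrite /freq /=; field; rewrite ?l10 ?l20.
  by have [-> ->] := cos_sinD2pi (freq n x) n.2.
Qed.

Lemma freq_continuous n : continuous (freq n).
Proof.
move=> x; rewrite /continuous_at /freq; apply: cvgD.
- by apply: cvgM; [exact: cvg_cst|exact: cvg_fst].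
- by apply: cvgM; [exact: cvg_cst|exact: cvg_snd].
Qed.

Lemma cos_freq_continuous n : continuous (fun x => cos (freq n x)).
Proof.
move=> x; apply: continuous_comp; first exact: freq_continuous.
exact: continuous_cos.
Qed.

Lemma sin_freq_continuous n : continuous (fun x => sin (freq n x)).
Proof.
move=> x; apply: continuous_comp; first exact: freq_continuous.
exact: continuous_sin.
Qed.

Lemma wave_continuous a b n : continuous (wave a b n).
Proof.
move=> x; rewrite /continuous_at /wave; apply: cvgD.
- by apply: cvgM; [exact: cvg_cst|exact: cos_freq_continuous].
- by apply: cvgM; [exact: cvg_cst|exact: sin_freq_continuous].
Qed.

Lemma is_derive_wave a b n x v : is_derive x v (wave a b n)
  (wave (b * freq n v) (- (a * freq n v)) n x).
Proof.
apply: is_derive_line; rewrite /wave.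
rewrite (_ : (fun h : R => _) = (fun h : R =>
   a * cos (freq n v * h + freq n x) + b * sin (freq n v * h + freq n x))); last first.
  by apply/funext => h; rewrite freqD freqZ [h * _]mulrC.
set k := freq n v; set c := freq n x.
have dl : is_derive (0 : R) (1 : R) (fun h : R => k * h + c) k.
  by apply: is_derive_eq; rewrite addr0 /GRing.scale /= mulr1.
have dc : is_derive (0 : R) (1 : R) (fun h : R => cos (k * h + c)) (- sin c * k).
  apply: (@is_derive1_comp _ cos (fun h : R => k * h + c) 0 (- sin c) k).
  by rewrite mulr0 add0r; exact: is_derive_cos.
have ds : is_derive (0 : R) (1 : R) (fun h : R => sin (k * h + c)) (cos c * k).
  apply: (@is_derive1_comp _ sin (fun h : R => k * h + c) 0 (cos c) k).
  by rewrite mulr0 add0r; exact: is_derive_sin.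
apply: is_derive_eq; rewrite /GRing.scale /=; ring.
Qed.

Lemma derive_waveE a b n v x :
  'D_v (wave a b n) x = wave (b * freq n v) (- (a * freq n v)) n x.
Proof. by case: (is_derive_wave a b n x v). Qed.

Lemma derive_wave a b n v :
  'D_v (wave a b n) = wave (b * freq n v) (- (a * freq n v)) n.
Proof. by apply/funext => x; exact: derive_waveE. Qed.

Lemma wave_test_fun a b n : test_fun l1 l2 (wave a b n).
Proof.
split; first exact: wave_periodic.
move=> N; elim: N a b => [|N IH] a b; first by split=> //; exact: wave_continuous.
split; first exact: wave_continuous.
move=> v; split; first by move=> x; case: (is_derive_wave a b n x v).
by rewrite derive_wave; exact: IH.
Qed.

Lemma expiD n k x : expi (n + k) x = expi n x * expi k x.
Proof.
apply: complex_ext; rewrite !ReImE /= freqDn; first by rewrite cosD.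
by rewrite sinD addrC.
Qed.

Lemma expiN n x : expi (- n) x = (expi n x)^*%C.
Proof. by apply: complex_ext; rewrite !ReImE /= freqNn ?cosN ?sinN. Qed.

Lemma expi0 x : expi 0 x = 1.
Proof. by rewrite /expi freq0n cos0 sin0. Qed.

Lemma sqn_expi n x : sqn (expi n x) = 1.
Proof. by rewrite /sqn /= cos2Dsin2. Qed.

Lemma modc_expi n x : modc (expi n x) = 1.
Proof. by rewrite /modc sqn_expi sqrtr1. Qed.

Lemma cmeasurable_expi n : cmeasurable cell (expi n).
Proof.
split=> /=; apply: measurable_funTS; apply: continuous_measurable_plane.
- exact: cos_freq_continuous.
- exact: sin_freq_continuous.
Qed.

Lemma cintegrable_expi n : cintegrable leb2 cell (expi n).
Proof.
apply: (cintegrable_bounded (measurable_cell l1 l2) (leb2_cell_lty l1_gt0 l2_gt0)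
  (M := 1)); first exact: cmeasurable_expi.
by move=> x _; rewrite modc_expi.
Qed.

Lemma cintegrable_cst (c : R[i]) : cintegrable leb2 cell (fun=> c).
Proof.
by split; apply: continuous_rintegrable_cell => // x; exact: cvg_cst.
Qed.

Lemma cint_cst (c : R[i]) : cint leb2 cell (fun=> c) = (l1 * l2)%:C%C * c.
Proof.
have mc := measurable_cell l1 l2.
apply: complex_ext; rewrite !ReImE /= !Rintegral_cst// leb2_cell//=; ring.
Qed.

Lemma eq_cint_cell (f g : R * R -> R[i]) : f =1 g ->
  cint leb2 cell f = cint leb2 cell g.
Proof. by move=> fg; apply: eq_cint => x _; exact: fg. Qed.

(** For [n != 0] some frequency is nonzero, and then both parts of [expi n]
    are derivatives of waves. *)
Lemma cint_expi n : cint leb2 cell (expi n) = if n == 0 then (l1 * l2)%:C%C else 0.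
Proof.
have [->|n0] := eqVneq n 0.
  rewrite (@eq_cint_cell _ (fun=> 1)); first by rewrite cint_cst mulr1.
  by move=> x; rewrite expi0.
have key v : v = e1 R \/ v = e2 R -> freq n v != 0 -> cint leb2 cell (expi n) = 0.
  move=> ve k0; apply: complex_ext => /=.
  - rewrite -(integral_cell_derivative l1_gt0 l2_gt0 (wave_test_fun 0 (freq n v)^-1 n) ve).
    apply: eq_Rintegral => x _; rewrite derive_waveE /wave mulVf//; ring.
  - rewrite -(integral_cell_derivative l1_gt0 l2_gt0 (wave_test_fun (- (freq n v)^-1) 0 n) ve).
    apply: eq_Rintegral => x _; by rewrite derive_waveE /wave; field.
have [k1|] := eqVneq (freq n (e1 R)) 0; last by apply: key; left.
have [k2|] := eqVneq (freq n (e2 R)) 0; last by apply: key; right.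
by move: n0; rewrite (freq_eq0 k1 k2) eqxx.
Qed.

(** Normalisation: integration over the cell, without dividing by its area. *)
Definition fcoef (u : R * R -> R[i]) n : R[i] :=
  cint leb2 cell (fun x => (expi n x)^*%C * u x).

Definition tpoly (s : seq (int * int)) (c : int * int -> R[i]) x : R[i] :=
  \sum_(n <- s) c n * expi n x.

Lemma eq_fcoef u w n : u =1 w -> fcoef u n = fcoef w n.
Proof. by move=> /funext ->. Qed.

Lemma cintegrable_expiJM n (u : R * R -> R[i]) :
  cintegrable leb2 cell u -> cintegrable leb2 cell (fun x => (expi n x)^*%C * u x).
Proof.
move=> ui; apply: (cintegrableM_bounded (measurable_cell l1 l2) (M := 1)) => //.
  exact/cmeasurableJ/cmeasurable_expi.
by move=> x _; rewrite modcJ modc_expi.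
Qed.

Lemma fcoefD u w n : cintegrable leb2 cell u -> cintegrable leb2 cell w ->
  fcoef (fun x => u x + w x) n = fcoef u n + fcoef w n.
Proof.
move=> ui wi; rewrite /fcoef -(cintD (measurable_cell l1 l2)); first last.
- exact: cintegrable_expiJM.
- exact: cintegrable_expiJM.
by apply: eq_cint => x _; rewrite mulrDr.
Qed.

Lemma fcoefZ c u n : cintegrable leb2 cell u ->
  fcoef (fun x => c * u x) n = c * fcoef u n.
Proof.
move=> ui; rewrite /fcoef -(cintZ (measurable_cell l1 l2)); last first.
  exact: cintegrable_expiJM.
by apply: eq_cint => x _; rewrite mulrCA.
Qed.

Lemma fcoefN u n : cintegrable leb2 cell u ->
  fcoef (fun x => - u x) n = - fcoef u n.
Proof.
move=> ui; rewrite -mulN1r -fcoefZ//.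
by apply: eq_cint => x _; rewrite mulN1r.
Qed.

Lemma fcoefB u w n : cintegrable leb2 cell u -> cintegrable leb2 cell w ->
  fcoef (fun x => u x - w x) n = fcoef u n - fcoef w n.
Proof.
move=> ui wi; rewrite -fcoefN//; apply: fcoefD => //.
exact: (cintegrableN (measurable_cell l1 l2)).
Qed.

Lemma fcoef_sum (I : Type) (s : seq I) (F : I -> R * R -> R[i]) n :
  (forall i, cintegrable leb2 cell (F i)) ->
  fcoef (fun x => \sum_(i <- s) F i x) n = \sum_(i <- s) fcoef (F i) n.
Proof.
move=> Fi; rewrite /fcoef -(cint_sum (measurable_cell l1 l2)); last first.
  by move=> i; exact: cintegrable_expiJM.
by apply: eq_cint => x _; rewrite mulr_sumr.
Qed.

Lemma fcoef_cst c n : fcoef (fun=> c) n = if n == 0 then (l1 * l2)%:C%C * c else 0.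
Proof.
rewrite /fcoef (@eq_cint_cell _ (fun x => c * expi (- n) x)); last first.
  by move=> x; rewrite expiN mulrC.
rewrite (cintZ (measurable_cell l1 l2)); last exact: cintegrable_expi.
rewrite cint_expi oppr_eq0; case: ifP => _; first by rewrite mulrC.
by rewrite mulr0.
Qed.

Lemma cintegrable_tpoly s c : cintegrable leb2 cell (tpoly s c).
Proof.
apply: (cintegrable_sum (measurable_cell l1 l2)) => n.
by apply: (cintegrableZ (measurable_cell l1 l2)); exact: cintegrable_expi.
Qed.

Lemma modc_tpoly_le s c x : modc (tpoly s c x) <= \sum_(n <- s) modc (c n).
Proof.
apply: le_trans (modc_sum_le _ _ _) _.
by apply: ler_sum => n _; rewrite modcM modc_expi mulr1.
Qed.

Lemma cmeasurable_tpoly s c : cmeasurable cell (tpoly s c).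
Proof. exact/(cintegrable_measurable (mu := leb2))/cintegrable_tpoly. Qed.

(** The pairing of an integrable function with a trigonometric polynomial
    sees only Fourier coefficients; every duality argument below goes through
    this identity. *)
Lemma cint_tpolyJ (u : R * R -> R[i]) s c : cintegrable leb2 cell u ->
  cint leb2 cell (fun x => (tpoly s c x)^*%C * u x) =
  \sum_(n <- s) (c n)^*%C * fcoef u n.
Proof.
move=> ui.
rewrite (@eq_cint_cell _ (fun x =>
    \sum_(n <- s) (c n)^*%C * ((expi n x)^*%C * u x))); last first.
  move=> x; rewrite /tpoly rmorph_sum mulr_suml; apply: eq_bigr => n _.
  by rewrite rmorphM mulrA.
rewrite (cint_sum (measurable_cell l1 l2)); last first.
  move=> n; apply: (cintegrableZ (measurable_cell l1 l2)).
  exact: cintegrable_expiJM.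
apply: eq_bigr => n _; apply: (cintZ (measurable_cell l1 l2)).
exact: cintegrable_expiJM.
Qed.

Lemma fcoef_expi n k : fcoef (expi k) n = if k == n then (l1 * l2)%:C%C else 0.
Proof.
rewrite /fcoef (@eq_cint_cell _ (expi (k - n))); last first.
  by move=> x; rewrite expiD expiN mulrC.
by rewrite cint_expi subr_eq0.
Qed.

Lemma fcoef_tpoly s c n : uniq s -> n \in s ->
  fcoef (tpoly s c) n = (l1 * l2)%:C%C * c n.
Proof.
move=> us ns; rewrite fcoef_sum; last first.
  move=> k; apply: (cintegrableZ (measurable_cell l1 l2)).
  exact: cintegrable_expi.
rewrite (bigD1_seq n)//= big1 ?addr0 => [|k kn].
  by rewrite fcoefZ ?fcoef_expi ?eqxx 1?mulrC//; exact: cintegrable_expi.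
rewrite fcoefZ ?fcoef_expi ?(negbTE kn) ?mulr0//; exact: cintegrable_expi.
Qed.

Lemma rintegrable_sqn_tpoly s c : rintegrable leb2 cell (fun x => sqn (tpoly s c x)).
Proof.
have mc := measurable_cell l1 l2.
apply: (rintegrable_bounded mc (leb2_cell_lty l1_gt0 l2_gt0)
  (M := (\sum_(n <- s) modc (c n)) ^+ 2)).
  exact/measurable_sqn/cmeasurable_tpoly.
move=> x _; rewrite ger0_norm ?sqn_ge0// -sqr_modc ler_sqr ?nnegrE ?modc_ge0//.
  exact: modc_tpoly_le.
by apply: sumr_ge0 => n _; exact: modc_ge0.
Qed.

Lemma parseval_tpoly s c : uniq s ->
  \int[leb2]_(x in cell) sqn (tpoly s c x) =
  l1 * l2 * \sum_(n <- s) sqn (c n).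
Proof.
move=> us.
have -> : \int[leb2]_(x in cell) sqn (tpoly s c x) =
    complex.Re (cint leb2 cell (fun x => (tpoly s c x)^*%C * tpoly s c x)).
  rewrite /=; apply: eq_Rintegral => x _.
  by rewrite mulrC mulJc.
rewrite cint_tpolyJ; last exact: cintegrable_tpoly.
rewrite Re_sum mulr_sumr big_seq [RHS]big_seq; apply: eq_bigr => n ns.
rewrite fcoef_tpoly// mulrCA [_^*%C * _]mulrC mulJc.
by rewrite -rmorphM.
Qed.

End Waves.

(** * The embedding of H^(1/2) in L^4 and its dual *)

Section Embedding.
Variables (R : realType) (l1 l2 : R).
Hypotheses (l1_gt0 : 0 < l1) (l2_gt0 : 0 < l2).
Local Notation cell := (@cell R l1 l2).
Local Notation leb2 := (leb2 R).
Local Notation expi := (expi l1 l2).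
Local Notation tpoly := (tpoly l1 l2).
Local Notation fcoef := (fcoef l1 l2).
Local Notation area := (l1 * l2).
Local Notation wgt := (wgt R).

Let mc := measurable_cell l1 l2.
Let fc := leb2_cell_lty l1_gt0 l2_gt0.
Let area_gt0 : 0 < area. Proof. exact: mulr_gt0. Qed.

(** The coefficients of the squared modulus are the autocorrelation of those
    of the polynomial. *)
Lemma sqn_tpolyE N (c : int * int -> R[i]) (x : R * R) :
  (forall n, n \notin zbox N -> c n = 0) ->
  (sqn (tpoly (zbox N) c x))%:C%C =
  tpoly (zbox N.*2) (fun k => \sum_(n <- zbox N) c (n + k) * (c n)^*%C) x.
Proof.
move=> cN; rewrite -mulJc /tpoly mulr_suml.
rewrite rmorph_sum.
under eq_bigr do rewrite mulr_sumr.
rewrite exchange_big /=.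
under [RHS]eq_bigr do rewrite mulr_suml.
rewrite [RHS]exchange_big /= big_seq [RHS]big_seq; apply: eq_bigr => n.
rewrite mem_zbox => nN.
rewrite -(@sum_reindex _ _ _ (zbox N.*2) (zbox N) (fun k => n + k)
  (fun m => c m * expi m x * (c n * expi n x)^*%C)).
- apply: eq_bigr => k _; rewrite conjcM -expiN.
  transitivity (c (n + k) * (c n)^*%C * (expi (n + k) x * expi (- n) x)).
    by rewrite mulrACA mulrA.
  by rewrite -expiD addrAC subrr add0r.
- exact: uniq_zbox.
- exact: uniq_zbox.
- exact: addrI.
- move=> m; rewrite mem_zbox => mN; apply/mapP; exists (m - n); last by rewrite addrC subrK.
  rewrite mem_zbox (leq_trans (leq_supnD _ _))// supnN -addnn; exact: leq_add.
- by move=> k _ /cN ->; rewrite !mul0r.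
Qed.

(** The embedding of H^(1/2) into L^4: Parseval for the squared modulus turns
    the integral into the sum bounded by [convolution_square_le]. *)
Lemma tpoly_L4_le N (c : int * int -> R[i]) :
  \int[leb2]_(x in cell) (sqn (tpoly (zbox N) c x) ^+ 2) <=
  84 * area * (\sum_(n <- zbox N) wgt n * sqn (c n)) ^+ 2.
Proof.
pose c' n := if n \in zbox N then c n else 0.
have c'N n : n \notin zbox N -> c' n = 0 by rewrite /c' => /negbTE ->.
have tE x : tpoly (zbox N) c x = tpoly (zbox N) c' x.
  by rewrite /tpoly big_seq [RHS]big_seq; apply: eq_bigr => n nN; rewrite /c' nN.
under eq_Rintegral do rewrite tE -sqn_real sqn_tpolyE//.
rewrite parseval_tpoly//; last exact: uniq_zbox.
have -> : \sum_(n <- zbox N) wgt n * sqn (c n) =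
    \sum_(n <- zbox N) wgt n * modc (c' n) ^+ 2.
  by rewrite big_seq [RHS]big_seq; apply: eq_bigr => n nN; rewrite sqr_modc /c' nN.
rewrite [84 * _]mulrC -[leRHS]mulrA ler_pM2l//.
apply: le_trans (convolution_square_le (a := fun n => modc (c' n)) _ _).
- apply: ler_sum => k _; rewrite -sqr_modc ler_sqr ?nnegrE ?modc_ge0//.
    apply: le_trans (modc_sum_le _ _ _) _; apply: ler_sum => n _.
    by rewrite modcM modcJ.
  by apply: sumr_ge0 => n _; rewrite mulr_ge0 ?modc_ge0.
- by move=> n; exact: modc_ge0.
- by move=> n /c'N ->; rewrite modc0.
Qed.

Lemma rintegrable_sqn2_tpoly s (c : int * int -> R[i]) :
  rintegrable leb2 cell (fun x => sqn (tpoly s c x) ^+ 2).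
Proof.
apply: (rintegrable_bounded mc fc (M := (\sum_(n <- s) modc (c n)) ^+ 4)).
  exact/measurable_funX/measurable_sqn/cmeasurable_tpoly.
move=> x _; rewrite ger0_norm ?sqr_ge0// -sqr_modc -exprM.
by rewrite lerXn2r ?nnegrE ?modc_ge0 ?modc_tpoly_le// sumr_ge0// => n _; exact: modc_ge0.
Qed.

Definition pow43 (z : R[i]) : R := (modc z) `^ (4 / 3).

Lemma pow43_ge0 z : 0 <= pow43 z. Proof. exact: powR_ge0. Qed.

(** Young's inequality for the exponents 4 and 4/3 with a free scale [s]. In
    terms of [r = |u|^(1/3)] and [t = |z| / s] it reads
    [4 r^3 t <= 3 r^4 + t^4], and the difference is
    [(r - t)^2 (3 r^2 + 2 r t + t^2)]. *)
Lemma young43 (z u : R[i]) (s : R) : 0 < s ->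
  modc z * modc u <= 3 / 4 * s * pow43 u + (4 * s ^+ 3)^-1 * sqn z ^+ 2.
Proof.
move=> s0; pose r := modc u `^ (3^-1).
have r0 : 0 <= r by exact: powR_ge0.
have -> : modc u = r ^+ 3.
  by rewrite -powR_mulrn// -powRrM mulVf// powRr1 ?modc_ge0.
have -> : pow43 u = r ^+ 4.
  by rewrite -powR_mulrn// -powRrM mulrC.
rewrite -sqr_modc -exprM; set b := modc z.
have b0 : 0 <= b := modc_ge0 z.
pose t := b / s; have bE : b = s * t by rewrite /t mulrCA divff ?gt_eqF// mulr1.
have t0 : 0 <= t by rewrite divr_ge0// ltW.
rewrite bE -subr_ge0.
rewrite [X in 0 <= X](_ : _ = s / 4 * ((r - t) ^+ 2 * (3 * r ^+ 2 + 2 * r * t + t ^+ 2))).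
  apply: mulr_ge0; first by rewrite divr_ge0// ltW.
  apply: mulr_ge0; first exact: sqr_ge0.
  by have := mulr_ge0 r0 t0; have := sqr_ge0 r; have := sqr_ge0 t; nra.
by field; rewrite gt_eqF.
Qed.

(** The dual statement: L^(4/3) embeds in H^(-1/2). Let [X] be the sum on the
    left. It is the pairing of [g] with the polynomial [h] of coefficients
    [fcoef g n / wgt n], whose H^(1/2) norm squared is [X] again. By [young43]
    and [tpoly_L4_le], [X <= 3/4 s G + 84 area X^2 / (4 s^3)], and the scale
    [s^3 = 84 area X] gives [X <= s G]. *)
Lemma fcoef_dual_le N (g : R * R -> R[i]) : cintegrable leb2 cell g ->
  rintegrable leb2 cell (fun x => pow43 (g x)) ->
  (\sum_(n <- zbox N) sqn (fcoef g n) / wgt n) ^+ 2 <=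
  84 * area * (\int[leb2]_(x in cell) pow43 (g x)) ^+ 3.
Proof.
move=> gi g43; set X := \sum_(n <- _) _; set G := \int[_]_(_ in _) _.
have G0 : 0 <= G by apply: Rintegral_ge0 => x _; exact: pow43_ge0.
have wge0 n : 0 <= (wgt n)^-1 by rewrite invr_ge0 ltW// wgt_gt0.
have X0 : 0 <= X.
  by apply: sumr_ge0 => n _; rewrite mulr_ge0// sqn_ge0.
have [X00|Xn0] := eqVneq X 0.
  by rewrite X00 expr0n !mulr_ge0 ?exprn_ge0// ltW.
have Xgt0 : 0 < X by rewrite lt_def Xn0.
pose c n := fcoef g n * ((wgt n)^-1)%:C%C.
have cX : \sum_(n <- zbox N) wgt n * sqn (c n) = X.
  apply: eq_bigr => n _; rewrite sqnM sqn_real.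
  by have := wgt_gt0 R n; move: (wgt n) => w w0; field; rewrite gt_eqF.
pose h := tpoly (zbox N) c.
have XE : X = \int[leb2]_(x in cell) complex.Re ((h x)^*%C * g x).
  rewrite -Re_cint cint_tpolyJ// Re_sum; apply: eq_bigr => n _.
  by rewrite conjcM conjc_real mulrAC [_^*%C * _]mulrC mulJc -rmorphM.
pose S := 84 * area * X.
have S0 : 0 < S by rewrite !mulr_gt0.
pose s := S `^ (3^-1).
have s0 : 0 < s by exact: powR_gt0.
have s3 : s ^+ 3 = S.
  by rewrite -powR_mulrn ?(ltW s0)// -powRrM mulVf// powRr1// ltW.
have hg : cintegrable leb2 cell (fun x => (h x)^*%C * g x).
  apply: (cintegrableM_bounded mc (M := \sum_(n <- zbox N) modc (c n))) => //.
    exact/cmeasurableJ/cmeasurable_tpoly.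
  by move=> x _; rewrite modcJ modc_tpoly_le.
have : X <= 3 / 4 * s * G + (4 * s ^+ 3)^-1 *
    \int[leb2]_(x in cell) (sqn (h x) ^+ 2).
  rewrite XE -!RintegralZl//; [|exact: rintegrable_sqn2_tpoly].
  rewrite -RintegralD//; [|exact: rintegrableZ|].
    2: by apply: rintegrableZ => //; exact: rintegrable_sqn2_tpoly.
  apply: le_Rintegral => //; first by case: hg.
    apply: rintegrableD => //; apply: rintegrableZ => //.
    exact: rintegrable_sqn2_tpoly.
  move=> x _; apply: le_trans (Re_le_modc _) _; rewrite modcM modcJ.
  exact: young43.
have : (4 * s ^+ 3)^-1 * \int[leb2]_(x in cell) (sqn (h x) ^+ 2) <= X / 4.
  apply: (@le_trans _ _ ((4 * s ^+ 3)^-1 * (84 * area * X ^+ 2))).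
    rewrite ler_wpM2l//; first by rewrite invr_ge0 mulr_ge0// exprn_ge0// ltW.
    by rewrite -[X in X ^+ 2]cX; exact: tpoly_L4_le.
  rewrite s3 le_eqVlt; apply/orP; left; apply/eqP; rewrite /S; field.
  by rewrite !gt_eqF.
set I := _ * \int[_]_(_ in _) _ => hI hX.
have XsG : X <= s * G by move: hI hX; lra.
have X3 : X ^+ 3 <= (s * G) ^+ 3.
  by rewrite lerXn2r ?nnegrE// mulr_ge0// ltW.
rewrite exprMn s3 /S in X3.
rewrite -(ler_pM2l Xgt0) -exprS.
by apply: le_trans X3 _; rewrite le_eqVlt; apply/orP; left; apply/eqP; ring.
Qed.

(** Pairing [u] with its own partial Fourier sum. *)
Lemma bessel (u : R * R -> R[i]) s : uniq s -> cintegrable leb2 cell u ->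
  rintegrable leb2 cell (fun x => sqn (u x)) ->
  \sum_(n <- s) sqn (fcoef u n) <= area * \int[leb2]_(x in cell) sqn (u x).
Proof.
move=> us ui u2; set T := \sum_(n <- _) _.
pose h := tpoly s (fcoef u).
have TE : T = \int[leb2]_(x in cell) complex.Re ((h x)^*%C * u x).
  rewrite -Re_cint cint_tpolyJ// Re_sum; apply: eq_bigr => n _.
  by rewrite mulrC mulJc.
have hu : cintegrable leb2 cell (fun x => (h x)^*%C * u x).
  apply: (cintegrableM_bounded mc (M := \sum_(n <- s) modc (fcoef u n))) => //.
    exact/cmeasurableJ/cmeasurable_tpoly.
  by move=> x _; rewrite modcJ modc_tpoly_le.
have : T <= area / 2 * \int[leb2]_(x in cell) sqn (u x) +
            (2 * area)^-1 * \int[leb2]_(x in cell) sqn (h x).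
  rewrite TE -!RintegralZl//; [|exact: rintegrable_sqn_tpoly].
  rewrite -RintegralD//; [|exact: rintegrableZ|].
    2: by apply: rintegrableZ => //; exact: rintegrable_sqn_tpoly.
  apply: le_Rintegral => //; first by case: hu.
    apply: rintegrableD => //; apply: rintegrableZ => //.
    exact: rintegrable_sqn_tpoly.
  move=> x _; apply: le_trans (Re_le_modc _) _; rewrite modcM modcJ.
  rewrite -!sqr_modc -subr_ge0.
  rewrite [X in 0 <= X](_ : _ = (2 * area)^-1 * (area * modc (u x) - modc (h x)) ^+ 2).
    by rewrite mulr_ge0 ?sqr_ge0// invr_ge0 mulr_ge0// ltW.
  by field; rewrite !gt_eqF.
rewrite parseval_tpoly// -/T.
have -> : (2 * area)^-1 * (area * T) = T / 2 by field; rewrite !gt_eqF.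
set U := \int[_]_(_ in _) _; lra.
Qed.

End Embedding.

(** * Trigonometric approximation of half-lines *)

Section HalfLine.
Variable R : realType.
Implicit Types (x y s t : R).

Lemma bernoulli_ge (y : R) (n : nat) : 0 <= y -> 1 + n%:R * y <= (1 + y) ^+ n.
Proof.
move=> y0; elim: n => [|n IH]; first by rewrite mul0r addr0 expr0.
rewrite exprS; apply: (@le_trans _ _ ((1 + y) * (1 + n%:R * y))).
  have n0 : 0 <= n%:R :> R by [].
  rewrite -natr1 mulrDl mul1r; nra.
by rewrite ler_wpM2l// addr_ge0.
Qed.

Lemma bernoulli_le (y : R) (n : nat) : 0 <= y <= 1 -> 1 - n%:R * y <= (1 - y) ^+ n.
Proof.
move=> /andP[y0 y1]; elim: n => [|n IH]; first by rewrite mul0r subr0 expr0.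
rewrite exprS; apply: (@le_trans _ _ ((1 - y) * (1 - n%:R * y))).
  have n0 : 0 <= n%:R :> R by [].
  rewrite -natr1 mulrDl mul1r; nra.
by rewrite ler_wpM2l// subr_ge0.
Qed.

(** Weierstrass-type polynomials in [q] which converge to 1 for [q < 1/2] and
    to 0 for [q > 1/2]. *)
Definition step_poly (q : R) (k : nat) : R := (1 - q ^+ k) ^+ (2 ^ k).

Lemma step_poly01 q k : 0 <= q <= 1 -> 0 <= step_poly q k <= 1.
Proof.
move=> /andP[q0 q1]; have qk : q ^+ k <= 1 by rewrite exprn_ile1.
rewrite exprn_ge0 ?subr_ge0//= exprn_ile1// ?subr_ge0//.
by rewrite lerBlDr lerDl exprn_ge0.
Qed.

(** Bernoulli: [(1 - q^k)^(2^k) >= 1 - (2 q)^k]. *)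
Lemma step_poly_cvg1 q : 0 <= q -> q < 1 / 2 -> step_poly q k @[k --> \oo] --> (1 : R).
Proof.
move=> q0 q2; have q01 : 0 <= q <= 1 by rewrite q0 /=; lra.
apply: (@squeeze_cvgr _ _ _ _ (fun k => 1 - (2 * q) ^+ k) (fun=> 1)).
- apply: nearW => k; have /andP[_ ->] := step_poly01 k q01; rewrite andbT.
  have := @bernoulli_le (q ^+ k) (2 ^ k).
  rewrite exprn_ge0// exprn_ile1 ?(andP q01).2// => /(_ isT).
  by rewrite natrX -exprMn.
- rewrite -[X in _ --> X]subr0; apply: cvgB; first exact: cvg_cst.
  apply: cvg_expr; rewrite ger0_norm; lra.
- exact: cvg_cst.
Qed.

(** Bernoulli: [(1 - q^k)^(2^k) <= (1 + q^k)^-(2^k) <= (2 q)^-k]. *)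
Lemma step_poly_cvg0 q : 1 / 2 < q -> q <= 1 -> step_poly q k @[k --> \oo] --> (0 : R).
Proof.
move=> q2 q1; have q01 : 0 <= q <= 1 by rewrite q1 andbT; lra.
have q0 : 0 <= q by case/andP: q01.
have qq : 0 < 2 * q by lra.
apply: (@squeeze_cvgr _ _ _ _ (fun=> 0) (fun k => (2 * q)^-1 ^+ k)).
- apply: nearW => k; have /andP[-> _] /= := step_poly01 k q01.
  have yk0 : 0 <= q ^+ k by rewrite exprn_ge0.
  have yk1 : q ^+ k <= 1 by rewrite exprn_ile1.
  rewrite exprVn -[leRHS]mul1r ler_pdivlMr ?exprn_gt0//.
  apply: (@le_trans _ _ ((1 - q ^+ k) ^+ (2 ^ k) * (1 + q ^+ k) ^+ (2 ^ k))).
    rewrite ler_wpM2l ?exprn_ge0 ?subr_ge0//.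
    apply: le_trans (bernoulli_ge (2 ^ k) yk0).
    by rewrite natrX -exprMn lerDr.
  rewrite -exprMn exprn_ile1//.
    by rewrite mulr_ge0 ?subr_ge0// addr_ge0.
  by nra.
- exact: cvg_cst.
- apply: cvg_expr; rewrite ger0_norm ?invr_ge0 ?(ltW qq)// invf_lt1//; lra.
Qed.

(** Closure under products is part of the definition; in two variables the
    smaller class [trig] is closed under products as well ([trigM]). *)
Inductive trig1 (l : R) : (R -> R) -> Prop :=
| trig1_cst c : trig1 l (fun=> c)
| trig1_cos : trig1 l (fun x => cos (2 * pi / l * x))
| trig1_sin : trig1 l (fun x => sin (2 * pi / l * x))
| trig1D f g : trig1 l f -> trig1 l g -> trig1 l (fun x => f x + g x)
| trig1M f g : trig1 l f -> trig1 l g -> trig1 l (fun x => f x * g x).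

Lemma trig1X l f n : trig1 l f -> trig1 l (fun x => f x ^+ n).
Proof.
move=> tf; elim: n => [|n IH]; first exact: trig1_cst.
under eq_fun do rewrite exprS.
exact: trig1M.
Qed.

(** The trigonometric polynomial [sin (pi x / l) sin (pi (x - t) / l)], which is
    positive exactly to the right of [t] when [x] and [t] lie in ]0, l[. *)
Definition sep l t x : R := sin (pi / l * x) * sin (pi / l * (x - t)).

Lemma sepE l t x : sep l t x =
  1 / 2 * cos (pi / l * t) + (- (1 / 2) * cos (pi / l * t)) * cos (2 * pi / l * x) +
  (- (1 / 2) * sin (pi / l * t)) * sin (2 * pi / l * x).
Proof.
have -> : 2 * pi / l * x = pi / l * x + pi / l * x by ring.
rewrite /sep mulrBr; set a := pi / l * x; set b := pi / l * t.
rewrite sinB cosD sinD.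
have := cos2Dsin2 a; move: (cos a) (sin a) (cos b) (sin b) => ca sa cb sb h.
have -> : 1 / 2 * cb = 1 / 2 * cb * (ca ^+ 2 + sa ^+ 2) by rewrite h mulr1.
by field.
Qed.

Lemma trig1_sep l t : trig1 l (sep l t).
Proof.
rewrite (funext (sepE l t)).
apply: trig1D; first apply: trig1D.
- exact: trig1_cst.
- apply: trig1M; [exact: trig1_cst|exact: trig1_cos].
- apply: trig1M; [exact: trig1_cst|exact: trig1_sin].
Qed.

Lemma sep_norm_le1 l t x : `|sep l t x| <= 1.
Proof. by rewrite normrM mulr_ile1 ?sin_max. Qed.

Lemma sin_scaled_gt0 l x : 0 < x -> x < l -> 0 < sin (pi / l * x).
Proof.
move=> x0 xl; have l0 : 0 < l := lt_trans x0 xl.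
apply: sin_gt0_pi; rewrite mulr_gt0 ?divr_gt0 ?pi_gt0//=.
by rewrite -mulrA gtr_pMr ?pi_gt0// mulrC ltr_pdivrMr// mul1r.
Qed.

Lemma sep_gt0 l t x : 0 < t -> x < l -> t < x -> 0 < sep l t x.
Proof. by move=> t0 xl tx; apply: mulr_gt0; apply: sin_scaled_gt0; lra. Qed.

Lemma sep_lt0 l t x : t < l -> 0 < x -> x < t -> sep l t x < 0.
Proof.
move=> tl x0 xt; rewrite /sep -[x - t]opprB mulrN sinN mulrN oppr_lt0.
by apply: mulr_gt0; apply: sin_scaled_gt0; lra.
Qed.

(** Composing [step_poly] with the affine image [q = 1/2 - sep / 2] of the
    separating polynomial [sep l t]: for [0 < x < l] one has [q < 1/2] exactly
    when [t < x]. *)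
Lemma half_line_approx l t : exists u : nat -> R -> R,
  [/\ forall k x, 0 <= u k x <= 1, forall k, trig1 l (u k) &
      forall x, 0 < x < l -> x != t -> u k x @[k --> \oo] --> ((t < x)%R%:R : R)].
Proof.
(* Outside ]0, l[ the half-line contains all of the interval or none of it. *)
have [t0|t0] := leP t 0.
  exists (fun _ _ => 1); split => [k x|k|x /andP[x0 _] _]; first by rewrite ler01 lexx.
    exact: trig1_cst.
  by rewrite (le_lt_trans t0 x0); exact: cvg_cst.
have [tl|tl] := leP l t.
  exists (fun _ _ => 0); split => [k x|k|x /andP[_ xl] _]; first by rewrite ler01 lexx.
    exact: trig1_cst.
  by rewrite ltNge (le_trans (ltW xl) tl)/=; exact: cvg_cst.
pose q x := 1 / 2 + - (1 / 2) * sep l t x.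
have q01 x : 0 <= q x <= 1.
  by have := sep_norm_le1 l t x; rewrite /q ler_norml => /andP[? ?]; apply/andP; split; lra.
exists (fun k x => step_poly (q x) k); split.
- by move=> k x; exact: step_poly01.
- move=> k; apply: trig1X.
  under eq_fun do rewrite -[q _ ^+ k]mul1r -mulNr.
  apply: trig1D; first exact: trig1_cst.
  apply: trig1M; first exact: trig1_cst.
  apply: trig1X; apply: trig1D; first exact: trig1_cst.
  by apply: trig1M; [exact: trig1_cst|exact: trig1_sep].
- move=> x /andP[x0 xl]; rewrite neq_lt => /orP[xt|tx].
    have -> : (t < x) = false by apply/negbTE; rewrite -leNgt ltW.
    apply: step_poly_cvg0; last by case/andP: (q01 x).
    by have := sep_lt0 tl x0 xt; rewrite /q; lra.
  rewrite tx; apply: step_poly_cvg1; first by case/andP: (q01 x).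
  by have := sep_gt0 t0 xl tx; rewrite /q; lra.
Qed.

End HalfLine.

Section TrigAlgebra.
Variables (R : realType) (l1 l2 : R).
Hypotheses (l1_gt0 : 0 < l1) (l2_gt0 : 0 < l2).
Local Notation expi := (expi l1 l2).
Local Notation tpoly := (tpoly l1 l2).

Inductive trig : (R * R -> R[i]) -> Prop :=
| trig_expi n : trig (expi n)
| trigZ c P : trig P -> trig (fun x => c * P x)
| trigD P Q : trig P -> trig Q -> trig (fun x => P x + Q x).

Lemma trigM P Q : trig P -> trig Q -> trig (fun x => P x * Q x).
Proof.
move=> tP tQ; elim: tP => [n|c P' _ IH|P1 P2 _ IH1 _ IH2].
- elim: tQ => [k|c Q' _ IH|Q1 Q2 _ IH1 _ IH2].
  + by under eq_fun do rewrite -expiD; exact: trig_expi.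
  + by under eq_fun do rewrite mulrCA; exact: trigZ.
  + by under eq_fun do rewrite mulrDr; exact: trigD.
- by under eq_fun do rewrite -mulrA; exact: trigZ.
- by under eq_fun do rewrite mulrDl; exact: trigD.
Qed.

Lemma tpoly_pad N M c : (N <= M)%N ->
  tpoly (zbox N) c = tpoly (zbox M) (fun n => if n \in zbox N then c n else 0).
Proof.
move=> NM; apply/funext => x; rewrite /tpoly.
rewrite (@sum_reindex _ _ _ (zbox M) (zbox N) id
  (fun n => (if n \in zbox N then c n else 0) * expi n x)).
- by rewrite big_seq [RHS]big_seq; apply: eq_bigr => n ->.
- exact: uniq_zbox.
- exact: uniq_zbox.
- exact: inj_id.
- by move=> n; rewrite map_id !mem_zbox => /leq_trans; exact.
- by move=> n _ /negbTE ->; rewrite mul0r.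
Qed.

Lemma trig_tpoly P : trig P -> exists N c, P = tpoly (zbox N) c.
Proof.
elim => [n|c P' _ [N [b ->]]|P1 P2 _ [N1 [b1 ->]] _ [N2 [b2 ->]]].
- exists (supn n), (fun k => (k == n)%:R); apply/funext => x.
  rewrite /tpoly (bigD1_seq n) ?uniq_zbox ?mem_zbox//= eqxx mul1r big1 ?addr0//.
  by move=> k /negbTE ->; rewrite mul0r.
- exists N, (fun k => c * b k); apply/funext => x.
  by rewrite /tpoly mulr_sumr; apply: eq_bigr => k _; rewrite mulrA.
- rewrite (tpoly_pad b1 (leq_maxl N1 N2)) (tpoly_pad b2 (leq_maxr N1 N2)).
  set d1 := (fun n => if n \in zbox N1 then _ else _).
  set d2 := (fun n => if n \in zbox N2 then _ else _).
  exists (maxn N1 N2), (fun k => d1 k + d2 k); apply/funext => x.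
  rewrite /tpoly -big_split; apply: eq_bigr => k _.
  by rewrite mulrDl.
Qed.

Lemma trig_cst c : trig (fun=> c).
Proof.
rewrite (_ : (fun=> c) = (fun x => c * expi 0 x)).
  exact/trigZ/trig_expi.
by apply/funext => x; rewrite expi0 mulr1.
Qed.

Lemma trig_cos n : trig (fun x => (cos (freq l1 l2 n x))%:C%C).
Proof.
rewrite (_ : (fun x => _) =
  (fun x => (1 / 2)%:C%C * expi n x + (1 / 2)%:C%C * expi (- n) x)).
  by apply: trigD; exact/trigZ/trig_expi.
by apply/funext => x; apply: complex_ext; rewrite expiN !ReImE /=; field.
Qed.

Lemma trig_sin n : trig (fun x => (sin (freq l1 l2 n x))%:C%C).
Proof.
rewrite (_ : (fun x => _) =
  (fun x => Complex 0 (- (1 / 2)) * expi n x + Complex 0 (1 / 2) * expi (- n) x)).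
  by apply: trigD; exact/trigZ/trig_expi.
by apply/funext => x; apply: complex_ext; rewrite expiN !ReImE /=; field.
Qed.

Lemma trig1_trig1 f : trig1 l1 f -> trig (fun x => (f x.1)%:C%C).
Proof.
elim=> [c|||f1 f2 _ h1 _ h2|f1 f2 _ h1 _ h2].
- exact: trig_cst.
- have := trig_cos (1, 0); congr trig; apply/funext => x.
  by congr (cos _)%:C%C; rewrite /freq /=; ring.
- have := trig_sin (1, 0); congr trig; apply/funext => x.
  by congr (sin _)%:C%C; rewrite /freq /=; ring.
- by under eq_fun do rewrite rmorphD; exact: trigD.
- by under eq_fun do rewrite rmorphM; exact: trigM.
Qed.

Lemma trig1_trig2 f : trig1 l2 f -> trig (fun x => (f x.2)%:C%C).
Proof.
elim=> [c|||f1 f2 _ h1 _ h2|f1 f2 _ h1 _ h2].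
- exact: trig_cst.
- have := trig_cos (0, 1); congr trig; apply/funext => x.
  by congr (cos _)%:C%C; rewrite /freq /=; ring.
- have := trig_sin (0, 1); congr trig; apply/funext => x.
  by congr (sin _)%:C%C; rewrite /freq /=; ring.
- by under eq_fun do rewrite rmorphD; exact: trigD.
- by under eq_fun do rewrite rmorphM; exact: trigM.
Qed.

End TrigAlgebra.

(** * Density of trigonometric polynomials in weighted L^2 *)

Section HalfPlanes.
Variable R : realType.

Definition ray (a : option R) : set (measurableTypeR R) :=
  if a is Some s then `]s, +oo[ else setT.

(** A pi-system which generates the sigma-algebra of the plane and whose
    indicators are products of indicators of half-lines. *)
Definition quadrants : set (set (plane R)) :=
  [set A | exists a b, A = ray a `*` ray b].

Lemma measurable_ray a : measurable (ray a).
Proof. by case: a => [s|]; [exact: measurable_itv|exact: measurableT]. Qed.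

Lemma rayI a b : exists c, ray a `&` ray b = ray c.
Proof.
case: a b => [s|] [t|] /=.
- exists (Some (Num.max s t)); apply/seteqP; split => x /=; rewrite !in_itv/= !andbT.
    by move=> [sx tx]; rewrite gt_max sx tx.
  by rewrite gt_max => /andP[].
- by exists (Some s); rewrite setIT.
- by exists (Some t); rewrite setTI.
- by exists None; rewrite setIT.
Qed.

Lemma quadrantsI : setI_closed quadrants.
Proof.
move=> _ _ [a [b ->]] [c [d ->]].
have [p acp] := rayI a c; have [q bdq] := rayI b d.
by exists p, q; rewrite -setXI acp bdq.
Qed.

Lemma measurable_quadrants : measurable `<=` <<s quadrants >>.
Proof.
rewrite measurable_prod_measurableType; apply: smallest_sub.
  exact: smallest_sigma_algebra.
move=> _ [A mA [B mB <-]].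
have m1 : measurable_fun setT
    (fst : g_sigma_algebraType quadrants -> measurableTypeR R).
  apply: (measurability (@RGenOInfty.G R)); first exact: RGenOInfty.measurableE.
  move=> _ [_ [x ->] <-]; apply: sub_sigma_algebra.
  exists (Some x), None; apply/seteqP; split => -[u v] /=; first by move=> [].
  by move=> [].
have m2 : measurable_fun setT
    (snd : g_sigma_algebraType quadrants -> measurableTypeR R).
  apply: (measurability (@RGenOInfty.G R)); first exact: RGenOInfty.measurableE.
  move=> _ [_ [x ->] <-]; apply: sub_sigma_algebra.
  exists None, (Some x); apply/seteqP; split => -[u v] /=; first by move=> [].
  by move=> [].
have := measurableI _ _ (m1 measurableT A mA) (m2 measurableT B mB).
rewrite !setTI; congr (measurable _).
Qed.

End HalfPlanes.

Section Density.
Variables (R : realType) (l1 l2 : R).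
Hypotheses (l1_gt0 : 0 < l1) (l2_gt0 : 0 < l2).
Local Notation cell := (@cell R l1 l2).
Local Notation leb2 := (leb2 R).
Local Notation trig := (trig l1 l2).

Let mc := measurable_cell l1 l2.

Variable rho : R * R -> R.
Hypothesis rho_ge0 : forall x, 0 <= rho x.
Hypothesis irho : rintegrable leb2 cell rho.

Definition bmeas (f : R * R -> R[i]) :=
  cmeasurable cell f /\ exists M : R, forall x, cell x -> modc (f x) <= M.

Lemma bmeas_trig P : trig P -> bmeas P.
Proof.
move=> /trig_tpoly[N [c ->]]; split.
  exact: cmeasurable_tpoly.
by exists (\sum_(n <- zbox N) modc (c n)) => x _; exact: modc_tpoly_le.
Qed.

Lemma cmeasurableD (f g : R * R -> R[i]) : cmeasurable cell f ->
  cmeasurable cell g -> cmeasurable cell (fun x => f x + g x).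
Proof.
by move=> [fr fi] [gr gi]; split; under eq_fun do rewrite ReImE; exact: measurable_funD.
Qed.

Lemma bmeasD f g : bmeas f -> bmeas g -> bmeas (fun x => f x + g x).
Proof.
move=> [mf [M fM]] [mg [N gN]]; split; first exact: cmeasurableD.
by exists (M + N) => x cx; rewrite (le_trans (modcD_le _ _))// lerD ?fM ?gN.
Qed.

Lemma bmeasN f : bmeas f -> bmeas (fun x => - f x).
Proof.
move=> [[mr mi] [M fM]]; split.
  by split; under eq_fun do rewrite ReImE; exact: measurableT_comp.
by exists M => x cx; rewrite /modc sqnN; exact: fM.
Qed.

Lemma bmeas_real (h : R * R -> R) : measurable_fun cell h ->
  (exists M : R, forall x, cell x -> `|h x| <= M) -> bmeas (fun x => (h x)%:C%C).
Proof.
move=> mh [M hM]; split; first by split => //=; exact: measurable_cst.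
by exists M => x cx; rewrite /modc sqn_real sqrtr_sqr hM.
Qed.

(** Applied to a difference, this is the squared distance in L^2(rho). *)
Definition dist2 (f : R * R -> R[i]) : R :=
  \int[leb2]_(x in cell) (sqn (f x) * rho x).

Lemma rintegrable_dist2 f : bmeas f ->
  rintegrable leb2 cell (fun x => sqn (f x) * rho x).
Proof.
move=> [mf [M fM]].
apply: (rintegrable_le mc (g := fun x => M ^+ 2 * rho x)).
- by apply: measurable_funM; [exact: measurable_sqn|exact: rintegrable_measurable irho].
- move=> x cx; rewrite normrM !ger0_norm ?sqn_ge0// ler_wpM2r// -sqr_modc.
  by rewrite lerXn2r ?nnegrE ?modc_ge0 ?fM// (le_trans (modc_ge0 _) (fM x cx)).
- exact: rintegrableZ.
Qed.

Lemma dist2D f g : bmeas f -> bmeas g ->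
  dist2 (fun x => f x + g x) <= 2 * dist2 f + 2 * dist2 g.
Proof.
move=> bf bg; rewrite /dist2 -!RintegralZl//; try exact: rintegrable_dist2.
rewrite -RintegralD//; try by apply: rintegrableZ => //; exact: rintegrable_dist2.
apply: le_Rintegral => //.
- exact/rintegrable_dist2/bmeasD.
- by apply: rintegrableD => //; apply: rintegrableZ => //; exact: rintegrable_dist2.
- by move=> x _; rewrite !mulrA -mulrDl ler_wpM2r// sqnD_le.
Qed.

Definition approximable (h : R * R -> R) :=
  bmeas (fun x => (h x)%:C%C) /\
  forall e : R, 0 < e -> exists2 P, trig P & dist2 (fun x => (h x)%:C%C - P x) <= e.

Lemma approximable_trig h : trig (fun x => (h x)%:C%C) -> approximable h.
Proof.
move=> th; split; first exact: bmeas_trig.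
move=> e e0; exists (fun x => (h x)%:C%C) => //.
rewrite /dist2; under eq_Rintegral do rewrite subrr sqn0 mul0r.
by rewrite /Rintegral integral0 ltW.
Qed.

Lemma bmeasB f g : bmeas f -> bmeas g -> bmeas (fun x => f x - g x).
Proof. by move=> bf /bmeasN; exact: bmeasD. Qed.

Lemma approximableD g h : approximable g -> approximable h ->
  approximable (fun x => g x + h x).
Proof.
move=> [bg ag] [bh ah]; split.
  by under eq_fun do rewrite rmorphD; exact: bmeasD.
move=> e e0; have e4 : 0 < e / 4 by rewrite divr_gt0.
have [P tP hP] := ag _ e4; have [Q tQ hQ] := ah _ e4.
exists (fun x => P x + Q x); first exact: trigD.
under eq_fun do rewrite rmorphD opprD addrACA.
apply: (le_trans (dist2D _ _)).
- by apply: bmeasB => //; exact: bmeas_trig.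
- by apply: bmeasB => //; exact: bmeas_trig.
- lra.
Qed.

Lemma approximableZ k h : approximable h -> approximable (fun x => k * h x).
Proof.
move=> [bh ah]; split.
  case: bh => mh [M hM]; split.
    under eq_fun do rewrite rmorphM.
    by apply: cmeasurableM => //; split; exact: measurable_cst.
  exists (`|k| * M) => x cx; rewrite rmorphM modcM ler_pM ?modc_ge0 ?hM//.
  by rewrite /modc sqn_real sqrtr_sqr.
move=> e e0; have k0 : 0 < k ^+ 2 + 1 by rewrite ltr_wpDl ?sqr_ge0.
have [P tP hP] := ah _ (divr_gt0 e0 k0).
exists (fun x => k%:C%C * P x); first exact: trigZ.
have -> : dist2 (fun x => (k * h x)%:C%C - k%:C%C * P x) =
    k ^+ 2 * dist2 (fun x => (h x)%:C%C - P x).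
  rewrite /dist2 -RintegralZl//; last first.
    by apply: rintegrable_dist2; apply: bmeasB => //; exact: bmeas_trig.
  by apply: eq_Rintegral => x _; rewrite rmorphM -mulrBr sqnM sqn_real mulrA.
apply: (@le_trans _ _ (k ^+ 2 * (e / (k ^+ 2 + 1)))); first by rewrite ler_wpM2l ?sqr_ge0.
by rewrite mulrCA ger_pMr// ler_pdivrMr// mul1r lerDl.
Qed.

Lemma approximable_sum (I : Type) (s : seq I) (F : I -> R * R -> R) :
  (forall i, approximable (F i)) -> approximable (fun x => \sum_(i <- s) F i x).
Proof.
move=> aF; elim: s => [|i s IH].
  by under eq_fun do rewrite big_nil; apply: approximable_trig; exact: trig_cst.
by under eq_fun do rewrite big_cons; exact: approximableD.
Qed.

(** Dominated convergence, then the triangle inequality. *)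
Lemma approximable_lim (h_ : nat -> R * R -> R) (h : R * R -> R) (M : R) :
  (forall k, approximable (h_ k)) -> measurable_fun cell h ->
  (forall k x, cell x -> `|h_ k x| <= M) -> (forall x, cell x -> `|h x| <= M) ->
  {ae leb2, forall x, cell x -> h_ k x @[k --> \oo] --> h x} ->
  approximable h.
Proof.
move=> ah mh hkM hM hcvg.
have bh : bmeas (fun x => (h x)%:C%C) by apply: bmeas_real => //; exists M.
split=> // e e0.
pose f_ k x := ((h_ k x - h x) ^+ 2 * rho x)%:E.
have mhk k : measurable_fun cell (h_ k) by case: (ah k) => -[[]].
have mrho := rintegrable_measurable irho.
have F1 k : measurable_fun cell (f_ k).
  apply/measurable_EFinP/measurable_funM => //.
  by apply/measurable_funX/measurable_funB.
have F2 : {ae leb2, forall x, cell x -> f_ ^~ x @ \oo --> 0%E}.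
  apply: filterS hcvg => x hx cx; apply: cvg_EFin; first exact: nearW.
  rewrite /comp /f_ /=.
  rewrite -[X in _ --> X](mul0r (rho x)); apply: cvgMl.
  rewrite -[X in _ --> X](expr0n _ 2).
  rewrite (_ : 0 = h x - h x)//; last by rewrite subrr.
  under eq_fun do rewrite expr2; rewrite expr2.
  by apply: cvgM; apply: cvgB => //; try exact: hx; exact: cvg_cst.
have F3 : leb2.-integrable cell (fun x => ((M + M) ^+ 2 * rho x)%:E).
  exact: (rintegrableZ mc).
have F4 : {ae leb2, forall x k, cell x -> (`|f_ k x| <= ((M + M) ^+ 2 * rho x)%:E)%E}.
  apply: aeW => x k cx; rewrite lee_fin normrM ger0_norm ?sqr_ge0// ger0_norm//.
  rewrite ler_wpM2r// -real_normK ?num_real//.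
  rewrite lerXn2r ?nnegrE//; last by rewrite (le_trans (ler_normB _ _))// lerD ?hkM ?hM.
  have M0 : 0 <= M := le_trans (normr_ge0 _) (hM x cx).
  exact: addr_ge0.
have [_ _] := dominated_convergence mc F1 (measurable_cst _) F2 F3 F4.
rewrite integral0 => lim0.
have e8 : 0 < e / 4 by rewrite divr_gt0.
have [k hk] : exists k, dist2 (fun x => (h x)%:C%C - (h_ k x)%:C%C) <= e / 4.
  have /fine_cvgP[_ /cvgrPdist_le/(_ _ e8)[k _ /(_ k (leqnn k))]] := lim0.
  rewrite /= sub0r normrN => hk; exists k; apply: le_trans hk.
  rewrite (_ : dist2 _ = fine (\int[leb2]_(x in cell) f_ k x)).
    exact: ler_norm.
  apply: eq_Rintegral => x _.
  by rewrite -rmorphB sqn_real -[h x - _]opprB sqrrN.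
have [bhk ahk] := ah k.
have [P tP hP] := ahk _ e8; exists P => //.
rewrite (_ : (fun x => _) = (fun x => ((h x)%:C%C - (h_ k x)%:C%C) + ((h_ k x)%:C%C - P x))).
  apply: (le_trans (dist2D _ _)).
  - exact: bmeasB.
  - by apply: bmeasB => //; exact: bmeas_trig.
  - lra.
by apply/funext => x; rewrite addrA subrK.
Qed.

Lemma ae_and (P Q : plane R -> Prop) : {ae leb2, forall x, P x} ->
  {ae leb2, forall x, Q x} -> {ae leb2, forall x, P x /\ Q x}.
Proof.
have aeF : Filter (almost_everywhere leb2) := ae_filter_ringOfSetsType leb2.
by move=> aP aQ; exact: (@filterI _ _ aeF _ _ aP aQ).
Qed.

Lemma ae_imply (P Q : plane R -> Prop) : (forall x, P x -> Q x) ->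
  {ae leb2, forall x, P x} -> {ae leb2, forall x, Q x}.
Proof.
have aeF : Filter (almost_everywhere leb2) := ae_filter_ringOfSetsType leb2.
by move=> PQ; exact: (@filterS _ _ aeF _ _ PQ).
Qed.

Lemma ae_fst_neq (s : R) : {ae leb2, forall x, x.1 != s}.
Proof.
exists ([set s] `*` setT); split.
- exact: measurableX.
- transitivity ((lebesgue_measure [set s] * lebesgue_measure [set: R])%E : \bar R).
    exact: (product_measure1E lebesgue_measure lebesgue_measure).
  by rewrite lebesgue_measure_set1 mul0e.
- by move=> x /= /negP; rewrite negbK => /eqP.
Qed.

Lemma ae_snd_neq (s : R) : {ae leb2, forall x, x.2 != s}.
Proof.
exists (setT `*` [set s]); split.
- exact: measurableX.
- transitivity ((lebesgue_measure [set: R] * lebesgue_measure [set s])%E : \bar R).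
    exact: (product_measure1E lebesgue_measure lebesgue_measure).
  by rewrite lebesgue_measure_set1 mule0.
- by move=> x /= /negP; rewrite negbK => /eqP.
Qed.

Lemma ray_approx (l : R) (a : option R) : exists (s : R) (u : nat -> R -> R),
  [/\ forall k x, 0 <= u k x <= 1, forall k, trig1 l (u k) &
      forall x, 0 < x < l -> x != s -> u k x @[k --> \oo] --> (\1_(ray a) x : R)].
Proof.
case: a => [s|].
  have [u [u01 tu cu]] := half_line_approx l s; exists s, u; split => // x xl xs.
  rewrite indicE mem_setE /= in_itv /= andbT; exact: cu.
exists 0, (fun _ _ => 1); split => [k x|k|x _ _]; first by rewrite ler01 lexx.
  exact: trig1_cst.
by rewrite indicE in_setT; exact: cvg_cst.
Qed.

(** The product of the one-dimensional approximants converges off four lines,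
    which are null. *)
Lemma approximable_quadrant A : quadrants A -> approximable (\1_A).
Proof.
move=> [a [b ->]].
have [s [u [u01 tu cu]]] := ray_approx l1 a.
have [t [v [v01 tv cv]]] := ray_approx l2 b.
apply: (@approximable_lim (fun k x => u k x.1 * v k x.2) _ 1).
- move=> k; apply: approximable_trig; under eq_fun do rewrite rmorphM.
  by apply: trigM; [exact: trig1_trig1|exact: trig1_trig2].
- by apply: measurable_funTS; apply: measurable_indic; apply: measurableX; exact: measurable_ray.
- move=> k x _; rewrite normrM.
  have /andP[? ?] := u01 k x.1; have /andP[? ?] := v01 k x.2.
  by rewrite !ger0_norm// mulr_ile1.
- by move=> x _; rewrite indicE; case: (_ \in _); rewrite ?normr1 ?normr0.
- apply: ae_imply (ae_and (ae_and (ae_fst_neq 0) (ae_fst_neq s))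
    (ae_and (ae_snd_neq 0) (ae_snd_neq t))) => -[x y] /= [[x0 xs] [y0 yt]].
  rewrite /Defs.cell /= !in_itv/= => -[/andP[x0' xl] /andP[y0' yl]].
  have -> : \1_(ray a `*` ray b) (x, y) = \1_(ray a) x * \1_(ray b) y :> R.
    rewrite !indicE in_setX /=.
    by case: (x \in _); case: (y \in _); rewrite ?mulr1 ?mulr0 ?mul0r.
  by apply: cvgM; [apply: cu|apply: cv] => //; rewrite lt_neqAle eq_sym ?x0 ?y0 ?x0' ?y0'.
Qed.

(** Dynkin's lambda-system theorem: differences and increasing unions of
    approximable sets are approximable, and quadrants generate. *)
Lemma approximable_indic (A : set (plane R)) : measurable A -> approximable (\1_A).
Proof.
move=> mA; have := measurable_quadrants mA.
suff HL : lambda_system setT [set B : set (plane R) | measurable B /\ approximable (\1_B)].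
  move=> /(lambda_system_subset (@quadrantsI R) HL); case => //.
  move=> B qB; split; last exact: approximable_quadrant.
  by case: qB => a [b ->]; apply: measurableX; exact: measurable_ray.
split=> //.
- split; first exact: measurableT.
  apply: approximable_trig; rewrite indicT.
  exact: (trig_cst _ _ 1%:C%C).
- move=> B C CB [mB aB] [mC aC]; split; first exact: measurableD.
  rewrite (_ : \1_(B `\` C) = (fun x => \1_B x + (-1) * \1_C x)).
    by apply: approximableD => //; exact: approximableZ.
  apply/funext => x; rewrite !indicE in_setD mulN1r.
  have [/set_mem Cx|Cx] := boolP (x \in C); last by rewrite andbT subr0.
  by rewrite andbF (mem_set (CB _ Cx)) subrr.
- move=> F ndF HF; have mF k : measurable (F k) by case: (HF k).
  split; first exact: bigcupT_measurable.
  apply: (@approximable_lim (fun k => \1_(F k)) _ 1).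
  + by move=> k; case: (HF k).
  + by apply: measurable_funTS; apply: measurable_indic; exact: bigcupT_measurable.
  + by move=> k x _; rewrite indicE; case: (_ \in _); rewrite ?normr1 ?normr0.
  + by move=> x _; rewrite indicE; case: (_ \in _); rewrite ?normr1 ?normr0.
  + apply: aeW => x _; rewrite indicE; case: (boolP (x \in _)) => [|xF].
      rewrite inE => -[k _ Fkx]; apply: cvg_near_cst; exists k => // i /= ki.
      rewrite indicE mem_set//; move: Fkx; exact/subsetPset/ndF.
    apply: cvg_near_cst; apply: nearW => i; rewrite indicE memNset//.
    by move=> Fix; move/negP: xF; apply; rewrite inE; exists i.
Qed.

Lemma approximable_nnsfun (h : {nnsfun plane R >-> R}) :
  approximable (fun x => h x).
Proof.
under eq_fun do rewrite fimfunEord.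
apply: approximable_sum => i; apply: approximableZ; apply: approximable_indic.
exact: measurable_sfunP.
Qed.

End Density.

(** * From weighted square-summability to L^4: one sign of the real part *)

Section Regularity.
Variables (R : realType) (l1 l2 : R).
Hypotheses (l1_gt0 : 0 < l1) (l2_gt0 : 0 < l2).
Local Notation cell := (@cell R l1 l2).
Local Notation leb2 := (leb2 R).
Local Notation tpoly := (tpoly l1 l2).
Local Notation fcoef := (fcoef l1 l2).
Local Notation area := (l1 * l2).
Local Notation wgt := (wgt R).

Let mc := measurable_cell l1 l2.
Let fc := leb2_cell_lty l1_gt0 l2_gt0.
Let area_gt0 : 0 < area. Proof. exact: mulr_gt0. Qed.

Lemma bmeas_cintegrable f : bmeas l1 l2 f -> cintegrable leb2 cell f.
Proof. by move=> [mf [M fM]]; exact: (cintegrable_bounded mc fc mf fM). Qed.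

Lemma rintegrable_sqn f : bmeas l1 l2 f -> rintegrable leb2 cell (fun x => sqn (f x)).
Proof.
move=> [mf [M fM]]; apply: (rintegrable_bounded mc fc (M := M ^+ 2)).
  exact: measurable_sqn.
move=> x cx; rewrite ger0_norm ?sqn_ge0// -sqr_modc.
by rewrite lerXn2r ?nnegrE ?modc_ge0 ?fM// (le_trans (modc_ge0 _) (fM x cx)).
Qed.

Variable psi : R * R -> R[i].
Hypothesis ipsi : cintegrable leb2 cell psi.
Variable K : R.
Hypothesis psiK : forall N, \sum_(n <- zbox N) wgt n * sqn (fcoef psi n) <= K.

Lemma regularity_bound_ge0 : 0 <= K.
Proof.
apply: le_trans (psiK 0); apply: sumr_ge0 => n _.
by rewrite mulr_ge0 ?sqn_ge0// ltW ?wgt_gt0.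
Qed.

(** The duality of H^(1/2) and H^(-1/2), for polynomials. *)
Lemma tpoly_pairing_sqr_le N c B :
  \sum_(n <- zbox N) sqn (c n) / wgt n <= B ->
  complex.Re (cint leb2 cell (fun x => (tpoly (zbox N) c x)^*%C * psi x)) ^+ 2
    <= K * B.
Proof.
move=> cB; rewrite cint_tpolyJ//.
set S := \sum_(n <- _) _.
have SE : modc S <= \sum_(n <- zbox N) modc (fcoef psi n) * modc (c n).
  apply: le_trans (modc_sum_le _ _ _) _; apply: ler_sum => n _.
  by rewrite modcM modcJ mulrC.
apply: (@le_trans _ _ ((\sum_(n <- zbox N) modc (fcoef psi n) * modc (c n)) ^+ 2)).
  rewrite -real_normK ?num_real// lerXn2r ?nnegrE//.
    by apply: le_trans SE; exact: modc_ge0.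
  exact: le_trans (normr_Re_le _) SE.
apply: le_trans (cauchy_schwarz_weighted _ _ _ _ (wgt_gt0 R)) _.
apply: ler_pM.
- by apply: sumr_ge0 => n _; rewrite mulr_ge0 ?sqr_ge0// ltW ?wgt_gt0.
- by apply: sumr_ge0 => n _; rewrite mulr_ge0 ?sqr_ge0// invr_ge0 ltW ?wgt_gt0.
- by under eq_bigr do rewrite sqr_modc.
- by under eq_bigr do rewrite sqr_modc.
Qed.

(** The bound of [tpoly_pairing_sqr_le] passes from polynomials to [h]. With
    the weight [rho = 1 + |psi|] a polynomial close to [h] in L^2(rho) is close
    to it in plain L^2, so that [bessel] controls its Fourier coefficients, and
    has nearly the same pairing with [psi], although [psi] is only integrable:
    [|q| |psi| <= (e / 2 + |q|^2 / (2 e)) rho] for the difference [q]. *)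
Lemma approximable_pairing_le (h : R * R -> R) B :
  (forall rho, (forall x, 0 <= rho x) -> rintegrable leb2 cell rho ->
    approximable l1 l2 rho h) ->
  (forall N, \sum_(n <- zbox N) sqn (fcoef (fun x => (h x)%:C%C) n) / wgt n <= B) ->
  \int[leb2]_(x in cell) (complex.Re (psi x) * h x) <=
  Num.sqrt (2 * K * B / area ^+ 2).
Proof.
move=> ah hB.
pose rho x := 1 + modc (psi x).
have rho0 x : 0 <= rho x by rewrite addr_ge0 ?modc_ge0.
have irho : rintegrable leb2 cell rho.
  apply: rintegrableD => //; last exact: cintegrable_modc.
  by apply: (rintegrable_bounded mc fc (M := 1)) => // x _; rewrite normr1.
have [bh ah'] := ah rho rho0 irho.
have K0 := regularity_bound_ge0.
have B0 : 0 <= B.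
  apply: le_trans (hB 0); apply: sumr_ge0 => n _.
  by rewrite mulr_ge0 ?sqn_ge0// invr_ge0 ltW ?wgt_gt0.
set T := \int[_]_(_ in _) _; set rh := \int[leb2]_(x in cell) rho x.
(* [L] is the coefficient of the error [e] in the estimates [err] and [main] below. *)
pose L := Num.sqrt (2 * K / area) + (rh + 1) / 2.
suff key e : 0 < e -> T <= Num.sqrt (2 * K * B / area ^+ 2) + e * L.
  have rh0 : 0 <= rh by apply: Rintegral_ge0 => x _.
  have L0 : 0 < L.
    by rewrite ltr_wpDl ?sqrtr_ge0// divr_gt0// ltr_wpDl.
  apply/ler_addgt0Pr => e e0; have := key _ (divr_gt0 e0 L0).
  by rewrite divfK// gt_eqF.
move=> e0; have [P tP dP] := ah' (e ^+ 2) (exprn_gt0 2 e0).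
have bP := bmeas_trig l1_gt0 l2_gt0 tP.
have bd := bmeasB bh bP.
pose q x := (h x)%:C%C - P x.
have ihpsi : cintegrable leb2 cell (fun x => (h x)%:C%C * psi x).
  by case: bh => mh [M hM]; exact: (cintegrableM_bounded mc mh hM ipsi).
have iPpsi : cintegrable leb2 cell (fun x => (P x)^*%C * psi x).
  case: bP => mP [M PM]; apply: (cintegrableM_bounded mc (cmeasurableJ mP) _ ipsi).
  by move=> x cx; rewrite modcJ; exact: PM.
have iqpsi : cintegrable leb2 cell (fun x => (q x)^*%C * psi x).
  case: bd => mq [M qM]; apply: (cintegrableM_bounded mc (cmeasurableJ mq) _ ipsi).
  by move=> x cx; rewrite modcJ; exact: qM.
have TE : T = complex.Re (cint leb2 cell (fun x => (P x)^*%C * psi x)) +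
    \int[leb2]_(x in cell) complex.Re ((q x)^*%C * psi x).
  rewrite Re_cint -RintegralD//; [|by case: iPpsi|by case: iqpsi].
  by apply: eq_Rintegral => x _; rewrite /q !ReImE /=; ring.
have err : \int[leb2]_(x in cell) complex.Re ((q x)^*%C * psi x) <=
    e * ((rh + 1) / 2).
  have iq : rintegrable leb2 cell (fun x => sqn (q x) * rho x).
    exact: rintegrable_dist2.
  apply: (@le_trans _ _ (\int[leb2]_(x in cell)
      (e / 2 * rho x + (2 * e)^-1 * (sqn (q x) * rho x)))).
    apply: le_Rintegral => //; first by case: iqpsi.
      by apply: rintegrableD => //; exact: rintegrableZ.
    move=> x _; apply: le_trans (Re_le_modc _) _; rewrite modcM modcJ.
    apply: (@le_trans _ _ (modc (q x) * rho x)).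
      by rewrite ler_wpM2l ?modc_ge0// lerDr.
    rewrite [(2 * e)^-1 * _]mulrA -mulrDl ler_wpM2r//.
    rewrite -sqr_modc -subr_ge0.
    rewrite [X in 0 <= X](_ : _ = (2 * e)^-1 * (e - modc (q x)) ^+ 2).
      by rewrite mulr_ge0 ?sqr_ge0// invr_ge0 mulr_ge0// ltW.
    by field; rewrite gt_eqF.
  rewrite RintegralD//; [|exact: rintegrableZ|exact: rintegrableZ].
  rewrite !RintegralZl// -/rh.
  rewrite -/(dist2 l1 l2 rho q).
  have : (2 * e)^-1 * dist2 l1 l2 rho q <= e / 2.
    rewrite mulrC ler_pdivrMr ?mulr_gt0//.
    by have -> : e / 2 * (2 * e) = e ^+ 2 by field.
  set D := _ * dist2 _ _ _ _ => De.
  have -> : e * ((rh + 1) / 2) = e / 2 * rh + e / 2 by ring.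
  by rewrite lerD2l.
have main : complex.Re (cint leb2 cell (fun x => (P x)^*%C * psi x)) <=
    Num.sqrt (2 * K * B / area ^+ 2) + e * Num.sqrt (2 * K / area).
  have [N [c PE]] := trig_tpoly tP.
  have cE n : n \in zbox N -> sqn (c n) = sqn (fcoef P n) / area ^+ 2.
    move=> nN; rewrite PE fcoef_tpoly ?uniq_zbox// sqnM sqn_real.
    by field; rewrite !gt_eqF.
  have cB : \sum_(n <- zbox N) sqn (c n) / wgt n <= (2 * B + 2 * area * e ^+ 2) / area ^+ 2.
    apply: (@le_trans _ _ (\sum_(n <- zbox N)
       (2 * (sqn (fcoef (fun x => (h x)%:C%C) n) / wgt n) + 2 * sqn (fcoef q n)) / area ^+ 2)).
      rewrite big_seq [leRHS]big_seq; apply: ler_sum => n nN.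
      rewrite (cE _ nN) mulrAC ler_wpM2r ?invr_ge0 ?sqr_ge0//.
      have -> : fcoef P n = fcoef (fun x => (h x)%:C%C) n + - fcoef q n.
        rewrite fcoefB; [by rewrite opprB addrC subrK| exact: bmeas_cintegrable..].
      apply: (@le_trans _ _ ((2 * sqn (fcoef (fun x => (h x)%:C%C) n) + 2 * sqn (fcoef q n)) / wgt n)).
        rewrite ler_wpM2r ?invr_ge0 ?(ltW (wgt_gt0 _ _))//.
        by rewrite -[sqn (fcoef q n)]sqnN sqnD_le.
      rewrite mulrDl -mulrA lerD2l ler_pdivrMr ?wgt_gt0//.
      by rewrite ler_peMr ?mulr_ge0 ?sqn_ge0// ler1n.
    rewrite -mulr_suml ler_wpM2r ?invr_ge0 ?sqr_ge0//.
    rewrite big_split /= -!mulr_sumr -mulrA lerD// ler_pM2l//.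
    apply: le_trans (bessel l1_gt0 l2_gt0 (uniq_zbox N) (bmeas_cintegrable bd) (rintegrable_sqn bd)) _.
    rewrite ler_pM2l//; apply: le_trans dP; apply: le_Rintegral => //.
    - exact: rintegrable_sqn.
    - exact: rintegrable_dist2.
    - by move=> x _; rewrite ler_peMr ?sqn_ge0// lerDl modc_ge0.
  have := tpoly_pairing_sqr_le cB; rewrite -PE => sq.
  apply: le_trans (ler_norm _) _.
  rewrite -ler_sqr ?nnegrE ?addr_ge0 ?mulr_ge0 ?sqrtr_ge0 ?(ltW e0)//.
  rewrite real_normK ?num_real//; apply: le_trans sq _.
  have H1 : 0 <= 2 * K * B / area ^+ 2.
    by rewrite !mulr_ge0 ?invr_ge0 ?sqr_ge0.
  have H2 : 0 <= 2 * K / area by rewrite !mulr_ge0 ?invr_ge0// ltW.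
  rewrite sqrrD [(e * _) ^+ 2]exprMn !sqr_sqrtr//.
  have -> : K * ((2 * B + 2 * area * e ^+ 2) / area ^+ 2) =
     2 * K * B / area ^+ 2 + e ^+ 2 * (2 * K / area) by field; rewrite !gt_eqF.
  by rewrite lerD2r lerDl mulrn_wge0// mulr_ge0 ?sqrtr_ge0// mulr_ge0 ?sqrtr_ge0// ltW.
rewrite TE /L mulrDr addrA; exact: lerD.
Qed.

Lemma nnsfun_bounded (s : {nnsfun plane R >-> R}) :
  exists M : R, forall x, `|s x| <= M.
Proof.
have /compact_bounded[M [_ sM]] : compact (range s).
  exact/finite_compact/fimfunP.
by exists (M + 1) => x; apply: (sM (M + 1)); [rewrite ltrDl|exists x].
Qed.

(** Test [psi] against [h = s^3]. As [s <= Re psi] where [s > 0], the pairing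
    is at least [S], the integral of [s^4]. The H^(-1/2) norm of [h] is bounded
    through its L^(4/3) norm, and [|h|^(4/3) = s^4], so the resulting inequality
    is [S^4 <= C K^2 S^3]: the power of [S] on the right is the smaller one and
    [S], finite because [s] is simple, can be divided out. *)
Lemma nnsfun_below_L4_le (s : {nnsfun plane R >-> R}) :
  (forall x, cell x -> s x <= Num.max (complex.Re (psi x)) 0) ->
  \int[leb2]_(x in cell) (s x ^+ 4) <= 336 / area ^+ 3 * K ^+ 2.
Proof.
move=> spsi; pose h := mul_nnsfun s (mul_nnsfun s s).
have hE x : h x = s x ^+ 3 by rewrite /= !exprS expr0 mulr1.
have s0 x : 0 <= s x by exact: fun_ge0.
have K0 := regularity_bound_ge0.
have [M sM] := nnsfun_bounded s.
have mS : measurable_fun cell (s : plane R -> R) by exact: measurable_funTS.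
have iS k : rintegrable leb2 cell (fun x => s x ^+ k).
  apply: (rintegrable_bounded mc fc (M := M ^+ k)); first exact: measurable_funX.
  by move=> x _; rewrite normrX lerXn2r ?nnegrE// (le_trans (normr_ge0 _) (sM x)).
set S := \int[_]_(_ in _) _.
have S0 : 0 <= S by apply: Rintegral_ge0 => x _; rewrite exprn_ge0.
have hi : cintegrable leb2 cell (fun x => (h x)%:C%C).
  split; last exact: integrable0.
  by apply: (eq_rintegrable mc _ (iS 3%N)) => x _; rewrite hE.
have p43 x : pow43 (h x)%:C%C = s x ^+ 4.
  rewrite /pow43 hE /modc sqn_real sqrtr_sqr ger0_norm ?exprn_ge0//.
  rewrite -powR_mulrn// -powRrM.
  have -> : 3%:R * (4 / 3) = 4%:R :> R by field.
  by rewrite powR_mulrn.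
pose B := Num.sqrt (84 * area * S ^+ 3).
have hB N : \sum_(n <- zbox N) sqn (fcoef (fun x => (h x)%:C%C) n) / wgt n <= B.
  have := fcoef_dual_le l1_gt0 l2_gt0 N hi.
  under eq_Rintegral do rewrite p43.
  rewrite -/S => H; rewrite -[leLHS]ger0_norm; last first.
    by apply: sumr_ge0 => n _; rewrite mulr_ge0 ?sqn_ge0// invr_ge0 ltW ?wgt_gt0.
  rewrite -sqrtr_sqr ler_wsqrtr//; apply: H.
  by apply: (eq_rintegrable mc _ (iS 4%N)) => x _; rewrite p43.
have Spsi : S <= \int[leb2]_(x in cell) (complex.Re (psi x) * h x).
  apply: le_Rintegral => //; first exact: iS.
    have mh : cmeasurable cell (fun x => (h x)%:C%C) by exact: (cintegrable_measurable hi).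
    have : cintegrable leb2 cell (fun x => (h x)%:C%C * psi x).
      apply: (cintegrableM_bounded mc mh (M := M ^+ 3)) => // x _.
      rewrite /modc sqn_real sqrtr_sqr hE normrX lerXn2r ?nnegrE//.
      by rewrite (le_trans (normr_ge0 _) (sM x)).
    case=> + _; apply: (eq_rintegrable mc) => x _; rewrite !ReImE /=; ring.
  move=> x cx; rewrite hE exprS; have := spsi x cx; rewrite le_max.
  move=> /orP[sx|sx]; first by rewrite ler_wpM2r ?exprn_ge0.
  have -> : s x = 0 by apply/eqP; rewrite eq_le sx s0.
  by rewrite expr0n !mulr0.
have SB : S <= Num.sqrt (2 * K * B / area ^+ 2).
  apply: le_trans Spsi _; apply: approximable_pairing_le => // rho rho0 irho.
  exact: (approximable_nnsfun l1_gt0 l2_gt0 rho0 irho h).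
have B0 : 0 <= B := sqrtr_ge0 _.
have H1 : 0 <= 2 * K * B / area ^+ 2 by rewrite !mulr_ge0 ?invr_ge0 ?sqr_ge0.
have S2 : S ^+ 2 <= 2 * K * B / area ^+ 2.
  by rewrite -[leRHS]sqr_sqrtr// lerXn2r ?nnegrE ?sqrtr_ge0.
have S4 : S ^+ 4 <= 4 * K ^+ 2 / area ^+ 4 * (84 * area * S ^+ 3).
  have -> : 84 * area * S ^+ 3 = B ^+ 2.
    by rewrite sqr_sqrtr// !mulr_ge0 ?exprn_ge0// ltW.
  have -> : 4 * K ^+ 2 / area ^+ 4 * B ^+ 2 = (2 * K * B / area ^+ 2) ^+ 2.
    by field; rewrite !gt_eqF.
  by rewrite (exprM S 2 2) lerXn2r ?nnegrE ?sqr_ge0.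
have [->|Sn0] := eqVneq S 0.
  apply: mulr_ge0; last exact: sqr_ge0.
  by apply: divr_ge0; [exact: ler0n|rewrite exprn_ge0// ltW].
have Sgt0 : 0 < S by rewrite lt_def Sn0.
rewrite -(ler_pM2r (exprn_gt0 3 Sgt0)) -exprS; apply: le_trans S4 _.
rewrite le_eqVlt; apply/orP; left; apply/eqP; field.
by rewrite !gt_eqF.
Qed.

(** Simple functions increase to the positive part: monotone convergence. *)
Lemma positive_part_L4_le :
  (\int[leb2]_(x in cell) ((Num.max (complex.Re (psi x)) 0) ^+ 4)%:E <=
   (336 / area ^+ 3 * K ^+ 2)%:E)%E.
Proof.
have mpsi : measurable_fun cell (fun x => complex.Re (psi x)).
  by case: (cintegrable_measurable ipsi).
pose f x := (Num.max (complex.Re (psi x)) 0)%:E.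
have mf : measurable_fun cell f.
  by apply/measurable_EFinP/measurable_maxr.
have f0 x : cell x -> (0 <= f x)%E by rewrite lee_fin le_max lexx orbT.
pose s := nnsfun_approx mc mf.
pose g n x := (s n x ^+ 4)%:E.
have s0 n x : 0 <= s n x by exact: fun_ge0.
have mg n : measurable_fun cell (g n).
  by apply/measurable_EFinP/measurable_funX/measurable_funTS.
have g0 n x : cell x -> (0 <= g n x)%E by rewrite lee_fin exprn_ge0.
have ndg x : cell x -> {homo (fun n => g n x) : n m / (n <= m)%N >-> (n <= m)%E}.
  move=> _ n m nm; rewrite lee_fin lerXn2r ?nnegrE//.
  by have /lefP/(_ x) := nd_nnsfun_approx mc mf nm.
have gf x : cell x -> g n x @[n --> \oo] --> ((Num.max (complex.Re (psi x)) 0) ^+ 4)%:E.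
  move=> cx; have /fine_cvgP[_ sf] := cvg_nnsfun_approx mc mf f0 cx.
  apply: cvg_EFin; first exact: nearW.
  rewrite /comp /g /= in sf *.
  by do 3 (rewrite exprS; under eq_fun do rewrite exprS; apply: cvgM => //);
     rewrite expr1; under eq_fun do rewrite expr1.
rewrite (eq_integral (fun x => limn (g ^~ x))); last first.
  by move=> x /set_mem cx; apply/esym/cvg_lim => //; exact: gf.
have cg := cvg_monotone_convergence mc mg g0 ndg.
apply: (cvge_to_le (cg leb2)).
apply: nearW => n.
have le_n : \int[leb2]_(x in cell) (s n x ^+ 4) <= 336 / area ^+ 3 * K ^+ 2.
  apply: nnsfun_below_L4_le => x cx.
  by have := le_approx n f0 cx; rewrite -lee_fin -(nnsfun_approxE mc mf).
have [M sM] := nnsfun_bounded (s n).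
have iS : rintegrable leb2 cell (fun x => s n x ^+ 4).
  apply: (rintegrable_bounded mc fc (M := M ^+ 4)).
    by apply/measurable_funX/measurable_funTS.
  by move=> x _; rewrite normrX lerXn2r ?nnegrE// (le_trans (normr_ge0 _) (sM x)).
by rewrite -(fineK (integrable_fin_num mc iS)) lee_fin.
Qed.

End Regularity.

(** * From weighted square-summability to L^4: complex functions and spinors *)

Section ScalarRegularity.
Variables (R : realType) (l1 l2 : R).
Hypotheses (l1_gt0 : 0 < l1) (l2_gt0 : 0 < l2).
Local Notation cell := (@cell R l1 l2).
Local Notation leb2 := (leb2 R).
Local Notation fcoef := (fcoef l1 l2).
Local Notation area := (l1 * l2).
Local Notation wgt := (wgt R).
Let mc := measurable_cell l1 l2.

Variable psi : R * R -> R[i].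
Hypothesis ipsi : cintegrable leb2 cell psi.
Variable K : R.
Hypothesis psiK : forall N, \sum_(n <- zbox N) wgt n * sqn (fcoef psi n) <= K.

Lemma rotated_positive_part_L4_le (c : R[i]) : sqn c = 1 ->
  (\int[leb2]_(x in cell) ((Num.max (complex.Re (c * psi x)) 0) ^+ 4)%:E <=
   (336 / area ^+ 3 * K ^+ 2)%:E)%E.
Proof.
move=> c1; apply: (positive_part_L4_le l1_gt0 l2_gt0 (psi := fun x => c * psi x)).
  exact: (cintegrableZ mc).
move=> N; apply: le_trans (psiK N); apply: ler_sum => n _.
by rewrite fcoefZ// sqnM c1 mul1r.
Qed.

(** The hypothesis on Fourier coefficients is unchanged when [psi] is
    multiplied by 1, -1, i or -i, and the positive parts of the real parts of
    these four functions recover [|psi|]. *)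
Lemma sobolev_L4_le :
  (\int[leb2]_(x in cell) (sqn (psi x) ^+ 2)%:E <=
   (2688 / area ^+ 3 * K ^+ 2)%:E)%E.
Proof.
pose pp (c : R[i]) (x : R * R) : \bar R := ((Num.max (complex.Re (c * psi x)) 0) ^+ 4)%:E.
have mpp c : measurable_fun cell (pp c).
  apply/measurable_EFinP/measurable_funX/measurable_maxr => //.
  by case: (cintegrable_measurable (cintegrableZ mc c ipsi)).
have pp0 c x : (0 <= pp c x)%E.
  by rewrite lee_fin exprn_ge0// le_max lexx orbT.
have bnd c : sqn c = 1 ->
    (\int[leb2]_(x in cell) pp c x <= (336 / area ^+ 3 * K ^+ 2)%:E)%E.
  exact: rotated_positive_part_L4_le.
have two0 : (0 <= 2%:E :> \bar R)%E by rewrite lee_fin.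
apply: (@le_trans _ _ (\int[leb2]_(x in cell)
   (2%:E * (pp 1%R x + pp (- 1)%R x + (pp 'i%C x + pp (- 'i%C)%R x))))%E).
  apply: ge0_le_integral => //.
  - by move=> x _; rewrite lee_fin sqr_ge0.
  - apply/measurable_EFinP/measurable_funX/measurable_sqn.
    exact: (cintegrable_measurable ipsi).
  - by apply: measurable_funeM; do !apply: emeasurable_funD.
  - move=> x _; rewrite -!EFinD -EFinM lee_fin !ReImE /=.
    case: (psi x) => p q; rewrite /sqn /=.
    have E t : (Num.max t 0) ^+ 4 + (Num.max (- t) 0) ^+ 4 = t ^+ 4 :> R.
      have [t0|t0] := leP 0 t.
        by rewrite (max_idPr _) ?oppr_le0// expr0n addr0.
      by rewrite (max_idPl _) ?oppr_ge0 ?ltW// expr0n add0r; ring.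
    have -> : 1 * p - 0 * q = p by ring.
    have -> : - 1 * p - - 0 * q = - p by ring.
    have -> : 0 * p - 1 * q = - q by ring.
    have -> : - 0 * p - - 1 * q = - - q by ring.
    rewrite !E -subr_ge0.
    rewrite [X in 0 <= X](_ : _ = (p ^+ 2 - q ^+ 2) ^+ 2); last by ring.
    exact: sqr_ge0.
rewrite ge0_integralZl//; last 2 first.
- by do !apply: emeasurable_funD.
- by move=> x _; rewrite !adde_ge0.
rewrite !ge0_integralD//; last 4 first.
- by move=> x _; rewrite adde_ge0.
- exact: emeasurable_funD.
- by move=> x _; rewrite adde_ge0.
- exact: emeasurable_funD.
have -> : (2688 / area ^+ 3 * K ^+ 2)%:E =
    (2%:E * ((336 / area ^+ 3 * K ^+ 2)%:E + (336 / area ^+ 3 * K ^+ 2)%:E +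
    ((336 / area ^+ 3 * K ^+ 2)%:E + (336 / area ^+ 3 * K ^+ 2)%:E)))%E.
  by rewrite -!EFinD -EFinM; congr EFin; ring.
by apply: lee_wpmul2l => //; rewrite !leeD// bnd// ?sqnN /sqn /= ?expr0n ?expr1n ?addr0 ?add0r.
Qed.

End ScalarRegularity.

Section SpinorNorms.
Variables (R : realType) (l1 l2 : R).
Hypotheses (l1_gt0 : 0 < l1) (l2_gt0 : 0 < l2).
Local Notation cell := (@cell R l1 l2).
Local Notation leb2 := (leb2 R).
Let mc := measurable_cell l1 l2.
Let fc := leb2_cell_lty l1_gt0 l2_gt0.
Implicit Types u : R * R -> spinor R.

Definition snorm2 (v : spinor R) : R := \sum_j sqn (v j 0).

Lemma snorm2_ge0 v : 0 <= snorm2 v.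
Proof. by apply: sumr_ge0 => j _; exact: sqn_ge0. Qed.

Lemma sqn_le_snorm2 (v : spinor R) j : sqn (v j 0) <= snorm2 v.
Proof.
rewrite /snorm2 (bigD1 j)//= lerDl; apply: sumr_ge0 => k _; exact: sqn_ge0.
Qed.

Lemma spinor_normE (v : spinor R) : spinor_norm v = Num.sqrt (snorm2 v).
Proof.
congr Num.sqrt; apply: eq_bigr => j _; case: (v j 0) => a b /=.
by rewrite sqr_sqrtr ?addr_ge0 ?sqr_ge0.
Qed.

Lemma modc_le_spinor_norm (v : spinor R) j : modc (v j 0) <= spinor_norm v.
Proof. by rewrite spinor_normE ler_wsqrtr// sqn_le_snorm2. Qed.

Lemma spinor_norm_ge0 (v : spinor R) : 0 <= spinor_norm v.
Proof. exact: sqrtr_ge0. Qed.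

Lemma snorm2_eq0 (v : spinor R) : snorm2 v = 0 -> v = 0.
Proof.
move=> v0; apply/matrixP => j k; rewrite (ord1 k) mxE; apply: sqn_eq0.
by apply/eqP; rewrite eq_le sqn_ge0 andbT -v0 sqn_le_snorm2.
Qed.

Definition spinor_integrable u := forall j, cintegrable leb2 cell (fun x => u x j 0).
Definition spinor_measurable u := forall j, cmeasurable cell (fun x => u x j 0).

Lemma spinor_integrable_measurable u : spinor_integrable u -> spinor_measurable u.
Proof. by move=> iu j; exact: cintegrable_measurable (iu j). Qed.

Lemma measurable_snorm2 u : spinor_measurable u ->
  measurable_fun cell (fun x => snorm2 (u x)).
Proof. by move=> mu; apply: measurable_sum => j; exact/measurable_sqn/mu. Qed.

Lemma measurable_spinor_norm u : spinor_measurable u ->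
  measurable_fun cell (fun x => spinor_norm (u x)).
Proof.
move=> /measurable_snorm2 mu; under eq_fun do rewrite spinor_normE.
have ms : measurable_fun [set: R] (@Num.sqrt R).
  by apply: continuous_measurable_fun; exact: sqrt_continuous.
exact: measurableT_comp ms mu.
Qed.

Lemma measurable_powR_comp (f : R * R -> R) p : measurable_fun cell f ->
  measurable_fun cell (fun x => f x `^ p).
Proof. exact: (measurableT_comp (measurable_powR p)). Qed.

Lemma Lp_normE p u : 0 < p -> Lp_norm l1 l2 p u =
  ((\int[leb2]_(x in cell) ((spinor_norm (u x)) `^ p)%:E) `^ p^-1)%E.
Proof.
move=> p0; rewrite /Lp_norm unlock; congr poweR.
rewrite [RHS]integral_mkcond; apply: eq_integral => x _.
rewrite !patchE; case: ifP => _.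
  by rewrite gee0_abs ?lee_fin ?spinor_norm_ge0// poweR_EFin.
by rewrite abse0 poweR0r// gt_eqF.
Qed.

Lemma integral_powR_ge0 p u :
  (0 <= \int[leb2]_(x in cell) ((spinor_norm (u x)) `^ p)%:E)%E.
Proof. by apply: integral_ge0 => x _; rewrite lee_fin powR_ge0. Qed.

Lemma Lp_norm_lty p u : 0 < p -> (Lp_norm l1 l2 p u < +oo)%E ->
  (\int[leb2]_(x in cell) ((spinor_norm (u x)) `^ p)%:E < +oo)%E.
Proof.
move=> p0; rewrite Lp_normE//.
case: (\int[leb2]_(x in cell) _)%E (integral_powR_ge0 p u) => [r|//|//] _.
  by move=> _; rewrite ltry.
by rewrite poweRyr// gt_eqF// invr_gt0.
Qed.

Lemma spinor_Lp_integrable p u : 1 <= p -> spinor_measurable u ->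
  (\int[leb2]_(x in cell) ((spinor_norm (u x)) `^ p)%:E < +oo)%E ->
  spinor_integrable u.
Proof.
move=> p1 mu up j.
have mn := measurable_spinor_norm mu.
have ip : rintegrable leb2 cell (fun x => spinor_norm (u x) `^ p).
  have mp := measurable_powR_comp p mn.
  apply/integrableP; split.
    apply/measurable_EFinP.
    exact: mp.
  by under eq_integral do rewrite gee0_abs ?lee_fin ?powR_ge0//.
have i1 : rintegrable leb2 cell (fun=> 1 : R).
  by apply: (rintegrable_bounded mc fc (M := 1)) => // x _; rewrite normr1.
apply: (cintegrable_le mc (mu j) _ (rintegrableD mc i1 ip)) => x _.
apply: le_trans (modc_le_spinor_norm _ _) _.
have [s1|s1] := leP (spinor_norm (u x)) 1; first by rewrite ler_wpDr// powR_ge0.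
rewrite ler_wpDl// -[leLHS]powRr1 ?spinor_norm_ge0//.
by rewrite ler_powR// ltW.
Qed.

Lemma in_Lp_integrable p u : 1 <= p -> in_Lp l1 l2 p u -> spinor_integrable u.
Proof.
move=> p1 [_ mr mi up]; apply: (spinor_Lp_integrable p1).
  by move=> j; split; [exact: mr|exact: mi].
by apply: Lp_norm_lty => //; exact: lt_le_trans p1.
Qed.

Lemma bounded_Lp_norm_lty p u (M : R) : 0 < p -> spinor_measurable u ->
  (forall x, cell x -> spinor_norm (u x) <= M) -> (Lp_norm l1 l2 p u < +oo)%E.
Proof.
move=> p0 mu uM; rewrite Lp_normE//.
have ip : rintegrable leb2 cell (fun x => spinor_norm (u x) `^ p).
  apply: (rintegrable_bounded mc fc (M := M `^ p)).
    by apply: measurable_powR_comp; exact: measurable_spinor_norm.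
  move=> x cx; rewrite ger0_norm ?powR_ge0// ge0_ler_powR ?nnegrE ?(ltW p0)//.
  - exact: spinor_norm_ge0.
  - exact: le_trans (spinor_norm_ge0 _) (uM x cx).
  - exact: uM.
rewrite -(fineK (integrable_fin_num mc ip)) poweR_EFin; exact: ltry.
Qed.

(** The cell has finite measure. *)
Lemma in_Lp1 p u : 1 <= p -> in_Lp l1 l2 p u -> in_Lp l1 l2 1 u.
Proof.
move=> p1 up; have iu := in_Lp_integrable p1 up.
case: up => tu mr mi _; split=> //.
have mn := measurable_spinor_norm (spinor_integrable_measurable iu).
rewrite Lp_normE//.
have is_ : rintegrable leb2 cell (fun x => spinor_norm (u x)).
  apply: (rintegrable_le mc (g := fun x => \sum_j modc (u x j 0))) => //.
    move=> x _; rewrite ger0_norm ?spinor_norm_ge0// spinor_normE.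
    rewrite -ler_sqr ?nnegrE ?sqrtr_ge0 ?sumr_ge0// => [|j _]; last exact: modc_ge0.
    rewrite sqr_sqrtr ?snorm2_ge0// expr2 mulr_suml; apply: ler_sum => j _.
    rewrite -sqr_modc expr2 ler_wpM2l ?modc_ge0// (bigD1 j)//= lerDl.
    by apply: sumr_ge0 => k _; exact: modc_ge0.
  by apply: rintegrable_sum => // j; exact: cintegrable_modc (iu j).
under eq_integral do rewrite powRr1 ?spinor_norm_ge0//.
rewrite -(fineK (integrable_fin_num mc is_)) poweR_EFin; exact: ltry.
Qed.

End SpinorNorms.

(** * The symbol of the Dirac operator *)

Section DiracSymbol.
Variable R : realType.
Implicit Types (v w : spinor R) (m zeta k a b mu : R).

Definition dirac_symbol m zeta k1 k2 : 'M[R[i]]_4 :=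
  k1%:C%C *: (gamma0 R *m gamma1 R) + k2%:C%C *: (gamma0 R *m gamma2 R)
  + zeta%:C%C *: (gamma0 R *m gamma3 R) + m%:C%C *: gamma0 R.

Definition s0 : 'I_4 := @lshift 2 2 (@lshift 1 1 ord0).
Definition s1 : 'I_4 := @lshift 2 2 (@rshift 1 1 ord0).
Definition s2 : 'I_4 := @rshift 2 2 (@lshift 1 1 ord0).
Definition s3 : 'I_4 := @rshift 2 2 (@rshift 1 1 ord0).

Lemma spin_cases (P : 'I_4 -> Prop) : P s0 -> P s1 -> P s2 -> P s3 -> forall j, P j.
Proof.
move=> p0 p1 p2 p3 j; have : (j < 4)%N := ltn_ord j.
case: j => -[|[|[|[|//]]]] /= lt4 _.
- by rewrite (_ : Ordinal _ = s0)//; exact: val_inj.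
- by rewrite (_ : Ordinal _ = s1)//; exact: val_inj.
- by rewrite (_ : Ordinal _ = s2)//; exact: val_inj.
- by rewrite (_ : Ordinal _ = s3)//; exact: val_inj.
Qed.

Lemma sum_spin (V : nmodType) (F : 'I_4 -> V) :
  \sum_j F j = F s0 + F s1 + (F s2 + F s3).
Proof.
rewrite (@big_split_ord _ _ _ 2 2) /=; congr (_ + _).
- by rewrite (@big_split_ord _ _ _ 1 1) !big_ord1.
- by rewrite (@big_split_ord _ _ _ 1 1) !big_ord1.
Qed.

Lemma spinorP v w : v s0 0 = w s0 0 -> v s1 0 = w s1 0 ->
  v s2 0 = w s2 0 -> v s3 0 = w s3 0 -> v = w.
Proof.
move=> h0 h1 h2 h3; apply/matrixP => j k; rewrite (ord1 k).
by elim/spin_cases: j.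
Qed.

Lemma mx2_col (a b c d : R[i]) (w : 'cV[R[i]]_2) :
  (mx2 a b c d *m w) (@lshift 1 1 ord0) 0 =
    a * w (@lshift 1 1 ord0) 0 + b * w (@rshift 1 1 ord0) 0 /\
  (mx2 a b c d *m w) (@rshift 1 1 ord0) 0 =
    c * w (@lshift 1 1 ord0) 0 + d * w (@rshift 1 1 ord0) 0.
Proof.
rewrite -[w in LHS](@vsubmxK _ 1 1) -[w in X in _ /\ X = _](@vsubmxK _ 1 1).
rewrite (@mul_block_col _ 1 1 1 1) !mul_scalar_mx.
by split; [rewrite (@col_mxEu _ 1 1)|rewrite (@col_mxEd _ 1 1)]; rewrite !mxE.
Qed.

Lemma gamma0_of (s : 'M[R[i]]_2) : gamma0 R *m gamma_of s = block_mx 0 s s 0.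
Proof.
rewrite /gamma0 /gamma_of (@mulmx_block _ 2 2 2 2 2 2).
by rewrite !mul1mx !mul0mx !mulmx0 !addr0 !add0r mulmxN mulNmx mul1mx opprK.
Qed.

Lemma alpha_col (s : 'M[R[i]]_2) v (u := @usubmx _ 2 2 1 v) (d := @dsubmx _ 2 2 1 v) :
  gamma0 R *m gamma_of s *m v = col_mx (s *m d) (s *m u).
Proof.
rewrite gamma0_of -[v in LHS](@vsubmxK _ 2 2) (@mul_block_col _ 2 2 2 2).
by rewrite !mul0mx add0r addr0.
Qed.

Lemma alphaE (a b c d : R[i]) v (A := gamma0 R *m gamma_of (mx2 a b c d)) :
  [/\ (A *m v) s0 0 = a * v s2 0 + b * v s3 0,
      (A *m v) s1 0 = c * v s2 0 + d * v s3 0,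
      (A *m v) s2 0 = a * v s0 0 + b * v s1 0 &
      (A *m v) s3 0 = c * v s0 0 + d * v s1 0].
Proof.
rewrite /A alpha_col.
have [hd0 hd1] := mx2_col a b c d (@dsubmx _ 2 2 1 v).
have [hu0 hu1] := mx2_col a b c d (@usubmx _ 2 2 1 v).
split.
- by rewrite /s0 (@col_mxEu _ 2 2) hd0 !mxE.
- by rewrite /s1 (@col_mxEu _ 2 2) hd1 !mxE.
- by rewrite /s2 (@col_mxEd _ 2 2) hu0 !mxE.
- by rewrite /s3 (@col_mxEd _ 2 2) hu1 !mxE.
Qed.

Lemma betaE v : [/\ (gamma0 R *m v) s0 0 = v s0 0, (gamma0 R *m v) s1 0 = v s1 0,
  (gamma0 R *m v) s2 0 = - v s2 0 & (gamma0 R *m v) s3 0 = - v s3 0].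
Proof.
have E : gamma0 R *m v = col_mx (@usubmx _ 2 2 1 v) (- @dsubmx _ 2 2 1 v).
  rewrite /gamma0 -[v in LHS](@vsubmxK _ 2 2) (@mul_block_col _ 2 2 2 2).
  by rewrite !mul0mx !mul1mx addr0 add0r mulNmx mul1mx.
rewrite E; split.
- by rewrite /s0 (@col_mxEu _ 2 2) !mxE.
- by rewrite /s1 (@col_mxEu _ 2 2) !mxE.
- by rewrite /s2 (@col_mxEd _ 2 2) !mxE.
- by rewrite /s3 (@col_mxEd _ 2 2) !mxE.
Qed.

Lemma mulmx_lincomb4 (F : comNzRingType) n (c1 c2 c3 c4 : F) (M1 M2 M3 M4 : 'M[F]_n)
    (v : 'cV[F]_n) j :
  ((c1 *: M1 + c2 *: M2 + c3 *: M3 + c4 *: M4) *m v) j 0 =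
  c1 * (M1 *m v) j 0 + c2 * (M2 *m v) j 0 + c3 * (M3 *m v) j 0 + c4 * (M4 *m v) j 0.
Proof. by rewrite !mulmxDl -!scalemxAl !mxE. Qed.

Lemma dirac_symbolE m zeta k1 k2 v (A := dirac_symbol m zeta k1 k2)
    (kp := Complex k1 k2) (km := Complex k1 (- k2)) :
  [/\ (A *m v) s0 0 = m%:C%C * v s0 0 + zeta%:C%C * v s2 0 + km * v s3 0,
      (A *m v) s1 0 = m%:C%C * v s1 0 - zeta%:C%C * v s3 0 + kp * v s2 0,
      (A *m v) s2 0 = - m%:C%C * v s2 0 + zeta%:C%C * v s0 0 + km * v s1 0 &
      (A *m v) s3 0 = - m%:C%C * v s3 0 - zeta%:C%C * v s1 0 + kp * v s0 0].
Proof.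
have comb j x y z t : (gamma0 R *m gamma1 R *m v) j 0 = x ->
    (gamma0 R *m gamma2 R *m v) j 0 = y -> (gamma0 R *m gamma3 R *m v) j 0 = z ->
    (gamma0 R *m v) j 0 = t ->
    (A *m v) j 0 = k1%:C%C * x + k2%:C%C * y + zeta%:C%C * z + m%:C%C * t.
  by move=> <- <- <- <-; exact: mulmx_lincomb4.
have [a10 a11 a12 a13] := alphaE 0 1 1 0 v.
have [a20 a21 a22 a23] := alphaE 0 (- 'i%C) 'i%C 0 v.
have [a30 a31 a32 a33] := alphaE 1 0 0 (- 1) v.
have [b0 b1 b2 b3] := betaE v.
rewrite (comb s0 _ _ _ _ a10 a20 a30 b0) (comb s1 _ _ _ _ a11 a21 a31 b1).
rewrite (comb s2 _ _ _ _ a12 a22 a32 b2) (comb s3 _ _ _ _ a13 a23 a33 b3).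
have -> : kp = k1%:C%C + 'i%C * k2%:C%C.
  by rewrite /kp; apply: complex_ext; rewrite !ReImE /=; ring.
have -> : km = k1%:C%C - 'i%C * k2%:C%C.
  by rewrite /km; apply: complex_ext; rewrite !ReImE /=; ring.
move: (v s0 0) (v s1 0) (v s2 0) (v s3 0) => x0 x1 x2 x3.
by move: k1%:C%C k2%:C%C m%:C%C zeta%:C%C 'i%C => p q m' z' i; split; ring.
Qed.

(** The Clifford relations. *)
Lemma dirac_symbol_sqr m zeta k1 k2 v (A := dirac_symbol m zeta k1 k2) :
  A *m (A *m v) = (k1 ^+ 2 + k2 ^+ 2 + (zeta ^+ 2 + m ^+ 2))%:C%C *: v.
Proof.
have [a0 a1 a2 a3] := dirac_symbolE m zeta k1 k2 v.
have [c0 c1 c2 c3] := dirac_symbolE m zeta k1 k2 (A *m v).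
have -> : (k1 ^+ 2 + k2 ^+ 2 + (zeta ^+ 2 + m ^+ 2))%:C%C =
    Complex k1 k2 * Complex k1 (- k2) + (zeta%:C%C ^+ 2 + m%:C%C ^+ 2).
  by apply: complex_ext; rewrite !ReImE /=; ring.
apply: spinorP; rewrite [RHS]mxE ?c0 ?c1 ?c2 ?c3 /A ?a0 ?a1 ?a2 ?a3;
  move: (v s0 0) (v s1 0) (v s2 0) (v s3 0) => x0 x1 x2 x3;
  by move: (Complex k1 k2) (Complex k1 (- k2)) m%:C%C zeta%:C%C => kp km m' z'; ring.
Qed.

Definition rdot v w : R := \sum_j complex.Re ((v j 0)^*%C * w j 0).

Lemma snorm2_dirac_symbol m zeta k1 k2 v :
  snorm2 (dirac_symbol m zeta k1 k2 *m v) =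
  (k1 ^+ 2 + k2 ^+ 2 + (zeta ^+ 2 + m ^+ 2)) * snorm2 v.
Proof.
have [a0 a1 a2 a3] := dirac_symbolE m zeta k1 k2 v.
rewrite /snorm2 !sum_spin a0 a1 a2 a3.
move: (v s0 0) (v s1 0) (v s2 0) (v s3 0) => [x0 y0] [x1 y1] [x2 y2] [x3 y3].
by rewrite /sqn !ReImE /=; ring.
Qed.

Lemma dirac_symbol_hermitian m zeta k1 k2 v w (A := dirac_symbol m zeta k1 k2) :
  \sum_j ((A *m v) j 0)^*%C * w j 0 = \sum_j (v j 0)^*%C * (A *m w) j 0.
Proof.
have [a0 a1 a2 a3] := dirac_symbolE m zeta k1 k2 v.
have [c0 c1 c2 c3] := dirac_symbolE m zeta k1 k2 w.
rewrite !sum_spin a0 a1 a2 a3 c0 c1 c2 c3 !(conjcM, conjcD, conjcN, conjc_real).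
have -> : (Complex k1 (- k2))^*%C = Complex k1 k2 by rewrite /conjc opprK.
have -> : (Complex k1 k2)^*%C = Complex k1 (- k2) by [].
move: (v s0 0)^*%C (v s1 0)^*%C (v s2 0)^*%C (v s3 0)^*%C => p0 p1 p2 p3.
move: (w s0 0) (w s1 0) (w s2 0) (w s3 0) => q0 q1 q2 q3.
by move: (Complex k1 k2) (Complex k1 (- k2)) m%:C%C zeta%:C%C => kp km m' z'; ring.
Qed.

Lemma snorm2_lincomb a b v w :
  snorm2 (a%:C%C *: v + b%:C%C *: w) =
  a ^+ 2 * snorm2 v + 2 * a * b * rdot v w + b ^+ 2 * snorm2 w.
Proof.
rewrite /snorm2 /rdot !mulr_sumr -!big_split /=; apply: eq_bigr => j _.
by rewrite !mxE /sqn !ReImE /=; ring.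
Qed.

(** The symbol [A] is Hermitian with [A^2 = mu^2], so its eigenvalues are [mu]
    and [-mu], and the one closest to [a >= 0] is [mu]. Concretely
    [|(A - a) v|^2 = (mu^2 + a^2) |v|^2 - 2 a <v, A v>], and
    [<v, A v> <= mu |v|^2] because [|mu v - A v|^2 >= 0]. *)
Lemma dirac_symbol_coercive m zeta k1 k2 a mu v :
  0 < mu -> mu ^+ 2 = k1 ^+ 2 + k2 ^+ 2 + (zeta ^+ 2 + m ^+ 2) -> 0 <= a ->
  (mu - a) ^+ 2 * snorm2 v <=
  snorm2 (dirac_symbol m zeta k1 k2 *m v - a%:C%C *: v).
Proof.
move=> mu0 muE a0; set w := _ *m v.
have wE : snorm2 w = mu ^+ 2 * snorm2 v by rewrite muE snorm2_dirac_symbol.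
have : 0 <= snorm2 (mu%:C%C *: v + (-1)%:C%C *: w) := snorm2_ge0 _.
have -> : w - a%:C%C *: v = (- a)%:C%C *: v + 1%:C%C *: w.
  by rewrite rmorphN scaleNr rmorph1 scale1r addrC.
rewrite !snorm2_lincomb wE => h.
have : rdot v w <= mu * snorm2 v by rewrite -(ler_pM2l mu0); move: h; lra.
move=> h2; have := ler_wpM2l a0 h2.
move: (snorm2 v) (rdot v w) => s t; nra.
Qed.

End DiracSymbol.

(** * Fourier coefficients of spinor fields *)

Section SpinorFourier.
Variables (R : realType) (l1 l2 : R).
Hypotheses (l1_gt0 : 0 < l1) (l2_gt0 : 0 < l2).
Local Notation cell := (@cell R l1 l2).
Local Notation leb2 := (leb2 R).
Local Notation fcoef := (fcoef l1 l2).
Local Notation area := (l1 * l2).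
Local Notation wgt := (wgt R).
Local Notation spinor_integrable := (spinor_integrable l1 l2).
Let mc := measurable_cell l1 l2.
Let area_gt0 : 0 < area. Proof. exact: mulr_gt0. Qed.
Implicit Types u : R * R -> spinor R.

Definition vfcoef u n : spinor R := \col_j fcoef (fun x => u x j 0) n.

Lemma spinor_integrableD u u' : spinor_integrable u -> spinor_integrable u' ->
  spinor_integrable (fun x => u x + u' x).
Proof.
by move=> iu iu' j; under eq_fun do rewrite mxE; exact: (cintegrableD mc).
Qed.

Lemma spinor_integrableZ c u : spinor_integrable u ->
  spinor_integrable (fun x => c *: u x).
Proof.
by move=> iu j; under eq_fun do rewrite mxE; exact: (cintegrableZ mc).
Qed.

Lemma spinor_integrableN u : spinor_integrable u -> spinor_integrable (fun x => - u x).
Proof.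
by move=> iu j; under eq_fun do rewrite mxE; exact: (cintegrableN mc).
Qed.

Lemma spinor_integrableB u u' : spinor_integrable u -> spinor_integrable u' ->
  spinor_integrable (fun x => u x - u' x).
Proof. by move=> iu /spinor_integrableN; exact: spinor_integrableD. Qed.

Lemma spinor_integrable_mulmx (M : 'M[R[i]]_4) u : spinor_integrable u ->
  spinor_integrable (fun x => M *m u x).
Proof.
move=> iu j; under eq_fun do rewrite mxE.
by apply: (cintegrable_sum mc) => k; exact: (cintegrableZ mc).
Qed.

Lemma spinor_integrable_cst (v : spinor R) : spinor_integrable (fun=> v).
Proof. by move=> j; exact: cintegrable_cst. Qed.

Lemma vfcoefD u u' n : spinor_integrable u -> spinor_integrable u' ->
  vfcoef (fun x => u x + u' x) n = vfcoef u n + vfcoef u' n.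
Proof.
move=> iu iu'; apply/matrixP => j k; rewrite !mxE -fcoefD//.
by apply: eq_fcoef => x; rewrite mxE.
Qed.

Lemma vfcoefZ c u n : spinor_integrable u ->
  vfcoef (fun x => c *: u x) n = c *: vfcoef u n.
Proof.
move=> iu; apply/matrixP => j k; rewrite !mxE -fcoefZ//.
by apply: eq_fcoef => x; rewrite mxE.
Qed.

Lemma vfcoefB u u' n : spinor_integrable u -> spinor_integrable u' ->
  vfcoef (fun x => u x - u' x) n = vfcoef u n - vfcoef u' n.
Proof.
move=> iu iu'; apply/matrixP => j k; rewrite !mxE -fcoefB//.
by apply: eq_fcoef => x; rewrite !mxE.
Qed.

Lemma vfcoef_mulmx (M : 'M[R[i]]_4) u n : spinor_integrable u ->
  vfcoef (fun x => M *m u x) n = M *m vfcoef u n.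
Proof.
move=> iu; apply/matrixP => j k; rewrite !mxE.
under eq_bigr do rewrite mxE -fcoefZ//.
rewrite -fcoef_sum; last by move=> i; exact: (cintegrableZ mc).
by apply: eq_fcoef => x; rewrite mxE.
Qed.

Lemma vfcoef_cst (v : spinor R) n :
  vfcoef (fun=> v) n = if n == 0 then area%:C%C *: v else 0.
Proof.
apply/matrixP => j k; rewrite (ord1 k) mxE (fcoef_cst l1_gt0 l2_gt0).
by case: ifP => _; rewrite mxE.
Qed.

Lemma ae_eq_fcoef (f g : R * R -> R[i]) n :
  cmeasurable cell f -> cmeasurable cell g ->
  {ae leb2, forall x, cell x -> f x = g x} -> fcoef f n = fcoef g n.
Proof.
move=> mf mg fg.
have [er ei] := cmeasurableM (cmeasurableJ (cmeasurable_expi l1 l2 n)) mf.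
have [gr gi] := cmeasurableM (cmeasurableJ (cmeasurable_expi l1 l2 n)) mg.
rewrite /fcoef /cint; congr Complex; congr fine; apply: ae_eq_integral => //.
- exact/measurable_EFinP.
- exact/measurable_EFinP.
- by apply: ae_imply fg => x fgx cx /=; rewrite fgx.
- exact/measurable_EFinP.
- exact/measurable_EFinP.
- by apply: ae_imply fg => x fgx cx /=; rewrite fgx.
Qed.

Lemma ae_eq_vfcoef u u' n : spinor_integrable u -> spinor_integrable u' ->
  ae_eq_torus l1 l2 u u' -> vfcoef u n = vfcoef u' n.
Proof.
move=> iu iu' uu'; apply/matrixP => j k; rewrite !mxE; apply: ae_eq_fcoef.
- exact: cintegrable_measurable (iu j).
- exact: cintegrable_measurable (iu' j).
- by apply: ae_imply uu' => x E cx; rewrite E.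
Qed.

(** Apply [sobolev_L4_le] with the bound 0 to each component of the
    difference. *)
Lemma vfcoef_inj u u' : spinor_integrable u -> spinor_integrable u' ->
  (forall n, vfcoef u n = vfcoef u' n) -> ae_eq_torus l1 l2 u u'.
Proof.
move=> iu iu' E.
have comp j : {ae leb2, forall x, cell x -> u x j 0 = u' x j 0}.
  have id : cintegrable leb2 cell (fun x => u x j 0 - u' x j 0).
    by apply: (cintegrableD mc) => //; exact: (cintegrableN mc).
  have z0 N : \sum_(n <- zbox N) wgt n * sqn (fcoef (fun x => u x j 0 - u' x j 0) n) <= 0.
    apply: sumr_le0 => n _; rewrite fcoefB//.
    by have := congr1 (fun M : spinor R => M j 0) (E n); rewrite !mxE => ->; rewrite subrr sqn0 mulr0.
  have := sobolev_L4_le l1_gt0 l2_gt0 id z0.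
  rewrite expr0n mulr0 => I0.
  have I00 : (\int[leb2]_(x in cell) (sqn (u x j 0 - u' x j 0) ^+ 2)%:E = 0)%E.
    apply/eqP; rewrite eq_le I0 /=; apply: integral_ge0 => x _.
    by rewrite lee_fin sqr_ge0.
  have ms : measurable_fun cell (fun x => (sqn (u x j 0 - u' x j 0) ^+ 2)%:E).
    exact/measurable_EFinP/measurable_funX/measurable_sqn/(cintegrable_measurable id).
  have : ae_eq leb2 cell (fun x => (sqn (u x j 0 - u' x j 0) ^+ 2)%:E) (cst 0%E).
    apply/ae_eq_integral_abs => //.
    by under eq_integral do rewrite gee0_abs ?lee_fin ?sqr_ge0//.
  apply: ae_imply => x h cx; have [/eqP] : (sqn (u x j 0 - u' x j 0) ^+ 2)%:E = 0%:E := h cx.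
  by rewrite expf_eq0 /= => /eqP/sqn_eq0/eqP; rewrite subr_eq0 => /eqP.
apply: ae_imply (ae_and (ae_and (comp s0) (comp s1)) (ae_and (comp s2) (comp s3))).
by move=> x [[h0 h1] [h2 h3]] cx; apply: spinorP; auto.
Qed.

Lemma cintegrable_realM (f : R * R -> R) (h : R * R -> R[i]) :
  continuous f -> cintegrable leb2 cell h ->
  cintegrable leb2 cell (fun x => (f x)%:C%C * h x).
Proof.
move=> cf ih; have [M fM] := bounded_on_cell l1 l2 cf.
apply: (cintegrableM_bounded mc (M := M)) => //.
  split => /=; last exact: measurable_cst.
  exact: (measurable_funTS (continuous_measurable_plane cf)).
by move=> x cx; rewrite /modc sqn_real sqrtr_sqr fM.
Qed.

Lemma fcoef_cos_sin (h : R * R -> R[i]) n : cintegrable leb2 cell h ->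
  fcoef h n = cint leb2 cell (fun x => (cos (freq l1 l2 n x))%:C%C * h x) -
    'i%C * cint leb2 cell (fun x => (sin (freq l1 l2 n x))%:C%C * h x).
Proof.
move=> ih.
have ic : cintegrable leb2 cell (fun x => (cos (freq l1 l2 n x))%:C%C * h x).
  by apply: cintegrable_realM => //; exact: cos_freq_continuous.
have is' : cintegrable leb2 cell (fun x => (sin (freq l1 l2 n x))%:C%C * h x).
  by apply: cintegrable_realM => //; exact: sin_freq_continuous.
rewrite -mulNr -(cintZ mc)// -(cintD mc)//; last exact: (cintegrableZ mc).
apply: eq_cint => x _; rewrite mulrA -mulrDl; congr (_ * _).
by apply: complex_ext; rewrite !ReImE /=; ring.
Qed.

(** The cosine and the sine of a frequency are test functions, and each is a
    multiple of the derivative of the other. *)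
Lemma fcoef_weak_derivative v u u' n j : spinor_integrable u -> spinor_integrable u' ->
  weak_derivative l1 l2 v u u' ->
  fcoef (fun x => u' x j 0) n =
  'i%C * (freq l1 l2 n v)%:C%C * fcoef (fun x => u x j 0) n.
Proof.
move=> iu iu' uu'; rewrite !fcoef_cos_sin//.
set k := freq l1 l2 n v.
have ic : cintegrable leb2 cell (fun x => (cos (freq l1 l2 n x))%:C%C * u x j 0).
  by apply: cintegrable_realM => //; exact: cos_freq_continuous.
have is' : cintegrable leb2 cell (fun x => (sin (freq l1 l2 n x))%:C%C * u x j 0).
  by apply: cintegrable_realM => //; exact: sin_freq_continuous.
have hc : cint leb2 cell (fun x => (cos (freq l1 l2 n x))%:C%C * u' x j 0) =
    k%:C%C * cint leb2 cell (fun x => (sin (freq l1 l2 n x))%:C%C * u x j 0).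
  rewrite -[RHS](cintZ mc)//.
  have /(congr1 -%R) := uu' _ (wave_test_fun l1_gt0 l2_gt0 1 0 n) j.
  rewrite opprK => H.
  transitivity (cint leb2 cell (fun x => (wave l1 l2 1 0 n x)%:C%C * u' x j 0)).
    by apply: eq_cint => x _; rewrite /wave mul1r mul0r addr0.
  rewrite -[LHS]H -[LHS](cintN mc); last first.
    apply: cintegrable_realM => //; rewrite derive_wave; exact: wave_continuous.
  apply: eq_cint => x _; rewrite derive_waveE /wave -/k mulrA -mulNr -rmorphM -rmorphN.
  by congr (_%:C%C * _); ring.
have hs : cint leb2 cell (fun x => (sin (freq l1 l2 n x))%:C%C * u' x j 0) =
    - k%:C%C * cint leb2 cell (fun x => (cos (freq l1 l2 n x))%:C%C * u x j 0).
  rewrite -[RHS](cintZ mc)//.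
  have /(congr1 -%R) := uu' _ (wave_test_fun l1_gt0 l2_gt0 0 1 n) j.
  rewrite opprK => H.
  transitivity (cint leb2 cell (fun x => (wave l1 l2 0 1 n x)%:C%C * u' x j 0)).
    by apply: eq_cint => x _; rewrite /wave mul1r mul0r add0r.
  rewrite -[LHS]H -[LHS](cintN mc); last first.
    apply: cintegrable_realM => //; rewrite derive_wave; exact: wave_continuous.
  apply: eq_cint => x _; rewrite derive_waveE /wave -/k.
  have -> : 1 * k * cos (freq l1 l2 n x) + - (0 * k) * sin (freq l1 l2 n x) =
    k * cos (freq l1 l2 n x) by ring.
  by rewrite rmorphM !mulNr -mulrA.
rewrite hc hs; have i2 := @sqr_i R; move: (cint _ _ _) (cint _ _ _) => a b.
have -> : 'i%C * k%:C%C * (a - 'i%C * b) = 'i%C * k%:C%C * a - 'i%C ^+ 2 * k%:C%C * b.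
  by ring.
by rewrite i2; ring.
Qed.

Lemma vfcoef_weak_derivative v u u' n : spinor_integrable u -> spinor_integrable u' ->
  weak_derivative l1 l2 v u u' ->
  vfcoef u' n = ('i%C * (freq l1 l2 n v)%:C%C) *: vfcoef u n.
Proof.
move=> iu iu' uu'; apply/matrixP => j k; rewrite !mxE.
exact: fcoef_weak_derivative.
Qed.

Lemma wpartial_spec p v u : 1 <= p -> in_W1p l1 l2 p u ->
  v = e1 R \/ v = e2 R ->
  spinor_integrable (wpartial l1 l2 v u) /\ weak_derivative l1 l2 v u (wpartial l1 l2 v u).
Proof.
move=> p1 [_ hW] hv; have [w wp wd] := hW v hv.
have w1 : in_Lp l1 l2 1 w by exact: (in_Lp1 l1_gt0 l2_gt0 p1).
have [h1 h2] := @xgetPex _ (fun=> 0)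
  [set w | in_Lp l1 l2 1 w /\ weak_derivative l1 l2 v u w] (ex_intro _ w (conj w1 wd)).
by split=> //; exact: (in_Lp_integrable l1_gt0 l2_gt0 (lexx 1)).
Qed.

Variables m zeta : R.

Definition symbol n := dirac_symbol m zeta (freq l1 l2 n (e1 R)) (freq l1 l2 n (e2 R)).

Lemma Dirac_integrable p u : 1 <= p -> in_W1p l1 l2 p u ->
  spinor_integrable (Dirac l1 l2 m zeta u).
Proof.
move=> p1 uW; have iu := in_Lp_integrable l1_gt0 l2_gt0 p1 uW.1.
have [i1 _] := wpartial_spec p1 uW (or_introl erefl).
have [i2 _] := wpartial_spec p1 uW (or_intror erefl).
apply: spinor_integrableD; first apply: spinor_integrableD.
- apply/spinor_integrableZ/spinor_integrableD; exact: spinor_integrable_mulmx.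
- exact/spinor_integrableZ/spinor_integrable_mulmx.
- exact/spinor_integrableZ/spinor_integrable_mulmx.
Qed.

Lemma vfcoef_first_order (G1 G2 G3 G0 : 'M[R[i]]_4) (c d e : R[i]) w w' u n :
  spinor_integrable w -> spinor_integrable w' -> spinor_integrable u ->
  vfcoef (fun x => c *: (G1 *m w x + G2 *m w' x) + d *: (G3 *m u x) + e *: (G0 *m u x)) n =
  c *: (G1 *m vfcoef w n + G2 *m vfcoef w' n) + d *: (G3 *m vfcoef u n)
    + e *: (G0 *m vfcoef u n).
Proof.
move=> iw iw' iu.
have iA := spinor_integrable_mulmx G1 iw.
have iB := spinor_integrable_mulmx G2 iw'.
have iC := spinor_integrable_mulmx G3 iu.
have iD := spinor_integrable_mulmx G0 iu.
have iAB := spinor_integrableD iA iB.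
rewrite (vfcoefD n (spinor_integrableD (spinor_integrableZ _ iAB)
  (spinor_integrableZ _ iC)) (spinor_integrableZ _ iD)).
rewrite (vfcoefD n (spinor_integrableZ _ iAB) (spinor_integrableZ _ iC)).
rewrite (vfcoefZ _ n iAB) (vfcoefZ _ n iC) (vfcoefZ _ n iD) (vfcoefD n iA iB).
by rewrite (vfcoef_mulmx G1 n iw) (vfcoef_mulmx G2 n iw') (vfcoef_mulmx G3 n iu)
  (vfcoef_mulmx G0 n iu).
Qed.

Lemma first_order_symbol (G1 G2 G3 G0 : 'M[R[i]]_4) (a b d e : R[i]) (v v' v'' : spinor R) :
  v' = ('i%C * a) *: v -> v'' = ('i%C * b) *: v ->
  - 'i%C *: (G1 *m v' + G2 *m v'') + d *: (G3 *m v) + e *: (G0 *m v) =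
  (a *: G1 + b *: G2 + d *: G3 + e *: G0) *m v.
Proof.
move=> -> ->; rewrite !mulmxDl -!scalemxAl -!scalemxAr.
by congr (_ + _ + _); rewrite scalerDr !scalerA; congr (_ *: _ + _ *: _);
  rewrite mulrA mulNr -expr2 sqr_i opprK mul1r.
Qed.

Lemma vfcoef_Dirac p u n : 1 <= p -> in_W1p l1 l2 p u ->
  vfcoef (Dirac l1 l2 m zeta u) n = symbol n *m vfcoef u n.
Proof.
move=> p1 uW; have iu := in_Lp_integrable l1_gt0 l2_gt0 p1 uW.1.
have [i1 d1] := wpartial_spec p1 uW (or_introl erefl).
have [i2 d2] := wpartial_spec p1 uW (or_intror erefl).
have E := vfcoef_first_order (gamma0 R *m gamma1 R) (gamma0 R *m gamma2 R)
  (gamma0 R *m gamma3 R) (gamma0 R) (- 'i%C) zeta%:C%C m%:C%C n i1 i2 iu.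
apply: (etrans E).
exact: first_order_symbol (vfcoef_weak_derivative n iu i1 d1)
  (vfcoef_weak_derivative n iu i2 d2).
Qed.

End SpinorFourier.

(** * The lowest positive eigenspace and its projection *)

Section SpectralProjection.
Variables (F : numFieldType) (n : nat) (M : 'M[F]_n) (L : F).
Hypotheses (L_neq0 : L != 0) (M_sqr : forall w : 'cV_n, M *m (M *m w) = (L ^+ 2) *: w).
Implicit Types w : 'cV[F]_n.

(** The projections on the eigenspaces of [M] for [L] and [-L], when [M]
    squares to [L ^+ 2]. *)
Definition spectral_plus w := (2 * L)^-1 *: (L *: w + M *m w).
Definition spectral_minus w := w - spectral_plus w.

Lemma mul_spectral_plus w : M *m spectral_plus w = L *: spectral_plus w.
Proof.
rewrite /spectral_plus -scalemxAr mulmxDr M_sqr -scalemxAr; move: (M *m w) => w'.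
by apply/matrixP => i j; rewrite !mxE; ring.
Qed.

Lemma mul_spectral_minus w : M *m spectral_minus w = - (L *: spectral_minus w).
Proof.
rewrite /spectral_minus mulmxBr mul_spectral_plus /spectral_plus; move: (M *m w) => w'.
by apply/matrixP => i j; rewrite !mxE; field.
Qed.

Lemma spectral_minus_linear a w : spectral_minus (M *m w - a *: w) = M *m spectral_minus w - a *: spectral_minus w.
Proof.
rewrite /spectral_minus [in RHS]mulmxBr mul_spectral_plus /spectral_plus mulmxBr M_sqr -scalemxAr; move: (M *m w) => w'.
by apply/matrixP => i j; rewrite !mxE; ring.
Qed.

Lemma spectral_plusZ a w : spectral_plus (a *: w) = a *: spectral_plus w.
Proof.
rewrite /spectral_plus -scalemxAr; move: (M *m w) => w'.
by apply/matrixP => i j; rewrite !mxE; ring.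
Qed.

Lemma spectral_decomposition w : spectral_plus w + spectral_minus w = w. Proof. by rewrite addrC subrK. Qed.

End SpectralProjection.

Section Eigenspace.
Variables (R : realType) (l1 l2 : R).
Hypotheses (l1_gt0 : 0 < l1) (l2_gt0 : 0 < l2).
Local Notation cell := (@cell R l1 l2).
Local Notation leb2 := (leb2 R).
Local Notation area := (l1 * l2).
Local Notation spinor_integrable := (spinor_integrable l1 l2).
Local Notation vfcoef := (vfcoef l1 l2).
Let mc := measurable_cell l1 l2.
Let area_gt0 : 0 < area. Proof. exact: mulr_gt0. Qed.
Variables m zeta : R.
Hypothesis m_gt0 : 0 < m.
Local Notation symbol := (symbol l1 l2 m zeta).
Implicit Types (u e : R * R -> spinor R) (v w : spinor R).

Definition lam : R := Num.sqrt (zeta ^+ 2 + m ^+ 2).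

Lemma lam_gt0 : 0 < lam.
Proof. by rewrite sqrtr_gt0 ltr_wpDl ?sqr_ge0// exprn_gt0. Qed.

Lemma sqr_lam : lam ^+ 2 = zeta ^+ 2 + m ^+ 2.
Proof. by rewrite sqr_sqrtr// addr_ge0 ?sqr_ge0. Qed.

(** The Dirac operator acts on constant spinors by this matrix. *)
Definition mass : 'M[R[i]]_4 := dirac_symbol m zeta 0 0.

Lemma symbol0 : symbol 0 = mass.
Proof. by rewrite /symbol !freq0n. Qed.

(** The positive eigenvalue of the symbol at the mode [n]. *)
Definition energy n : R :=
  Num.sqrt (freq l1 l2 n (e1 R) ^+ 2 + freq l1 l2 n (e2 R) ^+ 2 + lam ^+ 2).

Lemma energy_gt0 n : 0 < energy n.
Proof.
by rewrite sqrtr_gt0 ltr_wpDl ?addr_ge0 ?sqr_ge0// exprn_gt0// lam_gt0.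
Qed.

Lemma sqr_energy n : energy n ^+ 2 = freq l1 l2 n (e1 R) ^+ 2 + freq l1 l2 n (e2 R) ^+ 2 +
  (zeta ^+ 2 + m ^+ 2).
Proof. by rewrite sqr_sqrtr -?sqr_lam// !addr_ge0 ?sqr_ge0. Qed.

Lemma symbol_coercive n a v : 0 <= a ->
  (energy n - a) ^+ 2 * snorm2 v <= snorm2 (symbol n *m v - a%:C%C *: v).
Proof. by move=> a0; apply: dirac_symbol_coercive => //; [exact: energy_gt0|exact: sqr_energy]. Qed.

Lemma lam_lt_energy n : n != 0 -> lam < energy n.
Proof.
move=> n0; rewrite -ltr_sqr ?nnegrE ?ltW ?energy_gt0 ?lam_gt0// sqr_energy sqr_lam ltrDr.
rewrite lt_neqAle addr_ge0 ?sqr_ge0// andbT eq_sym paddr_eq0 ?sqr_ge0// !sqrf_eq0.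
by apply: contra n0 => /andP[/eqP h1 /eqP h2]; apply/eqP/(freq_eq0 l1_gt0 l2_gt0 h1 h2).
Qed.

Lemma mass_sqr v : mass *m (mass *m v) = (lam ^+ 2)%:C%C *: v.
Proof. by rewrite dirac_symbol_sqr expr0n !add0r sqr_lam. Qed.

(** The value of the constant spinor field which has the same zeroth Fourier
    coefficient. *)
Definition mean u : spinor R := (area^-1)%:C%C *: vfcoef u 0.

Lemma area_unit v : area%:C%C *: ((area^-1)%:C%C *: v) = v.
Proof. by rewrite scalerA -rmorphM divff ?scale1r// gt_eqF. Qed.

(** At a mode [n != 0] the eigenvalue [lam] lies strictly below [energy n], so
    coercivity kills the Fourier coefficient; uniqueness of Fourier series
    leaves a constant. *)
Lemma Eigen_ae_cst u : Eigen l1 l2 m zeta lam u ->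
  mass *m mean u = lam%:C%C *: mean u /\ ae_eq_torus l1 l2 u (fun=> mean u).
Proof.
move=> [uW uE].
have two : 1 <= 2 :> R by rewrite ler1n.
have iu := in_Lp_integrable l1_gt0 l2_gt0 two uW.1.
have E n : symbol n *m vfcoef u n = lam%:C%C *: vfcoef u n.
  rewrite -(vfcoef_Dirac l1_gt0 l2_gt0 m zeta n two uW) -vfcoefZ//.
  apply: ae_eq_vfcoef => //; first exact: (Dirac_integrable l1_gt0 l2_gt0 m zeta two uW).
  exact: spinor_integrableZ.
have u0 n : n != 0 -> vfcoef u n = 0.
  move=> n0; apply: snorm2_eq0.
  have := symbol_coercive n (vfcoef u n) (ltW lam_gt0).
  rewrite E subrr [snorm2 0](_ : _ = 0); last first.
    by rewrite /snorm2 big1// => j _; rewrite mxE sqn0.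
  have h : 0 < (energy n - lam) ^+ 2 by rewrite exprn_gt0// subr_gt0 lam_lt_energy.
  rewrite pmulr_rle0// => h'; apply/eqP; rewrite eq_le h' /=; exact: snorm2_ge0.
split; first by rewrite /mean -scalemxAr -symbol0 E !scalerA mulrC.
apply: vfcoef_inj => // [|n]; first exact: spinor_integrable_cst.
rewrite vfcoef_cst//; have [->|n0] := eqVneq n 0; last exact: u0.
by rewrite /mean area_unit.
Qed.

Lemma in_Lp_cst p v : 0 < p -> in_Lp l1 l2 p (fun=> v).
Proof.
move=> p0; split=> //.
by apply: (bounded_Lp_norm_lty l1_gt0 l2_gt0 (M := spinor_norm v)).
Qed.

Lemma weak_derivative_cst d v : d = e1 R \/ d = e2 R ->
  weak_derivative l1 l2 d (fun=> v) (fun=> 0).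
Proof.
move=> hd f tf j.
transitivity (cint leb2 cell (fun x => v j 0 * ('D_d f x)%:C%C)).
  by apply: eq_cint => x _; rewrite mulrC.
have cDf : continuous ('D_d f) by case: tf => _ /(_ 1%N)[_] /(_ d)[_] [].
rewrite (cintZ mc); last first.
  have := cintegrable_realM cDf (cintegrable_cst l1_gt0 l2_gt0 1).
  by under eq_fun do rewrite mulr1.
have -> : cint leb2 cell (fun x => ('D_d f x)%:C%C) = 0.
  apply: complex_ext => /=; first exact: integral_cell_derivative.
  by rewrite /Rintegral integral0.
rewrite mulr0; symmetry; apply/eqP; rewrite oppr_eq0; apply/eqP.
transitivity (cint leb2 cell (fun=> 0)).
  by apply: eq_cint => x _; rewrite mxE mulr0.
by apply: complex_ext => /=; rewrite /Rintegral integral0.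
Qed.

Lemma in_W1p_cst p v : 0 < p -> in_W1p l1 l2 p (fun=> v).
Proof.
move=> p0; split; first exact: in_Lp_cst.
by move=> d hd; exists (fun=> 0); [exact: in_Lp_cst|exact: weak_derivative_cst].
Qed.

(** The derivatives of a constant vanish only through the chosen
    representatives of its weak derivatives, so the equation is again checked on
    Fourier coefficients. *)
Lemma cst_Eigen v : mass *m v = lam%:C%C *: v -> Eigen l1 l2 m zeta lam (fun=> v).
Proof.
move=> vE; have two : 1 <= 2 :> R by rewrite ler1n.
have vW : in_W1p l1 l2 2 (fun=> v) by exact: in_W1p_cst.
split=> //; apply: vfcoef_inj => //.
- exact: (Dirac_integrable l1_gt0 l2_gt0 m zeta two vW).
- exact: spinor_integrable_cst.
- move=> n; rewrite (vfcoef_Dirac l1_gt0 l2_gt0 m zeta n two vW) !vfcoef_cst//.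
  have [->|_] := eqVneq n 0; last by rewrite mulmx0.
  by rewrite symbol0 -scalemxAr vE !scalerA mulrC.
Qed.

Lemma mean_cst v : mean (fun=> v) = v.
Proof.
by rewrite /mean vfcoef_cst// eqxx scalerA -rmorphM mulVf ?scale1r// gt_eqF.
Qed.

Lemma ae_eq_cst_inj v w : ae_eq_torus l1 l2 (fun=> v) (fun=> w) -> v = w.
Proof.
move=> vw; rewrite -(mean_cst v) -(mean_cst w) /mean; congr (_ *: _).
by apply: ae_eq_vfcoef => //; exact: spinor_integrable_cst.
Qed.

Lemma hdotZr v (c : R[i]) w : hdot v (c *: w) = c * hdot v w.
Proof. by rewrite /hdot mulr_sumr; apply: eq_bigr => j _; rewrite mxE mulrCA. Qed.

Lemma hdotDr v w w' : hdot v (w + w') = hdot v w + hdot v w'.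
Proof. by rewrite /hdot -big_split; apply: eq_bigr => j _; rewrite mxE mulrDr. Qed.

Lemma L2_inner_cst v u : spinor_integrable u ->
  L2_inner l1 l2 (fun=> v) u = hdot v (vfcoef u 0).
Proof.
move=> iu; rewrite /L2_inner.
transitivity (cint leb2 cell (fun x => \sum_j (v j 0)^*%C * u x j 0)) => //.
rewrite (cint_sum mc); last by move=> j; exact: (cintegrableZ mc).
apply: eq_bigr => j _; rewrite mxE (cintZ mc)//; congr (_ * _).
by apply: eq_cint => x _; rewrite expi0 conjc1 mul1r.
Qed.

Lemma L2_inner_ae v e u : spinor_integrable e -> spinor_integrable u ->
  ae_eq_torus l1 l2 e (fun=> v) -> L2_inner l1 l2 e u = hdot v (vfcoef u 0).
Proof.
move=> ie iu ev; rewrite -L2_inner_cst// /L2_inner.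
have me j : cmeasurable cell (fun x => (e x j 0)^*%C * u x j 0).
  apply: cmeasurableM; last exact: cintegrable_measurable (iu j).
  exact: cmeasurableJ (cintegrable_measurable (ie j)).
have mv j : cmeasurable cell (fun x => (v j 0)^*%C * u x j 0).
  apply: cmeasurableM; last exact: cintegrable_measurable (iu j).
  by split; exact: measurable_cst.
rewrite /cintegral /hdot; congr Complex; congr fine; apply: ae_eq_integral => //.
- apply/measurable_EFinP; under eq_fun do rewrite Re_sum.
  by apply: measurable_sum => j; case: (me j).
- apply/measurable_EFinP; under eq_fun do rewrite Re_sum.
  by apply: measurable_sum => j; case: (mv j).
- by apply: ae_imply ev => x E cx /=; rewrite E.
- apply/measurable_EFinP; under eq_fun do rewrite Im_sum.
  by apply: measurable_sum => j; case: (me j).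
- apply/measurable_EFinP; under eq_fun do rewrite Im_sum.
  by apply: measurable_sum => j; case: (mv j).
- by apply: ae_imply ev => x E cx /=; rewrite E.
Qed.

Lemma lamC_neq0 : lam%:C%C != 0 :> R[i].
Proof. by rewrite fmorph_eq0 gt_eqF// lam_gt0. Qed.

Lemma massC_sqr v : mass *m (mass *m v) = (lam%:C%C ^+ 2) *: v.
Proof. by rewrite -rmorphXn mass_sqr. Qed.

Lemma hdot_mass v w : hdot (mass *m v) w = hdot v (mass *m w).
Proof. exact: dirac_symbol_hermitian. Qed.

Lemma hdotNr v w : hdot v (- w) = - hdot v w.
Proof. by rewrite -scaleN1r hdotZr mulN1r. Qed.

Lemma hdotZl v (c : R[i]) w : hdot (c *: v) w = c^*%C * hdot v w.
Proof.
by rewrite /hdot mulr_sumr; apply: eq_bigr => j _; rewrite mxE conjcM mulrA.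
Qed.

Lemma hdot_eigen_orthogonal v w : mass *m v = lam%:C%C *: v ->
  mass *m w = - (lam%:C%C *: w) -> hdot v w = 0.
Proof.
move=> vE wE; have := hdot_mass v w; rewrite vE wE hdotNr hdotZl hdotZr conjc_real.
move=> /eqP; rewrite -addr_eq0 -mulr2n mulrn_eq0 /= mulf_eq0 => /orP[|/eqP//].
by move=> /eqP/(@complexI R) /eqP; rewrite gt_eqF// lam_gt0.
Qed.

(** Normalises [(lam + m, 0, zeta, 0)] and [(0, lam + m, 0, -zeta)] in the L^2
    norm of the torus. They span the eigenspace of [mass] for [lam]. *)
Definition eigen_scale : R := (Num.sqrt (area * (2 * lam * (lam + m))))^-1.
Definition eigen1 : spinor R :=
  \col_j ([:: eigen_scale * (lam + m); 0; eigen_scale * zeta; 0]`_j)%:C%C.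
Definition eigen2 : spinor R :=
  \col_j ([:: 0; eigen_scale * (lam + m); 0; - (eigen_scale * zeta)]`_j)%:C%C.

Lemma eigen1E : [/\ eigen1 s0 0 = (eigen_scale * (lam + m))%:C%C, eigen1 s1 0 = 0,
  eigen1 s2 0 = (eigen_scale * zeta)%:C%C & eigen1 s3 0 = 0].
Proof. by split; rewrite mxE. Qed.

Lemma eigen2E : [/\ eigen2 s0 0 = 0, eigen2 s1 0 = (eigen_scale * (lam + m))%:C%C,
  eigen2 s2 0 = 0 & eigen2 s3 0 = (- (eigen_scale * zeta))%:C%C].
Proof. by split; rewrite mxE. Qed.

Lemma eigen_scale_sqr : area * eigen_scale ^+ 2 * (2 * lam * (lam + m)) = 1.
Proof.
have l0 := lam_gt0; have h : 0 < area * (2 * lam * (lam + m)).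
  by rewrite !mulr_gt0// addr_gt0.
rewrite /eigen_scale exprVn sqr_sqrtr ?(ltW h)//.
by rewrite mulrAC mulfV// gt_eqF.
Qed.

Lemma massE v : [/\ (mass *m v) s0 0 = m%:C%C * v s0 0 + zeta%:C%C * v s2 0,
  (mass *m v) s1 0 = m%:C%C * v s1 0 - zeta%:C%C * v s3 0,
  (mass *m v) s2 0 = - m%:C%C * v s2 0 + zeta%:C%C * v s0 0 &
  (mass *m v) s3 0 = - m%:C%C * v s3 0 - zeta%:C%C * v s1 0].
Proof.
have [a0 a1 a2 a3] := dirac_symbolE m zeta 0 0 v.
rewrite /mass a0 a1 a2 a3 oppr0 (_ : Complex 0 0 = 0)//.
by split; rewrite mul0r addr0.
Qed.

Lemma sqr_lamC : lam%:C%C ^+ 2 = zeta%:C%C ^+ 2 + m%:C%C ^+ 2 :> R[i].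
Proof. by have := congr1 (real_complex R) sqr_lam; rewrite !(rmorphM, rmorphD, rmorphXn). Qed.

Lemma mass_eigen1 : mass *m eigen1 = lam%:C%C *: eigen1.
Proof.
have [h0 h1 h2 h3] := massE eigen1; have [e0 e1 e2 e3] := eigen1E.
have sl := sqr_lamC.
have sl' : zeta%:C%C ^+ 2 = lam%:C%C ^+ 2 - m%:C%C ^+ 2 :> R[i] by rewrite sl addrK.
apply: spinorP; rewrite [RHS]mxE ?h0 ?h1 ?h2 ?h3 ?e0 ?e1 ?e2 ?e3 ?rmorphM ?rmorphD /=;
  move: eigen_scale%:C%C lam%:C%C m%:C%C zeta%:C%C sl' => c L M Z sl'; try ring.
transitivity (M * (c * (L + M)) + c * Z ^+ 2); first by ring.
by rewrite sl'; ring.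
Qed.

Lemma mass_eigen2 : mass *m eigen2 = lam%:C%C *: eigen2.
Proof.
have [h0 h1 h2 h3] := massE eigen2; have [e0 e1 e2 e3] := eigen2E.
have sl := sqr_lamC.
have sl' : zeta%:C%C ^+ 2 = lam%:C%C ^+ 2 - m%:C%C ^+ 2 :> R[i] by rewrite sl addrK.
apply: spinorP; rewrite [RHS]mxE ?h0 ?h1 ?h2 ?h3 ?e0 ?e1 ?e2 ?e3 ?rmorphN ?rmorphM ?rmorphD /=;
  move: eigen_scale%:C%C lam%:C%C m%:C%C zeta%:C%C sl' => c L M Z sl'; try ring.
transitivity (M * (c * (L + M)) + c * Z ^+ 2); first by ring.
by rewrite sl'; ring.
Qed.

Lemma hdotE v w : hdot v w = (v s0 0)^*%C * w s0 0 + (v s1 0)^*%C * w s1 0 +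
  ((v s2 0)^*%C * w s2 0 + (v s3 0)^*%C * w s3 0).
Proof. by rewrite /hdot sum_spin. Qed.

(** The equations of an eigenvector reduce to two copies of
    [Z x = (L + M) y]; this is the expansion of [(x, y)] on the vector
    [c (L + M, Z)], of norm 1 for the pairing scaled by [A]. *)
Lemma eigen_component (A c L M Z x y : R[i]) : L + M != 0 -> L ^+ 2 = Z ^+ 2 + M ^+ 2 ->
  A * c ^+ 2 * (2 * L * (L + M)) = 1 -> Z * x = (L + M) * y ->
  x = A * (c * (L + M) * x + c * Z * y) * (c * (L + M)) /\
  y = A * (c * (L + M) * x + c * Z * y) * (c * Z).
Proof.
move=> lm0 sl sc q.
have E : (L + M) * (A * (c * (L + M) * x + c * Z * y)) * c = x.
  transitivity (A * c ^+ 2 * ((L + M) ^+ 2 * x + Z * ((L + M) * y))); first by ring.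
  rewrite -q -[RHS]mul1r -sc.
  transitivity (A * c ^+ 2 * (((L + M) ^+ 2 + Z ^+ 2) * x)); first by ring.
  rewrite (_ : Z ^+ 2 = L ^+ 2 - M ^+ 2); last by rewrite sl addrK.
  by ring.
split; first by rewrite -[LHS]E; ring.
apply: (mulfI lm0); rewrite -q -[in LHS]E; ring.
Qed.

Lemma eigen_expansion v : mass *m v = lam%:C%C *: v ->
  v = hdot eigen1 (area%:C%C *: v) *: eigen1 + hdot eigen2 (area%:C%C *: v) *: eigen2.
Proof.
move=> vE; have l0 := lam_gt0.
have comp j := congr1 (fun M : spinor R => M j 0) vE.
have [h0 h1 h2 h3] := massE v.
have := comp s2; have := comp s3; rewrite h2 h3 !mxE.
rewrite !hdotZr !hdotE; have [-> -> -> ->] := eigen1E; have [-> -> -> ->] := eigen2E.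
move=> k3 k2.
have sc : area%:C%C * eigen_scale%:C%C ^+ 2 * (2 * lam%:C%C * (lam%:C%C + m%:C%C)) = 1 :> R[i].
  have := congr1 (real_complex R) eigen_scale_sqr.
  by rewrite !(rmorphM, rmorphD, rmorphXn, rmorph1, rmorph_nat).
have sl : lam%:C%C ^+ 2 = zeta%:C%C ^+ 2 + m%:C%C ^+ 2 :> R[i].
  have := congr1 (real_complex R) sqr_lam.
  by rewrite !(rmorphM, rmorphD, rmorphXn).
have q2 : zeta%:C%C * v s0 0 = (lam%:C%C + m%:C%C) * v s2 0.
  by rewrite mulrDl -k2; ring.
have q3 : - zeta%:C%C * v s1 0 = (lam%:C%C + m%:C%C) * v s3 0.
  by rewrite mulrDl -k3; ring.
have lm0 : lam%:C%C + m%:C%C != 0 :> R[i].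
  by rewrite -rmorphD fmorph_eq0 gt_eqF// addr_gt0.
have [e0 e1 e2 e3] := eigen1E; have [d0 d1 d2 d3] := eigen2E.
have [k0 k2'] := eigen_component lm0 sl sc q2.
have sl' : lam%:C%C ^+ 2 = (- zeta%:C%C) ^+ 2 + m%:C%C ^+ 2 :> R[i] by rewrite sqrrN.
have [k1 k3'] := eigen_component lm0 sl' sc q3.
rewrite !conjc0 !mul0r !addr0 !add0r !conjc_real.
move: k0 k1 k2' k3'; move: area%:C%C => A k0 k1 k2' k3'.
rewrite rmorphN !rmorphM rmorphD -mulrN.
apply: spinorP; rewrite mxE [in RHS]mxE [X in _ = _ + X]mxE
  ?e0 ?e1 ?e2 ?e3 ?d0 ?d1 ?d2 ?d3 ?mulr0 ?addr0 ?add0r ?rmorphN ?rmorphM ?rmorphD -?mulrN //=.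
Qed.

Lemma hdot_eigen11 : hdot eigen1 (area%:C%C *: eigen1) = 1.
Proof.
have := congr1 (real_complex R) eigen_scale_sqr; rewrite rmorph1 => <-.
have [e0 e1 e2 e3] := eigen1E; have sl := sqr_lam.
rewrite hdotZr hdotE e0 e1 e2 e3 !conjc_real mulr0 !addr0 -!rmorphM -rmorphD -rmorphM.
congr (_%:C)%C.
have -> : zeta ^+ 2 = lam ^+ 2 - m ^+ 2 -> area * (eigen_scale * (lam + m) *
  (eigen_scale * (lam + m)) + eigen_scale * zeta * (eigen_scale * zeta)) =
  area * eigen_scale ^+ 2 * (2 * lam * (lam + m)) by move=> h; ring: h.
  by [].
by rewrite sl addrK.
Qed.

Lemma hdot_eigen22 : hdot eigen2 (area%:C%C *: eigen2) = 1.
Proof.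
rewrite -hdot_eigen11 !hdotZr !hdotE; congr (_ * _).
have [-> -> -> ->] := eigen1E; have [-> -> -> ->] := eigen2E.
by rewrite rmorphN conjcN mulrNN !mulr0 !add0r !addr0.
Qed.

Lemma hdot_eigen12 : hdot eigen1 (area%:C%C *: eigen2) = 0.
Proof.
rewrite hdotZr hdotE; have [-> -> -> ->] := eigen1E; have [-> -> -> ->] := eigen2E.
by rewrite conjc0 !mulr0 !mul0r !addr0 mulr0.
Qed.

Lemma hdot_eigen21 : hdot eigen2 (area%:C%C *: eigen1) = 0.
Proof.
rewrite hdotZr hdotE; have [-> -> -> ->] := eigen1E; have [-> -> -> ->] := eigen2E.
by rewrite conjc0 !mulr0 !mul0r !addr0 mulr0.
Qed.

Lemma Eigen_integrable u : Eigen l1 l2 m zeta lam u -> spinor_integrable u.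
Proof. by case=> -[uL _] _; apply: (in_Lp_integrable l1_gt0 l2_gt0 _ uL); rewrite ler1n. Qed.

(** The chosen basis is a default value unless some orthonormal basis exists,
    whence the need for an explicit one. *)
Lemma eigen_basis_exists :
  orthonormal_basis l1 l2 (Eigen l1 l2 m zeta lam) [:: fun=> eigen1; fun=> eigen2].
Proof.
split.
- move=> [|[|//]] _; apply: cst_Eigen; [exact: mass_eigen1|exact: mass_eigen2].
- move=> [|[|//]] [|[|//]] _ _ /=; rewrite L2_inner_cst//; do ?exact: spinor_integrable_cst;
    rewrite vfcoef_cst// eqxx.
  + exact: hdot_eigen11.
  + exact: hdot_eigen12.
  + exact: hdot_eigen21.
  + exact: hdot_eigen22.
- move=> u uE; have [vE uv] := Eigen_ae_cst uE; have iu := Eigen_integrable uE.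
  apply: ae_imply uv => x E cx; rewrite E// [LHS](eigen_expansion vE) [_ *: mean u]area_unit.
  by rewrite !big_ord_recl big_ord0 addr0 /= !L2_inner_cst.
Qed.

Local Notation basis := (eigenbasis l1 l2 m zeta).
Let b i := nth (fun=> 0) basis i.

Lemma eigenbasisP : orthonormal_basis l1 l2 (Eigen l1 l2 m zeta lam) basis.
Proof. exact: (@xgetPex _ [::] _ (ex_intro _ _ eigen_basis_exists)). Qed.

Lemma PrE u x : Pr l1 l2 m zeta u x = \sum_(i < size basis) L2_inner l1 l2 (b i) u *: b i x.
Proof. by rewrite /Pr (big_nth (fun=> 0)) big_mkord. Qed.

Lemma basis_Eigen i : (i < size basis)%N -> Eigen l1 l2 m zeta lam (b i).
Proof. by case: eigenbasisP => h _ _; exact: h. Qed.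

Let P w := \sum_(i < size basis) hdot (mean (b i)) w *: mean (b i).

(** Only the class of each basis element up to null sets is known, and that
    class is constant. *)
Lemma Pr_ae_sum u : spinor_integrable u -> ae_eq_torus l1 l2 (Pr l1 l2 m zeta u)
  (fun=> P (vfcoef u 0)).
Proof.
move=> iu; have h i : {ae leb2, forall x, (i < size basis)%N -> cell x -> b i x = mean (b i)}.
  have [ib|_] := ltnP i (size basis); last exact: aeW.
  by apply: ae_imply (Eigen_ae_cst (basis_Eigen ib)).2 => x E _.
apply: ae_imply (ae_foralln h) => x E cx; rewrite PrE; apply: eq_bigr => i _.
rewrite E//; congr (_ *: _).
apply: L2_inner_ae => //; first exact: Eigen_integrable (basis_Eigen (ltn_ord i)).
exact: (Eigen_ae_cst (basis_Eigen (ltn_ord i))).2.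
Qed.

Let P_eigen v : mass *m v = lam%:C%C *: v -> P (area%:C%C *: v) = v.
Proof.
move=> vE; symmetry; apply: ae_eq_cst_inj.
have := Pr_ae_sum (spinor_integrable_cst l1_gt0 l2_gt0 v); rewrite vfcoef_cst// eqxx => h1.
have [_ _ /(_ _ (cst_Eigen vE)) h2] := eigenbasisP.
apply: ae_imply (ae_and h1 h2) => x [H1 H2] cx.
exact: etrans (H2 cx) (etrans (esym (PrE _ _)) (H1 cx)).
Qed.

Let P_antieigen v : mass *m v = - (lam%:C%C *: v) -> P (area%:C%C *: v) = 0.
Proof.
move=> vE; rewrite /P big1// => i _; rewrite hdotZr (hdot_eigen_orthogonal _ vE).
  by rewrite mulr0 scale0r.
exact: (Eigen_ae_cst (basis_Eigen (ltn_ord i))).1.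
Qed.

Let P_D v w : P (v + w) = P v + P w.
Proof. by rewrite /P -big_split; apply: eq_bigr => i _; rewrite hdotDr scalerDl. Qed.

(** The projection on the chosen basis fixes the constants of the eigenspace
    (the spanning property of the basis, applied to them) and kills those for
    [-lam] (which are orthogonal to the former). This determines it on all
    constants, whatever the basis. *)
Lemma Pr_ae u : spinor_integrable u -> ae_eq_torus l1 l2 (Pr l1 l2 m zeta u)
  (fun=> spectral_plus mass lam%:C%C (mean u)).
Proof.
move=> iu; suff <- : P (vfcoef u 0) = spectral_plus mass lam%:C%C (mean u) by exact: Pr_ae_sum.
rewrite -(area_unit (vfcoef u 0)) -/(mean u) -[in LHS](spectral_decomposition mass lam%:C%C (mean u)).
rewrite scalerDr P_D P_eigen; last exact: mul_spectral_plus massC_sqr _.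
rewrite P_antieigen ?addr0//; exact: mul_spectral_minus lamC_neq0 massC_sqr _.
Qed.

Lemma Pr_integrable u : spinor_integrable (Pr l1 l2 m zeta u).
Proof.
move=> j; have -> : (fun x => Pr l1 l2 m zeta u x j 0) =
    fun x => \sum_(i < size basis) L2_inner l1 l2 (b i) u * b i x j 0.
  by apply/funext => x; rewrite PrE summxE; apply: eq_bigr => i _; rewrite mxE.
apply: (cintegrable_sum mc) => i; apply: (cintegrableZ mc).
exact: (Eigen_integrable (basis_Eigen (ltn_ord i))).
Qed.

Lemma Pr_perp_integrable u : spinor_integrable u -> spinor_integrable (Pr_perp l1 l2 m zeta u).
Proof. by move=> iu; apply: spinor_integrableB => //; exact: Pr_integrable. Qed.

Lemma vfcoef_Pr_perp u n : spinor_integrable u -> vfcoef (Pr_perp l1 l2 m zeta u) n =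
  if n == 0 then spectral_minus mass lam%:C%C (vfcoef u 0) else vfcoef u n.
Proof.
move=> iu; have ip := Pr_integrable u; rewrite /Pr_perp vfcoefB//.
rewrite (ae_eq_vfcoef n ip _ (Pr_ae iu)); last exact: spinor_integrable_cst.
rewrite vfcoef_cst//; case: ifP => [/eqP->|_]; last by rewrite subr0.
by rewrite /spectral_minus -spectral_plusZ area_unit.
Qed.

End Eigenspace.

(** * The elliptic estimate *)

Section EllipticEstimate.
Variables (R : realType) (l1 l2 : R).
Hypotheses (l1_gt0 : 0 < l1) (l2_gt0 : 0 < l2).
Local Notation cell := (@cell R l1 l2).
Local Notation leb2 := (leb2 R).
Local Notation fcoef := (fcoef l1 l2).
Local Notation area := (l1 * l2).
Local Notation wgt := (wgt R).
Local Notation vfcoef := (vfcoef l1 l2).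
Local Notation spinor_integrable := (spinor_integrable l1 l2).
Let mc := measurable_cell l1 l2.
Let area_gt0 : 0 < area. Proof. exact: mulr_gt0. Qed.
Implicit Types u g : R * R -> spinor R.

Lemma component_L4_le u j : spinor_integrable u -> forall K,
  (forall N, \sum_(n <- zbox N) wgt n * snorm2 (vfcoef u n) <= K) ->
  (\int[leb2]_(x in cell) (sqn (u x j 0) ^+ 2)%:E <= (2688 / area ^+ 3 * K ^+ 2)%:E)%E.
Proof.
move=> iu K uK; apply: (sobolev_L4_le l1_gt0 l2_gt0 (iu j)) => N.
apply: le_trans (uK N); apply: ler_sum => n _.
rewrite ler_wpM2l ?(ltW (wgt_gt0 _ _))//.
by apply: le_trans (sqn_le_snorm2 _ j); rewrite mxE.
Qed.

(** [(sum of four squares)^2 <= 4 (sum of their squares)], then the scalar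
    inequality for each component. *)
Lemma spinor_sobolev_L4_le u K : spinor_integrable u ->
  (forall N, \sum_(n <- zbox N) wgt n * snorm2 (vfcoef u n) <= K) ->
  (\int[leb2]_(x in cell) (spinor_norm (u x) `^ 4)%:E <=
   (16 * (2688 / area ^+ 3 * K ^+ 2))%:E)%E.
Proof.
move=> iu uK; have four0 : (0 <= 4%:E :> \bar R)%E by rewrite lee_fin.
have ms j : measurable_fun cell (fun x => (sqn (u x j 0) ^+ 2)%:E).
  exact/measurable_EFinP/measurable_funX/measurable_sqn/(cintegrable_measurable (iu j)).
have p0 j x : (0 <= (sqn (u x j 0) ^+ 2)%:E)%E by rewrite lee_fin sqr_ge0.
apply: (@le_trans _ _ (\int[leb2]_(x in cell)
   (4%:E * (\sum_(j < 4) (sqn (u x j 0) ^+ 2)%:E)))%E).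
  apply: ge0_le_integral => //.
  - by move=> x _; rewrite lee_fin powR_ge0.
  - apply/measurable_EFinP; apply: measurable_powR_comp.
    by apply: measurable_spinor_norm; exact: spinor_integrable_measurable.
  - by apply: measurable_funeM; exact: emeasurable_sum.
  - move=> x _; rewrite sumEFin -EFinM lee_fin (powR_mulrn 4) ?spinor_norm_ge0//.
    rewrite spinor_normE (exprM _ 2 2) sqr_sqrtr ?snorm2_ge0// /snorm2 !sum_spin.
    move: (sqn _) (sqn _) (sqn _) (sqn _) => a b c d.
    have := sqr_ge0 (a - b); have := sqr_ge0 (a - c); have := sqr_ge0 (a - d).
    have := sqr_ge0 (b - c); have := sqr_ge0 (b - d); have := sqr_ge0 (c - d); nra.
rewrite ge0_integralZl//; last 2 first.
- exact: emeasurable_sum.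
- by move=> x _; exact: sume_ge0.
rewrite ge0_integral_sum//.
apply: (@le_trans _ _ (4%:E * \sum_(j < 4) (2688 / area ^+ 3 * K ^+ 2)%:E)%E).
  by rewrite lee_wpmul2l//; apply: lee_sum => j _; exact: component_L4_le.
rewrite sumEFin -EFinM lee_fin big_const_ord iter_addr_0 -mulr_natl; lra.
Qed.

Definition elliptic_constant c := 16 * (2688 / area ^+ 3) * (16 / c ^+ 4 * (84 * area)).

Lemma elliptic_constant_ge0 c : 0 < c -> 0 <= elliptic_constant c.
Proof.
move=> c0; have a0 := ltW area_gt0; rewrite /elliptic_constant.
have a3 : 0 <= (area ^+ 3)^-1 by rewrite invr_ge0 exprn_ge0.
have c4 : 0 <= (c ^+ 4)^-1 by rewrite invr_ge0 exprn_ge0// ltW.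
apply: mulr_ge0; apply: mulr_ge0; [exact: ler0n| |exact: mulr_ge0 (ler0n _ _) _|].
  exact: mulr_ge0 (ler0n _ _) _.
exact: mulr_ge0 (ler0n _ _) _.
Qed.

(** A gain of one full derivative of [u] over [g] is spent in two halves: L^(4/3)
    into H^(-1/2) for [g], and H^(1/2) into L^4 for [u]. *)
Lemma elliptic_integral_le u g c : spinor_integrable u -> spinor_integrable g -> 0 < c ->
  rintegrable leb2 cell (fun x => spinor_norm (g x) `^ (4 / 3)) ->
  (forall n, (c * wgt n) ^+ 2 * snorm2 (vfcoef u n) <= snorm2 (vfcoef g n)) ->
  (\int[leb2]_(x in cell) (spinor_norm (u x) `^ 4)%:E <=
   (elliptic_constant c * (\int[leb2]_(x in cell) (spinor_norm (g x) `^ (4 / 3)))%R ^+ 3)%:E)%E.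
Proof.
move=> iu ig c0 g43 ug; set G := \int[_]_(_ in _) _.
have G0 : 0 <= G by apply: Rintegral_ge0 => x _; exact: powR_ge0.
pose Q := 84 * area * G ^+ 3.
have Q0 : 0 <= Q by rewrite !mulr_ge0 ?exprn_ge0// ltW.
have XQ N j : \sum_(n <- zbox N) sqn (vfcoef g n j 0) / wgt n <= Num.sqrt Q.
  have pow_le x : pow43 (g x j 0) <= spinor_norm (g x) `^ (4 / 3).
    rewrite /pow43 ge0_ler_powR ?nnegrE ?modc_ge0 ?spinor_norm_ge0//.
    exact: modc_le_spinor_norm.
  have mg : measurable_fun cell (fun x => pow43 (g x j 0)).
    apply: measurable_powR_comp; apply: measurable_modc.
    exact: cintegrable_measurable (ig j).
  have igj : rintegrable leb2 cell (fun x => pow43 (g x j 0)).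
    by apply: (rintegrable_le mc) g43 => // x _; rewrite ger0_norm ?pow43_ge0.
  have := fcoef_dual_le l1_gt0 l2_gt0 N (ig j) igj.
  have -> : \sum_(n <- zbox N) sqn (vfcoef g n j 0) / wgt n =
     \sum_(n <- zbox N) sqn (fcoef (fun x => g x j 0) n) / wgt n.
    by apply: eq_bigr => n _; rewrite mxE.
  set X := \sum_(_ <- _) _ => XG.
  have X0 : 0 <= X.
    by apply: sumr_ge0 => n _; rewrite mulr_ge0 ?sqn_ge0// invr_ge0 ltW ?wgt_gt0.
  rewrite -(ger0_norm X0) -sqrtr_sqr; apply: ler_wsqrtr; apply: (le_trans XG).
  rewrite /Q; apply: ler_wpM2l; first exact: mulr_ge0 (ler0n _ _) (ltW area_gt0).
  have i0 : 0 <= \int[leb2]_(x in cell) pow43 (g x j 0).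
    by apply: Rintegral_ge0 => x _; exact: pow43_ge0.
  have iG : \int[leb2]_(x in cell) pow43 (g x j 0) <= G by apply: le_Rintegral.
  by apply: (lerXn2r 3 _ _ iG); rewrite nnegrE; [exact: i0|exact: G0].
have -> : elliptic_constant c * G ^+ 3 =
    16 * (2688 / area ^+ 3 * (4 / c ^+ 2 * Num.sqrt Q) ^+ 2).
  rewrite [(_ * Num.sqrt Q) ^+ 2]exprMn sqr_sqrtr// /elliptic_constant /Q.
  have l10 : l1 != 0 by rewrite gt_eqF.
  have l20 : l2 != 0 by rewrite gt_eqF.
  have c00 : c != 0 by rewrite gt_eqF.
  by field; rewrite l10 l20 c00.
apply: spinor_sobolev_L4_le => // N.
apply: (@le_trans _ _ (\sum_(n <- zbox N) (c ^+ 2)^-1 * (snorm2 (vfcoef g n) / wgt n))).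
  apply: ler_sum => n _; have w0 := wgt_gt0 R n.
  rewrite -(ler_pM2l (exprn_gt0 2 c0)) mulVKf ?gt_eqF ?exprn_gt0//.
  rewrite ler_pdivlMr//; apply: le_trans (ug n).
  by rewrite le_eqVlt; apply/orP; left; apply/eqP; ring.
rewrite -mulr_sumr [leRHS](_ : _ = (c ^+ 2)^-1 * (4 * Num.sqrt Q)); last first.
  by rewrite mulrA [_ * 4]mulrC.
rewrite ler_wpM2l ?invr_ge0 ?sqr_ge0//.
under eq_bigr do rewrite /snorm2 mulr_suml.
rewrite exchange_big /=; apply: (@le_trans _ _ (\sum_(j < 4) Num.sqrt Q)).
  by apply: ler_sum => j _; exact: XQ.
by rewrite big_const_ord iter_addr_0 mulr_natl.
Qed.

(** The fourth root of [elliptic_integral_le]. The added 1 keeps the constant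
    positive, which settles the case where the right-hand norm is infinite. *)
Lemma elliptic_Lp_le u g c : spinor_integrable u -> spinor_integrable g -> 0 < c ->
  (forall n, (c * wgt n) ^+ 2 * snorm2 (vfcoef u n) <= snorm2 (vfcoef g n)) ->
  (Lp_norm l1 l2 4 u <= ((1 + elliptic_constant c) `^ 4^-1)%:E * Lp_norm l1 l2 (4 / 3) g)%E.
Proof.
move=> iu ig c0 ug; have C0 := elliptic_constant_ge0 c0.
have D0 : 0 < 1 + elliptic_constant c by rewrite ltr_pwDl.
have p0 : 0 < 4 / 3 :> R by rewrite divr_gt0.
have [goo|gfin] := eqVneq (Lp_norm l1 l2 (4 / 3) g) +oo%E.
  by rewrite goo gt0_muley ?leey// lte_fin powR_gt0.
have mg := measurable_spinor_norm (spinor_integrable_measurable ig).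
have g43 : rintegrable leb2 cell (fun x => spinor_norm (g x) `^ (4 / 3)).
  apply/integrableP; split; first by apply/measurable_EFinP; exact: measurable_powR_comp.
  under eq_integral do rewrite /= ger0_norm ?powR_ge0//.
  by apply: Lp_norm_lty => //; rewrite ltey.
have := elliptic_integral_le iu ig c0 g43 ug.
rewrite !Lp_normE//.
have GE : (\int[leb2]_(x in cell) (spinor_norm (g x) `^ (4 / 3))%:E)%E =
    ((\int[leb2]_(x in cell) (spinor_norm (g x) `^ (4 / 3)))%R)%:E.
  by rewrite /Rintegral fineK//; exact: integrable_fin_num.
rewrite GE; set G := (\int[_]_(_ in _) _)%R => h.
have G0 : 0 <= G by apply: Rintegral_ge0 => x _; exact: powR_ge0.
rewrite poweR_EFin -EFinM.
apply: (@le_trans _ _ (((elliptic_constant c * G ^+ 3)%:E `^ 4^-1)%E)).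
  have inI (y : \bar R) : (0 <= y)%E -> y \in `[0%E, +oo%E].
    by move=> y0; rewrite in_itv/= y0 leey.
  apply: (gt0_ler_poweR _ (inI _ _) (inI _ _) h); first by rewrite invr_ge0 ler0n.
    by apply: integral_ge0 => x _; rewrite lee_fin powR_ge0.
  by rewrite lee_fin; apply: mulr_ge0 => //; exact: exprn_ge0.
rewrite poweR_EFin lee_fin powRM ?exprn_ge0// ler_pM ?powR_ge0//.
  by rewrite ge0_ler_powR ?nnegrE ?(ltW D0)// lerDr.
by rewrite -powR_mulrn// -powRrM (_ : 3%:R * 4^-1 = (4 / 3)^-1)//; field.
Qed.

End EllipticEstimate.

Section SpectralGap.
Variables (R : realType) (l1 l2 : R).
Hypotheses (l1_gt0 : 0 < l1) (l2_gt0 : 0 < l2).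
Variables m zeta : R.
Hypothesis m_gt0 : 0 < m.
Local Notation lam := (lam m zeta).
Local Notation energy := (energy l1 l2 m zeta).

Definition min_freq := 2 * pi / Num.max l1 l2.

Lemma min_freq_gt0 : 0 < min_freq.
Proof. by rewrite divr_gt0 ?mulr_gt0 ?pi_gt0// lt_max l1_gt0. Qed.

Lemma min_freq_supn_le n :
  (min_freq * (supn n)%:R) ^+ 2 <= freq l1 l2 n (e1 R) ^+ 2 + freq l1 l2 n (e2 R) ^+ 2.
Proof.
rewrite freq_e1 freq_e2.
have max0 : 0 < Num.max l1 l2 by rewrite lt_max l1_gt0.
have side l (k : int) : 0 < l -> l <= Num.max l1 l2 ->
    (min_freq * (`|k|%N)%:R) ^+ 2 <= (2 * pi / l * k%:~R) ^+ 2.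
  move=> l0 ll; have e : (`|k|%N%:R) ^+ 2 = k%:~R ^+ 2 :> R.
    by rewrite -[RHS]real_normK ?num_real// -intr_norm -natr_absz.
  rewrite !(exprMn _ _ (_%:~R)) [leLHS]exprMn e ler_wpM2r ?sqr_ge0//.
  apply: lerXn2r; rewrite ?nnegrE ?divr_ge0 ?mulr_ge0 ?pi_ge0 ?(ltW l0) ?(ltW max0)//.
  by rewrite ler_wpM2l ?mulr_ge0 ?pi_ge0// lef_pV2.
have h1 := side _ n.1 l1_gt0; have h2 := side _ n.2 l2_gt0.
rewrite /supn; case: (leqP `|n.1| `|n.2|) => _.
  by apply: le_trans (h2 _) _; rewrite ?le_max ?lexx ?orbT// lerDr sqr_ge0.
by apply: le_trans (h1 _) _; rewrite ?le_max ?lexx ?orbT// lerDl sqr_ge0.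
Qed.

(** With [d = k^2 / (2 L + k) <= k] and [N >= 1],
    [(L + d N)^2 <= L^2 + d (2 L + k) N^2 = L^2 + k^2 N^2]. *)
Lemma spectral_gap_large_freq (k L M N : R) : 0 < k -> 0 < L -> 0 < M -> 1 <= N ->
  (k * N) ^+ 2 + L ^+ 2 <= M ^+ 2 -> k ^+ 2 / (2 * L + k) * N <= M - L.
Proof.
move=> k0 L0 M0 N1 H; set d := k ^+ 2 / (2 * L + k).
have Lk : 0 < 2 * L + k by rewrite addr_gt0// mulr_gt0.
have d0 : 0 < d by rewrite divr_gt0// exprn_gt0.
have dE : d * (2 * L + k) = k ^+ 2 by rewrite /d divfK// gt_eqF.
have dk : d <= k by rewrite /d ler_pdivrMr// expr2 ler_pM2l// lerDr mulr_ge0// ltW.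
rewrite lerBrDr -ler_sqr ?nnegrE ?(ltW M0)//; last first.
  by rewrite addr_ge0 ?(ltW L0)// mulr_ge0 ?(ltW d0)// (le_trans _ N1).
apply: le_trans H; rewrite sqrrD lerD2r ![(_ * N) ^+ 2]exprMn.
have N2 : N <= N ^+ 2 by rewrite expr2 ler_peMr// (le_trans _ N1).
have e1 : d ^+ 2 * N ^+ 2 <= d * k * N ^+ 2.
  by rewrite ler_wpM2r ?sqr_ge0// expr2 ler_pM2l.
have e2 : 2 * d * L * N <= 2 * d * L * N ^+ 2
  by apply: ler_wpM2l => //; apply: mulr_ge0 (ltW L0); apply: mulr_ge0 (ltW d0).
rewrite -dE -mulr_natl.
rewrite (_ : 2%:R * (d * N * L) = 2 * d * L * N); last by ring.
rewrite (_ : d * (2 * L + k) * N ^+ 2 = 2 * d * L * N ^+ 2 + d * k * N ^+ 2); last by ring.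
by rewrite addrC lerD.
Qed.

(** The first term bounds [energy n - lam] below for [n != 0], the factor 1/2
    accounting for [wgt n <= 2 |n|]. The second one serves the zero mode. *)
Definition gap_const := Num.min (min_freq ^+ 2 / (2 * lam + min_freq) / 2) lam.

Lemma gap_const_gt0 : 0 < gap_const.
Proof.
have l0 := lam_gt0 zeta m_gt0; have k0 := min_freq_gt0.
by rewrite lt_min l0 andbT !divr_gt0 ?exprn_gt0// addr_gt0// mulr_gt0.
Qed.

Lemma spectral_gap n : n != 0 -> gap_const * wgt R n <= energy n - lam.
Proof.
move=> n0; have l0 := lam_gt0 zeta m_gt0; have k0 := min_freq_gt0.
have N1 : 1 <= (supn n)%:R :> R.
  rewrite ler1n lt0n; apply: contra n0; rewrite /supn; case: n => a b /=.
  by rewrite -leqn0 geq_max !leqn0 !absz_eq0 => /andP[/eqP-> /eqP->].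
have H : (min_freq * (supn n)%:R) ^+ 2 + lam ^+ 2 <= energy n ^+ 2.
  by rewrite sqr_energy sqr_lam lerD2r min_freq_supn_le.
have := spectral_gap_large_freq k0 l0 (energy_gt0 l1 l2 zeta m_gt0 n) N1 H.
apply: le_trans; rewrite /gap_const; pose d := min_freq ^+ 2 / (2 * lam + min_freq); rewrite -/d.
have d0 : 0 < d by rewrite divr_gt0 ?exprn_gt0// addr_gt0// mulr_gt0.
apply: (@le_trans _ _ (d / 2 * wgt R n)).
  by rewrite ler_wpM2r ?(ltW (wgt_gt0 _ _))// ge_min lexx.
rewrite -mulrA ler_pM2l// /wgt -[(supn n).+1]addn1 natrD; lra.
Qed.

End SpectralGap.

Section Conclusion.
Variables (R : realType) (l1 l2 : R).
Hypotheses (l1_gt0 : 0 < l1) (l2_gt0 : 0 < l2).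
Variables m zeta : R.
Hypothesis m_gt0 : 0 < m.
Local Notation lam := (lam m zeta).
Local Notation symbol := (symbol l1 l2 m zeta).
Local Notation vfcoef := (vfcoef l1 l2).
Local Notation Pr_perp := (Pr_perp l1 l2 m zeta).
Local Notation Dirac := (Dirac l1 l2 m zeta).
Implicit Types (p a : R) (phi : R * R -> spinor R).

Lemma Dirac_shift_integrable p a phi : 1 <= p -> in_W1p l1 l2 p phi ->
  spinor_integrable l1 l2 (fun x => Dirac phi x - a%:C%C *: phi x).
Proof.
move=> p1 phiW; have iphi := in_Lp_integrable l1_gt0 l2_gt0 p1 phiW.1.
apply: spinor_integrableB => //; last exact: spinor_integrableZ.
exact: (Dirac_integrable l1_gt0 l2_gt0 m zeta p1 phiW).
Qed.

(** The projection is a function of the symbol at the zero mode and commutes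
    with it. *)
Lemma vfcoef_Pr_perp_Dirac p a phi n : 1 <= p -> in_W1p l1 l2 p phi ->
  vfcoef (Pr_perp (fun x => Dirac phi x - a%:C%C *: phi x)) n =
  symbol n *m vfcoef (Pr_perp phi) n - a%:C%C *: vfcoef (Pr_perp phi) n.
Proof.
move=> p1 phiW; have iphi := in_Lp_integrable l1_gt0 l2_gt0 p1 phiW.1.
have iD := Dirac_integrable l1_gt0 l2_gt0 m zeta p1 phiW.
have E k : vfcoef (fun x => Dirac phi x - a%:C%C *: phi x) k =
    symbol k *m vfcoef phi k - a%:C%C *: vfcoef phi k.
  rewrite vfcoefB//; last exact: spinor_integrableZ.
  by rewrite vfcoefZ// (vfcoef_Dirac l1_gt0 l2_gt0 m zeta k p1 phiW).
rewrite !vfcoef_Pr_perp//; last exact: Dirac_shift_integrable phiW.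
rewrite !E; case: ifP => [/eqP->|//].
by rewrite symbol0 spectral_minus_linear//; exact: massC_sqr.
Qed.

Lemma snorm2Z (c : R[i]) (v : spinor R) : snorm2 (c *: v) = sqn c * snorm2 v.
Proof. by rewrite /snorm2 mulr_sumr; apply: eq_bigr => j _; rewrite mxE sqnM. Qed.

(** Off the zero mode this is the spectral gap, as [a <= lam]. On the zero mode
    the projected coefficient satisfies [mass v = - lam v], so [mass - a] acts on
    it as the scalar [-(lam + a)]. *)
Lemma Pr_perp_coercive p a phi n : 0 <= a <= lam -> 1 <= p -> in_W1p l1 l2 p phi ->
  (gap_const l1 l2 m zeta * wgt R n) ^+ 2 * snorm2 (vfcoef (Pr_perp phi) n) <=
  snorm2 (vfcoef (Pr_perp (fun x => Dirac phi x - a%:C%C *: phi x)) n).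
Proof.
move=> /andP[a0 alam] p1 phiW; have iphi := in_Lp_integrable l1_gt0 l2_gt0 p1 phiW.1.
have gap0 : 0 < gap_const l1 l2 m zeta by exact: gap_const_gt0.
have w0 := wgt_gt0 R n.
rewrite (vfcoef_Pr_perp_Dirac _ _ p1 phiW); have [->|n0] := eqVneq n 0.
  rewrite symbol0 [vfcoef _ 0]vfcoef_Pr_perp// eqxx; set v := spectral_minus _ _ _.
  have -> : mass m zeta *m v = - (lam%:C%C *: v).
    by apply: mul_spectral_minus; [exact: lamC_neq0|exact: massC_sqr].
  rewrite -opprD -scalerDl -scaleNr snorm2Z ler_wpM2r ?snorm2_ge0//.
  rewrite -rmorphD -rmorphN sqn_real sqrrN lerXn2r ?nnegrE//.
  - by rewrite mulr_ge0// ltW.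
  - by rewrite addr_ge0// ltW// lam_gt0.
  - rewrite /wgt mulr1; apply: (@le_trans _ _ lam); last by rewrite lerDl.
    by rewrite /gap_const ge_min lexx orbT.
apply: le_trans (symbol_coercive l1 l2 zeta m_gt0 n _ a0).
rewrite ler_wpM2r ?snorm2_ge0// lerXn2r ?nnegrE ?mulr_ge0 ?(ltW gap0) ?(ltW w0)//.
  by rewrite subr_ge0 (le_trans alam)// ltW// lam_lt_energy.
apply: le_trans (spectral_gap l1_gt0 l2_gt0 zeta m_gt0 n0) _.
by rewrite lerD2l lerN2.
Qed.

End Conclusion.

Theorem lemma4p4 (R : realType) (m l1 l2 zeta : R)
    (hm : 0 < m) (hl1 : 0 < l1) (hl2 : 0 < l2) :
  exists C : R,
    forall (l3 : R) (k : int), 0 < l3 -> zeta = 2 * pi / l3 * k%:~R ->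
    forall a : R, 0 <= a -> a <= Num.sqrt (zeta ^+ 2 + m ^+ 2) ->
    forall phi : R * R -> 'cV[R[i]]_4, in_W1p l1 l2 (4 / 3) phi ->
      (Lp_norm l1 l2 4%R (Pr_perp l1 l2 m zeta phi) <=
       C%:E * Lp_norm l1 l2 (4 / 3)%R
                (Pr_perp l1 l2 m zeta
                   (fun x => Dirac l1 l2 m zeta phi x - a%:C%C *: phi x)%R))%E.
Proof.
exists ((1 + elliptic_constant l1 l2 (gap_const l1 l2 m zeta)) `^ 4^-1).
move=> l3 k _ _ a a0 alam phi phiW.
have p1 : 1 <= 4 / 3 :> R by rewrite ler_pdivlMr// mul1r ler_nat.
have iphi := in_Lp_integrable hl1 hl2 p1 phiW.1.
apply: elliptic_Lp_le => //.
- exact: Pr_perp_integrable.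
- by apply: Pr_perp_integrable => //; exact: Dirac_shift_integrable phiW.
- exact: gap_const_gt0.
- by move=> n; apply: Pr_perp_coercive phiW => //; rewrite a0.
Qed.
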